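(* Let $g_X(\cdot)$ be a Ricci flow on $X$, defined for all $t\ge0$, with complete time slices and bounded curvature on compact time intervals, whose initial metric $g_X(0)$ is asymptotically conical (with basepoint $x_0$) with asymptotic cone $(CY,g_{CY})$, vertex $\star$. Let $d_0$ be the time-zero distance. Let $\epsilon>0$ be such that for some $R<\infty$ and some constants $C_k<\infty$ ($k\ge0$), one has $|\nabla^k\mathrm{Rm}|(x,t)\le C_k\,d_0(x,x_0)^{-2-k}$ for all $k\ge 0$ whenever $d_0(x,x_0)\ge R$ and $t\le\epsilon\,d_0(x,x_0)^2$. For any sequence $r_i\to\infty$, after passing to a subsequence there is a smooth Ricci flow solution $g_\infty$ defined on $\{(x,t)\in(CY-\star)\times[0,\infty):0\le t\le\epsilon\,d(x,\star)^2\}$ so that (i) $g_\infty(0)=g_{CY}$, and (ii) $\lim_{i\to\infty}\frac1{r_i^2}g_X(r_i^2t)=g_\infty(t)$, with smooth convergence on annuli. More precisely, given $0<R_1<R_2<\infty$, for large $i$ there are smooth embeddings $\phi_{R_1,R_2,i}:(R_1,R_2)\times Y\to X$ so that $\lim_{i\to\infty}\frac1{r_i^2}\phi_{R_1,R_2,i}^*g_X(r_i^2t)=g_\infty(t)$, provided that $t\le\epsilon R_1^2$.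
   Context: Ricci flow: $\partial_tg=-2\mathrm{Ric}(g)$. For a compact Riemannian manifold $(Y,g_Y)$, $CY=((0,\infty)\times Y)\cup\{\star\}$ is the cone, with metric $g_{CY}=dR^2+R^2g_Y$ on $CY-\star$; $\frac1\lambda X$ denotes $X$ with distances divided by $\lambda$. A complete pointed Riemannian manifold $(X,x_0,g_X)$ is asymptotically conical with asymptotic cone $(CY,g_{CY})$ if there is a pointed Gromov-Hausdorff limit $\lim_{\lambda\to\infty}(\frac1\lambda X,x_0)=(CY,\star)$ such that for all $0<R_1<R_2<\infty$ there is a smooth limit $\lim_{\lambda\to\infty}\frac1\lambda A(\lambda R_1,\lambda R_2)=\overline{B(\star,R_2)}-B(\star,R_1)$, where $A(a,b)=\overline{B(x_0,b)}-B(x_0,a)$; the same maps are used to define the Gromov-Hausdorff limit and the smooth limits. (An $\epsilon$ as in the claim always exists, by separate propositions of the paper.) *)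

(* Defs.v *)
From HB Require Import structures.
From mathcomp Require Import all_boot all_order all_algebra.
From mathcomp Require Import all_classical all_reals all_analysis.

Set Implicit Arguments.
Unset Strict Implicit.
Unset Printing Implicit Defensive.
Import Order.TTheory GRing.Theory Num.Theory.
Import numFieldNormedType.Exports.

Local Open Scope classical_set_scope.
Local Open Scope ring_scope.

(* Calculus within a set D.  Derivatives are Frechet derivatives relative to D,
   so that functions can be differentiated up to the boundary of domains such
   as U x [0, oo[ or {0 <= t <= eps * r^2}.  When D is open these are the
   ordinary derivatives; on all the sets used below, which are locally the
   closure of their interior with regular boundary, they are unique. *)
Section Calculus.
Context {R : realType} {V : normedModType R}.

Definition has_diff_within (D : set V) (f : V -> R) (p : V)
    (L : {linear V -> R^o}) : Prop :=
  continuous (L : V -> R^o) /\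
  forall e : R, 0 < e -> \forall q \near within D (nbhs p),
    `|f q - f p - L (q - p)| <= e * `|q - p|.

Definition deriv_within (D : set V) (v : V) (f : V -> R) (p : V) : R :=
  xget 0 [set c : R | exists L, has_diff_within D f p L /\ c = L v].

Definition derivs_within (D : set V) (s : seq V) (f : V -> R) : V -> R :=
  foldr (deriv_within D) f s.

Definition smooth_on (D : set V) (f : V -> R) : Prop :=
  forall (s : seq V) (p : V), D p ->
    exists L, has_diff_within D (derivs_within D s f) p L.

(* C^oo convergence, locally uniformly on D *)
Definition smooth_cvg_on {I : Type} (F : set_system I) (D : set V)
    (f : I -> V -> R) (f0 : V -> R) : Prop :=
  forall (K : set V) (s : seq V) (e : R), compact K -> K `<=` D -> 0 < e ->
    \forall l \near F, forall p, K p ->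
      `|derivs_within D s (f l) p - derivs_within D s f0 p| < e.

End Calculus.

(* The geometry of a metric given by its matrix G : D -> 'M_n in coordinates. *)
Section LocalGeometry.
Context {R : realType} {n : nat}.
Variables (D : set 'rV[R]_n) (G : 'rV[R]_n -> 'M[R]_n).

Definition pd (i : 'I_n) (f : 'rV[R]_n -> R) : 'rV[R]_n -> R :=
  deriv_within D (delta_mx 0 i) f.

(* Gamma^k_{ij} *)
Definition christoffel (k i j : 'I_n) (x : 'rV[R]_n) : R :=
  2^-1 * \sum_(l < n) invmx (G x) k l *
    (pd i (fun y => G y j l) x + pd j (fun y => G y i l) x
     - pd l (fun y => G y i j) x).

(* R(d_i, d_j) d_k = sum_l (riem l i j k) d_l *)
Definition riem (l i j k : 'I_n) (x : 'rV[R]_n) : R :=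
  pd i (christoffel l j k) x - pd j (christoffel l i k) x
  + \sum_(m < n) (christoffel l i m x * christoffel m j k x
                  - christoffel l j m x * christoffel m i k x).

Definition ricci (j k : 'I_n) (x : 'rV[R]_n) : R :=
  \sum_(i < n) riem i i j k x.

(* A covariant tensor of rank r is given by its components T I for the lists I
   of r indices; the components at lists of another length are irrelevant. *)
Definition tensor : Type := seq 'I_n -> 'rV[R]_n -> R.

Definition Rm : tensor := fun I x =>
  if I is [:: i; j; k; l] then \sum_(m < n) riem m i j k x * G x m l else 0.

Definition nabla (T : tensor) : tensor := fun I x =>
  if I is i :: J then
    pd i (T J) x
    - \sum_(p < size J) \sum_(m < n)
        christoffel m i (nth i J p) x * T (set_nth i J p m) x
  else 0.

Definition tensor_norm (r : nat) (T : tensor) (x : 'rV[R]_n) : R :=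
  Num.sqrt (\sum_(I : r.-tuple 'I_n) \sum_(J : r.-tuple 'I_n)
    (\prod_(p < r) invmx (G x) (tnth I p) (tnth J p)) * (T I x * T J x)).

(* |nabla^k Rm| *)
Definition nablaRm_norm (k : nat) : 'rV[R]_n -> R :=
  tensor_norm (4 + k) (iter k nabla Rm).

End LocalGeometry.

(* The data of a family of charts on X; the axioms are in smooth_manifold.
   Only the restrictions of cmap i to cdom i and of cinv i to cimg i matter. *)
Record atlas (R : realType) (n : nat) (X : topologicalType) : Type := Atlas {
  idx : Type;
  cdom : idx -> set X;
  cmap : idx -> X -> 'rV[R]_n;
  cinv : idx -> 'rV[R]_n -> X }.

Section Maps.
Context {R : realType} {m n : nat} {M N : topologicalType}.
Variables (A : atlas R m M) (B : atlas R n N) (S : set M) (phi : M -> N).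

(* phi|S in the charts i of M and j of N *)
Definition rep_dom (i : idx A) (j : idx B) : set 'rV[R]_m :=
  cmap i @` (S `&` cdom i `&` phi @^-1` cdom j).

Definition rep (i : idx A) (j : idx B) (q : 'rV[R]_m) : 'rV[R]_n :=
  cmap j (phi (cinv i q)).

Definition jac (i : idx A) (j : idx B) (q : 'rV[R]_m) : 'M[R]_(m, n) :=
  \matrix_(k, l) deriv_within (rep_dom i j) (delta_mx 0 k)
                   (fun q' => rep i j q' 0 l) q.

Definition smooth_map : Prop :=
  {within S, continuous phi} /\
  forall i j l, smooth_on (rep_dom i j) (fun q => rep i j q 0 l).

Definition smooth_embedding : Prop :=
  [/\ smooth_map,
      forall i j x, S x -> cdom i x -> cdom j (phi x) ->
        row_free (jac i j (cmap i x)),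
      forall x y, S x -> S y -> phi x = phi y -> x = y
    & (* homeomorphism onto the image *)
      forall U : set M, open U ->
        exists2 O : set N, open O & phi @` (U `&` S) = O `&` phi @` S].

End Maps.

Definition smooth_manifold (R : realType) (n : nat) (X : topologicalType)
    (A : atlas R n X) : Prop :=
  [/\ hausdorff_space X,
      @second_countable X,
      forall x : X, exists i : idx A, cdom i x,
      forall i : idx A,
        [/\ open (cdom i), open (cmap i @` cdom i),
            forall x, cdom i x -> cinv i (cmap i x) = x,
            {within cdom i, continuous (cmap i)}
          & {within cmap i @` cdom i, continuous (cinv i)}]
    & (* the coordinate changes are smooth *)
      smooth_map A A setT id].

(* 2-tensors, given by their matrices in the charts; see metric_at for the
   change of charts. *)
Definition metric (R : realType) (n : nat) (X : topologicalType)
    (A : atlas R n X) : Type := idx A -> 'rV[R]_n -> 'M[R]_n.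

Section RiemannianGeometry.
Context {R : realType} {n : nat} {X : topologicalType}.
Variable A : atlas R n X.

Definition metric_at (g : metric A) (x : X) : Prop :=
  forall i : idx A, cdom i x ->
    [/\ (g i (cmap i x))^T = g i (cmap i x),
        forall v : 'rV[R]_n, v != 0 ->
          0 < (v *m g i (cmap i x) *m v^T) 0 0
      & forall j : idx A, cdom j x ->
          let J := jac setT id i j (cmap i x) in
          g i (cmap i x) = J *m g j (cmap j x) *m J^T].

Definition riemannian_metric (g : metric A) : Prop :=
  (forall x, metric_at g x) /\
  forall i k l, smooth_on (cmap i @` cdom i) (fun q => g i q k l).

Definition piecewise_smooth (c : R -> X) : Prop :=
  [/\ {within `[0, 1], continuous c},
      forall t, `[0, 1]%classic t -> exists i : idx A, cdom i (c t)
    & exists s : seq R,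
      [/\ sorted <%R (0 :: s), last 0 s = 1
        & forall (k : nat) (i : idx A) (l : 'I_n), (k < size s)%N ->
            smooth_on (`[nth 0 (0 :: s) k, nth 0 s k] `&` c @^-1` cdom i)
                      (fun t => cmap i (c t) 0 l)]].

(* |c'(t)|, computed in any chart around c t; the value does not depend on the
   chart *)
Definition speed (g : metric A) (c : R -> X) (t : R) : R :=
  xget 0 [set v : R | exists2 i : idx A, cdom i (c t) &
    let c' : 'rV[R]_n := \row_l derive1 (fun u => cmap i (c u) 0 l) t in
    v = Num.sqrt ((c' *m g i (cmap i (c t)) *m c'^T) 0 0)].

Definition curve_length (g : metric A) (c : R -> X) : \bar R :=
  (\int[(@lebesgue_measure R)]_(t in `[0%R, 1%R]) (speed g c t)%:E)%E.

(* +oo between distinct components *)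
Definition edist (g : metric A) (x y : X) : \bar R :=
  ereal_inf [set l | exists c : R -> X,
    [/\ piecewise_smooth c, c 0 = x, c 1 = y & l = curve_length g c]].

Definition dist (g : metric A) (x y : X) : R := fine (edist g x y).

Definition complete_metric (g : metric A) : Prop :=
  forall u : nat -> X,
    (forall e : R, 0 < e -> exists N, forall p q : nat,
       (N <= p)%N -> (N <= q)%N -> dist g (u p) (u q) < e) ->
    exists x, dist g (u k) x @[k --> \oo] --> (0 : R).

(* |nabla^k Rm|(x) <= C; the left-hand side does not depend on the chart *)
Definition nablaRm_le (g : metric A) (k : nat) (x : X) (C : R) : Prop :=
  forall i : idx A, cdom i x ->
    nablaRm_norm (cmap i @` cdom i) (g i) k (cmap i x) <= C.

(* the part of the space-time domain W lying over a chart *)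
Definition spacetime_chart (W : set (X * R)) (i : idx A) :
    set ('rV[R]_n * R) :=
  (fun p => (cmap i p.1, p.2)) @` (W `&` [set p | cdom i p.1]).

(* A smooth solution of dg/dt = -2 Ric(g) on the space-time domain W.  The time
   slices of W need not be open, whence the Ricci tensor relative to the
   slice. *)
Definition ricci_flow (W : set (X * R)) (g : R -> metric A) : Prop :=
  [/\ forall x t, W (x, t) -> metric_at (g t) x,
      forall i k l, smooth_on (spacetime_chart W i) (fun p => g p.2 i p.1 k l)
    & forall i q t k l, spacetime_chart W i (q, t) ->
        deriv_within (spacetime_chart W i) (0, 1) (fun p => g p.2 i p.1 k l)
          (q, t)
        = - 2 * ricci [set q' | spacetime_chart W i (q', t)] (g t i) k l q].

End RiemannianGeometry.

Section Pullback.
Context {R : realType} {m n : nat} {M N : topologicalType}.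
Variables (A : atlas R m M) (B : atlas R n N).

(* The pullback by phi|S, computed in any chart of N; the value does not depend
   on the chart when g is a metric. *)
Definition pullback (S : set M) (phi : M -> N) (g : metric B)
    (i : idx A) (q : 'rV[R]_m) : 'M[R]_m :=
  xget 0 [set Q : 'M[R]_m |
    exists2 j : idx B, cdom j (phi (cinv i q)) &
      let J := jac S phi i j q in Q = J *m g j (rep phi i j q) *m J^T].

End Pullback.

Section Cone.
Context {R : realType} {n : nat} {Y : topologicalType}.
Variable AY : atlas R n Y.

(* The charts (r, y) |-> (r, chart y) of ]0, oo[ x Y, seen inside R * Y. *)
Definition cone_atlas : atlas R n.+1 (R * Y)%type :=
  @Atlas R n.+1 (R * Y)%type (idx AY)
    (fun i => [set p | 0 < p.1 /\ cdom i p.2])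
    (fun i p => row_mx (p.1%:M : 'rV[R]_1) (cmap i p.2))
    (fun i q => ((lsubmx (q : 'rV[R]_(1 + n))) 0 0,
                 cinv i (rsubmx (q : 'rV[R]_(1 + n))))).

(* dr^2 + r^2 g_Y *)
Definition cone_metric (gY : metric AY) : metric cone_atlas :=
  fun (i : idx AY) (q : 'rV[R]_(1 + n)) =>
    block_mx (1%:M : 'M[R]_1) 0 0 ((lsubmx q 0 0) ^+ 2 *: gY i (rsubmx q)).

(* CY = (]0, oo[ x Y) + {vertex}, the vertex being None *)
Definition cone : set (option (R * Y)) :=
  [set p | if p is Some (r, _) then 0 < r else True].

(* The length metric on CY: a path from p to q either stays in CY - vertex, or
   goes through the vertex and then has length at least r_p + r_q. *)
Definition cone_dist (gY : metric AY) (p q : option (R * Y)) : R :=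
  match p, q with
  | None, None => 0
  | None, Some a | Some a, None => a.1
  | Some a, Some b =>
      fine (Order.min (edist (cone_metric gY) a b) (a.1 + b.1)%:E)
  end.

Definition open_annulus (R1 R2 : R) : set (R * Y) := [set p | R1 < p.1 < R2].
Definition closed_annulus (R1 R2 : R) : set (R * Y) :=
  [set p | R1 <= p.1 <= R2].

End Cone.
Arguments open_annulus {R Y}.
Arguments closed_annulus {R Y}.
Arguments cone {R Y}.

Section AsymptoticallyConical.
Context {R : realType} {n : nat} {X Y : topologicalType}.
Variables (A : atlas R n.+1 X) (AY : atlas R n Y).

(* A(a, b) = closure B(x0, b) - B(x0, a) *)
Definition annulus (g : metric A) (x0 : X) (a b : R) : set X :=
  closure [set x | dist g x x0 < b] `\` [set x | dist g x x0 < a].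

(* The maps F l : CY -> X realise lim (X / l, x0) = (CY, vertex). *)
Definition pointed_GH_cvg (g : metric A) (x0 : X) (gY : metric AY)
    (F : R -> option (R * Y) -> X) : Prop :=
  (forall l, F l None = x0) /\
  forall rho delta : R, 0 < rho -> 0 < delta ->
    \forall l \near pinfty_nbhs R,
      (forall p q, cone p -> cone q ->
         cone_dist gY p None < rho -> cone_dist gY q None < rho ->
         `|dist g (F l p) (F l q) / l - cone_dist gY p q| < delta) /\
      (forall x, dist g x x0 / l < rho - delta ->
         exists p, [/\ cone p, cone_dist gY p None < rho
                     & dist g x (F l p) / l < delta]).

(* The maps F l realise the smooth limit of A(l R1, l R2) / l: they embed the
   limit annulus in X, the image being A(l R1, l R2) up to an arbitrarily small
   change of the radii, and the pulled back metrics converge smoothly. *)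
Definition smooth_annulus_cvg (g : metric A) (x0 : X) (gY : metric AY)
    (F : R -> option (R * Y) -> X) (R1 R2 : R) : Prop :=
  let S := closed_annulus R1 R2 in
  let f l := fun p => F l (Some p) in
  [/\ \forall l \near pinfty_nbhs R,
        smooth_embedding (cone_atlas AY) A S (f l),
      forall delta : R, 0 < delta -> \forall l \near pinfty_nbhs R,
        f l @` S `<=` annulus g x0 (l * (R1 - delta)) (l * (R2 + delta)) /\
        annulus g x0 (l * (R1 + delta)) (l * (R2 - delta)) `<=` f l @` S
    & forall (i : idx (cone_atlas AY)) (j k : 'I_n.+1),
        smooth_cvg_on (pinfty_nbhs R) (cmap i @` (S `&` cdom i))
          (fun l q => (l ^+ 2)^-1 * pullback S (f l) g i q j k)
          (fun q => cone_metric gY i q j k)].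

Definition asymptotically_conical (g : metric A) (x0 : X) (gY : metric AY) :
    Prop :=
  exists F : R -> option (R * Y) -> X,
    pointed_GH_cvg g x0 gY F /\
    forall R1 R2 : R, 0 < R1 -> R1 < R2 -> smooth_annulus_cvg g x0 gY F R1 R2.

End AsymptoticallyConical.

(* Main.v *)
Require Import Defs.
From HB Require Import structures.
From mathcomp Require Import all_boot all_order all_algebra.
From mathcomp Require Import all_classical all_reals all_analysis.
From mathcomp Require Import ring lra.

Set Implicit Arguments.
Unset Strict Implicit.
Unset Printing Implicit Defensive.
Import Order.TTheory GRing.Theory Num.Theory.
Import numFieldNormedType.Exports.

Local Open Scope classical_set_scope.
Local Open Scope ring_scope.

(* Blow down the flow by r_i, pulled back to the cone by the comparison maps of
   the asymptotic cone at the slightly larger scale lam_i = (1 + o(1)) r_i; the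
   decay hypothesis then bounds every covariant derivative of the curvature on
   each parabolic region over an annulus, up to and including its boundary
   t = eps r^2, while the initial metrics converge smoothly to the cone metric.
   Bounded Ricci curvature keeps the metrics uniformly equivalent to their
   initial values, and Gronwall's inequality turns the bounds on nabla^k Rm into
   bounds on all coordinate derivatives of the metrics: space derivatives by
   induction on the order, time derivatives from the flow equation.  A diagonal
   subsequence converges at a countable dense set of space-time points, hence
   everywhere by equicontinuity, and with all derivatives by Taylor expansion.
   The flow equation and the positivity of the metric pass to the limit. *)

(** * Calculus relative to a thick set *)

(** Three obstacles shape the argument. The limit lives up to [t = eps * r^2], where the decay
    hypothesis leaves no slack, so that an error of the comparison maps in the distance to [x0]
    could push a point out of its range. The scaled distance error is therefore kept below [h^2] and
    the scale is enlarged by the factor [1 + h]: as [(1 + h) * (p - h^2) - p = h * (p - h - h^2)],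
    the distance is at least [r * p] once [h] is small compared with the radius [p]. Moreover Ricci
    contains two derivatives of the metric, so the flow equation alone closes no estimate; but a
    coordinate derivative of [nabla^k Rm] is [nabla^(k+1) Rm] plus Christoffel terms, so that
    [m + 1] derivatives of Ricci cost only [m + 1] derivatives of the metric, and the top ones enter
    linearly. Finally the domains are neither open nor convex: calculus is relative to sets that
    contain small squares at each point, and mean value arguments follow paths of three segments. *)

Record coords (R : realType) (V : normedModType R) : Type := Coords {
  cI : finType;
  ce : cI -> V;
  cc : cI -> V -> R;
  cc_lin : forall k (a : R) u v, cc k (a *: u + v) = a * cc k u + cc k v;
  cc_ce : forall k l, cc k (ce l) = (k == l)%:R;
  ccE : forall v, v = \sum_k cc k v *: ce k;
  cc_le : forall k v, `|cc k v| <= `|v| }.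

(** * Coordinates on a finite-dimensional normed space *)

Section Coords.
Context {R : realType} {V : normedModType R} (B : coords V).

Lemma ccD (k : cI B) u v : cc k (u + v) = cc k u + cc k v.
Proof. by have := cc_lin k 1 u v; rewrite scale1r mul1r. Qed.

Lemma cc0 (k : cI B) : cc k 0 = 0.
Proof. by have := ccD k 0 0; rewrite addr0; lra. Qed.

Lemma ccZ (k : cI B) a u : cc k (a *: u) = a * cc k u.
Proof. by have := cc_lin k a u 0; rewrite addr0 cc0 addr0. Qed.

Lemma ccN (k : cI B) u : cc k (- u) = - cc k u.
Proof. by rewrite -scaleN1r ccZ mulN1r. Qed.

Lemma ccB (k : cI B) u v : cc k (u - v) = cc k u - cc k v.
Proof. by rewrite ccD ccN. Qed.

Lemma norm_le_cc v : `|v| <= \sum_(k : cI B) `|cc k v| * `|ce k|.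
Proof.
rewrite {1}(ccE B v); apply: le_trans (ler_norm_sum _ _ _) _.
by apply: ler_sum => k _; rewrite normrZ.
Qed.

(** Differentials are handled as families [a] of coefficients, so that equality of differentials is
    pointwise equality of families and needs no bundled linear map. *)
Definition lform (a : cI B -> R) (v : V) : R := \sum_k a k * cc k v.

Lemma lform_lin a : linear (lform a : V -> R^o).
Proof.
move=> t u v; rewrite /lform scaler_sumr -big_split /=; apply: eq_bigr => k _.
by rewrite cc_lin /GRing.scale /=; ring.
Qed.

HB.instance Definition _ a :=
  GRing.isLinear.Build R V R^o *:%R (lform a) (lform_lin a).

Lemma lform_ce a (k : cI B) : lform a (ce k) = a k.
Proof.
rewrite /lform (bigD1 k) //= cc_ce eqxx mulr1 big1 ?addr0 // => l lk.
by rewrite cc_ce (negPf lk) mulr0.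
Qed.

Lemma lformD a b v : lform (fun k => a k + b k) v = lform a v + lform b v.
Proof. by rewrite /lform -big_split /=; apply: eq_bigr => k _; ring. Qed.

Lemma lformZ t a v : lform (fun k => t * a k) v = t * lform a v.
Proof. by rewrite /lform mulr_sumr; apply: eq_bigr => k _; ring. Qed.

Lemma lform0 v : lform (fun=> 0) v = 0.
Proof. by rewrite /lform big1 // => k _; rewrite mul0r. Qed.

Lemma lformZr t a v : lform a (t *: v) = t * lform a v.
Proof. exact: (linearZ_LR (lform a)). Qed.

Lemma lformDr a u v : lform a (u + v) = lform a u + lform a v.
Proof. exact: (linearD (lform a)). Qed.

Lemma lformB a b v : lform (fun k => a k - b k) v = lform a v - lform b v.
Proof. by rewrite /lform -sumrB; apply: eq_bigr => k _; ring. Qed.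

Lemma eq_lform a b : a =1 b -> lform a =1 lform b.
Proof. by move=> ab v; apply: eq_bigr => k _; rewrite ab. Qed.

Lemma lform_le a v : `|lform a v| <= (\sum_k `|a k|) * `|v|.
Proof.
apply: le_trans (ler_norm_sum _ _ _) _; rewrite mulr_suml.
by apply: ler_sum => k _; rewrite normrM ler_wpM2l // cc_le.
Qed.

Lemma lform_linE (L : {linear V -> R^o}) v : L v = lform (fun k => L (ce k)) v.
Proof.
rewrite {1}(ccE B v) linear_sum; apply: eq_bigr => k _.
by rewrite linearZ /= mulrC.
Qed.

Lemma lform_continuous a : continuous (lform a : V -> R^o).
Proof.
apply/linear_bounded_continuous/linear_boundedP; near=> r => x.
apply: le_trans (lform_le a x) _; apply: ler_wpM2r => //.
Unshelve. all: by end_near. Qed.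

End Coords.

(** * Little-o and Lipschitz remainders at a point *)

Section Little.
Context {R : realType} {V : normedModType R}.
Implicit Types (D : set V) (p : V) (u w : V -> R).

(** Little-o of the distance to [p] along [D]; [lip_within] is the matching big-O. The rules below
    are those by which remainders of first-order expansions combine. *)
Definition small_within D p u := forall e : R, 0 < e ->
  \forall q \near within D (nbhs p), `|u q| <= e * `|q - p|.

Definition lip_within D p u := exists M : R,
  \forall q \near within D (nbhs p), `|u q| <= M * `|q - p|.

Lemma near_ball_norm p (e : R) : 0 < e -> \forall q \near p, `|q - p| <= e.
Proof.
move=> e0; near=> q; rewrite distrC; apply: ltW.
by near: q; apply/nbhs_normP; exists e.
Unshelve. all: by end_near. Qed.

Lemma small_withinD D p u w : small_within D p u -> small_within D p w ->
  small_within D p (fun q => u q + w q).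
Proof.
move=> su sw e e0; have e2 : 0 < e / 2 by rewrite divr_gt0.
move: (su _ e2) (sw _ e2); apply: filter_app2; near=> q => h1 h2.
by apply: le_trans (ler_normD _ _) _; lra.
Unshelve. all: by end_near. Qed.

Lemma eq_small_within D p u w : (forall q, D q -> u q = w q) ->
  small_within D p u -> small_within D p w.
Proof.
move=> uw su e e0; have := su _ e0; rewrite !near_withinE.
by apply: filterS => q h Dq; rewrite -uw // h.
Qed.

Lemma small_within0 D p : small_within D p (fun=> 0).
Proof.
by move=> e e0; apply: nearW => q; rewrite normr0 mulr_ge0 // ltW.
Qed.

Lemma small_within_bdd D p u w (M : R) : small_within D p u ->
  (\forall q \near within D (nbhs p), `|w q| <= M) ->
  small_within D p (fun q => w q * u q).
Proof.
move=> su wM e e0; have M0 : 0 < `|M| + 1 by rewrite ltr_wpDl.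
have := su (e / (`|M| + 1)) (divr_gt0 e0 M0); move: wM.
apply: filter_app2; near=> q => wM uq; rewrite normrM.
have wM' : `|w q| <= `|M| + 1.
  by apply: le_trans wM _; rewrite ler_wpDr ?ler_norm.
apply: le_trans (ler_pM (normr_ge0 _) (normr_ge0 _) wM' uq) _.
by rewrite mulrA mulrCA divff ?gt_eqF // mulr1.
Unshelve. all: by end_near. Qed.

Lemma small_withinZ D p u (c : R) : small_within D p u ->
  small_within D p (fun q => c * u q).
Proof. by move=> su; apply: (small_within_bdd (M := `|c|)) => //; apply: nearW. Qed.

Lemma small_within_sum D p (I : finType) (u : I -> V -> R) :
  (forall k, small_within D p (u k)) ->
  small_within D p (fun q => \sum_k u k q).
Proof.
move=> su; rewrite (_ : (fun q => _) = \sum_k u k); last first.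
  by apply/funext => q; rewrite fct_sumE.
elim/big_rec: _ => [|k w _ sw]; first exact: small_within0.
exact: small_withinD.
Qed.

Lemma small_within_lip2 D p u w : lip_within D p u -> lip_within D p w ->
  small_within D p (fun q => u q * w q).
Proof.
move=> [M uM] [N wN] e e0.
pose K := (`|M| + 1) * (`|N| + 1).
have K0 : 0 < K by rewrite mulr_gt0 // ltr_wpDl.
have : \forall q \near within D (nbhs p), `|q - p| <= e / K.
  by apply: cvg_within; apply: near_ball_norm; rewrite divr_gt0.
move: uM wN; apply: filter_app3; near=> q => uM wN qe; rewrite normrM.
have uM' : `|u q| <= (`|M| + 1) * `|q - p|.
  apply: le_trans uM _; apply: ler_wpM2r => //.
  by rewrite ler_wpDr ?ler_norm.
have wN' : `|w q| <= (`|N| + 1) * `|q - p|.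
  apply: le_trans wN _; apply: ler_wpM2r => //.
  by rewrite ler_wpDr ?ler_norm.
apply: le_trans (ler_pM (normr_ge0 _) (normr_ge0 _) uM' wN') _.
rewrite mulrACA -/K mulrA ler_wpM2r // mulrC.
by rewrite -ler_pdivlMr.
Unshelve. all: by end_near. Qed.

Lemma small_lip D p u : small_within D p u -> lip_within D p u.
Proof. by move=> su; exists 1; apply: su. Qed.

Lemma lip_withinD D p u w : lip_within D p u -> lip_within D p w ->
  lip_within D p (fun q => u q + w q).
Proof.
move=> [M uM] [N wN]; exists (M + N); move: uM wN; apply: filter_app2.
near=> q => h1 h2; apply: le_trans (ler_normD _ _) _.
by rewrite mulrDl lerD.
Unshelve. all: by end_near. Qed.

Lemma eq_lip_within D p u w : (forall q, D q -> u q = w q) ->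
  lip_within D p u -> lip_within D p w.
Proof.
move=> uw [M uM]; exists M; move: uM; rewrite !near_withinE.
by apply: filterS => q h Dq; rewrite -uw // h.
Qed.

Lemma lip_within_near D p u (e : R) : 0 < e -> lip_within D p u ->
  \forall q \near within D (nbhs p), `|u q| <= e.
Proof.
move=> e0 [M uM]; have M0 : 0 < `|M| + 1 by rewrite ltr_wpDl.
have : \forall q \near within D (nbhs p), `|q - p| <= e / (`|M| + 1).
  by apply: cvg_within; apply: near_ball_norm; rewrite divr_gt0.
move: uM; apply: filter_app2; near=> q => uM; rewrite ler_pdivlMr // => qe.
apply: le_trans uM _; apply: le_trans _ qe; rewrite mulrC ler_wpM2l //.
by rewrite ler_wpDr ?ler_norm.
Unshelve. all: by end_near. Qed.

End Little.

(** * Differentials relative to a set *)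

Section Diff.
Context {R : realType} {V : normedModType R} (B : coords V).
Implicit Types (D : set V) (p : V) (f g : V -> R) (a b : cI B -> R).

Definition has_grad D f p a :=
  small_within D p (fun q => f q - f p - lform a (q - p)).

Lemma has_gradP D f p a : has_grad D f p a <-> has_diff_within D f p (lform a).
Proof. by split=> [h|[]//]; split=> //; apply: lform_continuous. Qed.

Lemma has_diff_grad D f p (L : {linear V -> R^o}) :
  has_diff_within D f p L -> has_grad D f p (fun k => L (ce k)).
Proof.
by move=> [_ h] e e0; have := h e e0; apply: filterS => q; rewrite -lform_linE.
Qed.

Lemma ex_gradP D f p :
  (exists L, has_diff_within D f p L) <-> (exists a, has_grad D f p a).
Proof.
split=> [[L /has_diff_grad h]|[a /has_gradP h]]; first by eexists; exact: h.
by eexists; exact: h.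
Qed.

(* Differentials relative to D are unique. *)
Definition thick D := forall p a, D p ->
  small_within D p (fun q => lform a (q - p)) -> forall k, a k = 0.

Lemma has_grad_uniq D f p a b : thick D -> D p ->
  has_grad D f p a -> has_grad D f p b -> a =1 b.
Proof.
move=> tD Dp fa fb k; apply/eqP; rewrite -subr_eq0; apply/eqP.
apply: (tD p (fun k => a k - b k)) => //.
apply: eq_small_within (small_withinD fb (small_withinZ (-1) fa)) => q _ /=.
by rewrite lformB; ring.
Qed.

Lemma deriv_withinE D f p a v : thick D -> D p -> has_grad D f p a ->
  deriv_within D v f p = lform a v.
Proof.
move=> tD Dp fa; rewrite /deriv_within.
case: xgetP => [c _ [L [/has_diff_grad fL ->]]|/(_ (lform a v)) []].
  by rewrite (lform_linE B); apply/esym/eq_lform/(has_grad_uniq tD Dp fa fL).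
by exists (lform a); split=> //; apply/has_gradP.
Qed.

Lemma deriv_within_ce D f p a k : thick D -> D p -> has_grad D f p a ->
  deriv_within D (ce k) f p = a k.
Proof. by move=> tD Dp fa; rewrite (deriv_withinE _ tD Dp fa) lform_ce. Qed.

Lemma has_grad_deriv D f p : thick D -> D p ->
  (exists L, has_diff_within D f p L) ->
  has_grad D f p (fun k => deriv_within D (ce k) f p).
Proof.
move=> tD Dp /ex_gradP[a fa] e e0; have := fa e e0; apply: filterS => q.
rewrite (@eq_lform _ _ _ a (fun k => deriv_within D (ce k) f p)) // => k.
by rewrite (deriv_within_ce _ tD Dp fa).
Qed.

Lemma has_grad_lip D f p a : has_grad D f p a ->
  lip_within D p (fun q => f q - f p).
Proof.
move=> fa; apply: (eq_lip_within (u := fun q =>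
  (f q - f p - lform a (q - p)) + lform a (q - p))) => [q _|]; first by ring.
apply: lip_withinD (small_lip fa) _; exists (\sum_k `|a k|).
by apply: nearW => q; apply: lform_le.
Qed.

Lemma has_grad_congr D D' f g p a :
  (\forall q \near p, D' q -> D q /\ f q = g q) -> f p = g p ->
  has_grad D f p a -> has_grad D' g p a.
Proof.
move=> DD' fg fa e e0; have := fa e e0; rewrite !near_withinE.
move: DD'; apply: filter_app2; near=> q => DD' h D'q.
by have [Dq fgq] := DD' D'q; rewrite -fgq -fg h.
Unshelve. all: by end_near. Qed.

Lemma has_grad_cst D p (c : R) : has_grad D (fun=> c) p (fun=> 0).
Proof.
apply: eq_small_within (small_within0 D p) => q _.
by rewrite lform0 subrr subr0.
Qed.

Lemma has_gradD D f g p a b : has_grad D f p a -> has_grad D g p b ->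
  has_grad D (fun q => f q + g q) p (fun k => a k + b k).
Proof.
move=> fa gb; apply: eq_small_within (small_withinD fa gb) => q _.
by rewrite lformD; ring.
Qed.

Lemma has_gradM D f g p a b : has_grad D f p a -> has_grad D g p b ->
  has_grad D (fun q => f q * g q) p (fun k => g p * a k + f p * b k).
Proof.
move=> fa gb; have fl := has_grad_lip fa; have gl := has_grad_lip gb.
apply: eq_small_within (small_withinD (small_withinD (small_withinZ (g p) fa)
  (small_withinZ (f p) gb)) (small_within_lip2 fl gl)) => q _.
by rewrite lformD !lformZ; ring.
Qed.

Lemma has_gradV D f p a : f p != 0 -> has_grad D f p a ->
  has_grad D (fun q => (f q)^-1) p (fun k => - (f p) ^- 2 * a k).
Proof.
move=> fp0 fa; have fl := has_grad_lip fa.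
have e0 : 0 < `|f p| / 2 by rewrite divr_gt0 // normr_gt0.
have near0 : \forall q \near within D (nbhs p), `|f p| / 2 <= `|f q|.
  have := lip_within_near e0 fl; apply: filterS => q h.
  by have := lerB_dist (f p) (f q); rewrite distrC; lra.
have bd : \forall q \near within D (nbhs p),
    `|(f p) ^- 2 * (f q)^-1| <= `|f p| ^- 2 * (`|f p| / 2)^-1.
  move: near0; apply: filterS => q h; rewrite normrM normfV normrX.
  rewrite normfV ler_wpM2l // ?invr_ge0 ?exprn_ge0 // lef_pV2 //.
  by rewrite posrE (lt_le_trans e0 h).
have h1 := small_withinZ (- (f p) ^- 2) fa.
have h2 := small_within_bdd (small_within_lip2 fl fl) bd.
move=> e ep; move: (small_withinD h1 h2 ep) near0.
apply: filter_app2; near=> q => h nq.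
have fq0 : f q != 0 by rewrite -normr_gt0 (lt_le_trans e0 nq).
(* Exact expansion: the remainder of [1 / f] is a multiple of the remainder of [f] plus a bounded
   factor times the square of [f q - f p]. *)
suff -> : (f q)^-1 - (f p)^-1 - lform (fun k => - (f p) ^- 2 * a k) (q - p) =
  - f p ^- 2 * (f q - f p - lform a (q - p)) +
     f p ^- 2 / f q * ((f q - f p) * (f q - f p)) by [].
by rewrite lformZ; field; rewrite fp0 fq0.
Unshelve. all: by end_near. Qed.

End Diff.

Section Chain.
Context {R : realType} {V W : normedModType R} (B : coords V) (C : coords W).

(** [psi] is Lipschitz at [p], so an error that is little-o of [psi q - psi p] is little-o of
    [q - p]; the other error is a combination of the remainders of the coordinates of [psi]. *)
Lemma has_grad_comp (D : set V) (D' : set W) (f : W -> R) (psi : V -> W) p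
    (a : cI C -> R) (b : cI C -> cI B -> R) :
  (forall q, D q -> D' (psi q)) ->
  (forall k, has_grad D (fun q => cc k (psi q)) p (b k)) ->
  has_grad D' f (psi p) a ->
  has_grad D (fun q => f (psi q)) p (fun l => \sum_k a k * b k l).
Proof.
move=> DD' pb fa.
have [M pM] : lip_within D p (fun q => `|psi q - psi p|).
  have : lip_within D p (fun q => \sum_k `|ce (c := C) k| *
      `|cc k (psi q) - cc k (psi p)|).
    rewrite (_ : (fun q => _) = \sum_k (fun q => `|ce (c := C) k| *
      `|cc k (psi q) - cc k (psi p)|)); last first.
      by apply/funext => q; rewrite fct_sumE.
    elim/big_ind: _ => [|u w|k _].
    - by exists 0; apply: nearW => q; rewrite normr0 mul0r.
    - exact: lip_withinD.
    - have [M h] := has_grad_lip (pb k); exists (`|ce (c := C) k| * M).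
      apply: filterS h => q h; rewrite normrM !normr_id -mulrA.
      by rewrite ler_wpM2l.
  move=> [M h]; exists M; apply: filterS h => q h; rewrite normr_id.
  apply: le_trans _ h; rewrite [leRHS]ger0_norm; last first.
    by apply: sumr_ge0 => k _; rewrite mulr_ge0.
  apply: le_trans (norm_le_cc C _) _; apply: ler_sum => k _.
  by rewrite ccB mulrC.
have h1 : small_within D p
    (fun q => f (psi q) - f (psi p) - lform a (psi q - psi p)).
  move=> e e0; have M0 : 0 < `|M| + 1 by rewrite ltr_wpDl.
  have := fa (e / (`|M| + 1)) (divr_gt0 e0 M0); rewrite near_withinE.
  move=> /nbhs_normP[d /= d0 hd].
  have : \forall q \near within D (nbhs p), `|(`|psi q - psi p|)| <= d / 2.
    by apply: (lip_within_near (u := fun q => `|psi q - psi p|));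
      [rewrite divr_gt0|exists M].
  move: pM; rewrite !near_withinE; apply: filter_app2; near=> q => h1 h2 Dq.
  have := hd (psi q) _ (DD' q Dq) => /=.
  rewrite distrC => h; apply: le_trans (h _) _.
    by move: (h2 Dq); rewrite normr_id; lra.
  move: (h1 Dq); rewrite normr_id => h3.
  rewrite -mulrA; apply: ler_wpM2l; first exact: ltW.
  rewrite ler_pdivrMl //.
  apply: le_trans h3 _; rewrite ler_wpM2r //.
  by rewrite ler_wpDr ?ler_norm.
have h2 : small_within D p (fun q => \sum_k a k *
    (cc k (psi q) - cc k (psi p) - lform (b k) (q - p))).
  by apply: small_within_sum => k; apply: small_withinZ; exact: pb.
apply: eq_small_within (small_withinD h1 h2) => q _.
have -> : lform (fun l => \sum_k a k * b k l) (q - p) =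
    \sum_k a k * lform (b k) (q - p).
  rewrite /lform (eq_bigr _ (fun l _ => mulr_suml _ _ _ _)) exchange_big /=.
  by apply: eq_bigr => k _; rewrite mulr_sumr; apply: eq_bigr => l _; ring.
rewrite (eq_bigr (fun k => a k * cc k (psi q - psi p) -
    a k * lform (b k) (q - p))); last by move=> k _; rewrite ccB; ring.
by rewrite sumrB /lform; ring.
Unshelve. all: by end_near. Qed.

End Chain.

(** * Smooth functions: locality and coinduction *)

Section Smooth.
Context {R : realType} {V : normedModType R}.
Implicit Types (D : set V) (f g : V -> R) (p v : V).

(** Equality at [p] is a separate hypothesis because [p] may lie outside [D], where the condition
    near [p] says nothing about it. *)
Lemma deriv_within_congr D D' f g p v :
  (\forall q \near p, D q <-> D' q) ->
  (\forall q \near p, D q -> f q = g q) -> f p = g p ->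
  deriv_within D v f p = deriv_within D' v g p.
Proof.
move=> DD' fg fgp; congr (xget 0 _); apply/seteqP.
have imp (D1 D2 : set V) f1 f2 L : (\forall q \near p, D1 q <-> D2 q) ->
    (\forall q \near p, D1 q -> f1 q = f2 q) -> f1 p = f2 p ->
    has_diff_within D1 f1 p L -> has_diff_within D2 f2 p L.
  move=> D12 f12 f12p [cL h]; split=> // e e0; have := h e e0.
  rewrite !near_withinE; move: D12 f12; apply: filter_app3.
  by near=> q => D12 f12 hq D2q; rewrite -f12p -f12; [apply: hq|]; apply/D12.
split=> c [L [hL ->]]; exists L; split=> //; first exact: imp hL.
apply: imp hL => //; first by apply: filterS DD' => q [].
by move: DD' fg; apply: filter_app2; near=> q => DD' fg D'q; rewrite fg //; apply/DD'.
Unshelve. all: by end_near. Qed.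

Lemma derivs_within_congr D D' f g s (O : set V) : open O ->
  (forall q, O q -> (D q <-> D' q)) ->
  (forall q, O q -> D q -> f q = g q) ->
  forall p, O p -> D p -> derivs_within D s f p = derivs_within D' s g p.
Proof.
move=> oO DD' fg; elim: s => [|v s IH] p Op Dp /=; first exact: fg.
have On : \forall q \near p, O q by exact: open_nbhs_nbhs.
apply: deriv_within_congr => /=; last exact: IH.
- by apply: filterS On => q /DD'.
- by apply: filterS On => q Oq Dq; exact: IH.
Qed.

Lemma eq_deriv_within D f g v p : (forall q, D q -> f q = g q) -> D p ->
  deriv_within D v f p = deriv_within D v g p.
Proof.
by move=> fg Dp; apply: deriv_within_congr; [exact: nearW|exact: nearW|exact: fg].
Qed.

Lemma eq_derivs_within D f g s p : (forall q, D q -> f q = g q) -> D p ->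
  derivs_within D s f p = derivs_within D s g p.
Proof.
move=> fg; elim: s p => [|v s IH] p Dp /=; first exact: fg.
exact: eq_deriv_within.
Qed.

Lemma derivs_within_rcons D s v f :
  derivs_within D (rcons s v) f = derivs_within D s (deriv_within D v f).
Proof. by rewrite /derivs_within -cats1 foldr_cat. Qed.

Definition diff_on D f := forall p, D p -> exists L, has_diff_within D f p L.

Lemma eq_diff_on D f g : (forall q, D q -> f q = g q) ->
  diff_on D f -> diff_on D g.
Proof.
move=> fg df p Dp; have [L [cL h]] := df p Dp; exists L; split=> // e e0.
have := h e e0; rewrite !near_withinE; apply: filterS => q hq Dq.
by rewrite -!fg //; exact: hq.
Qed.

Lemma smooth_diff D f : smooth_on D f -> diff_on D f.
Proof. by move=> sf; exact: (sf [::]). Qed.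

Lemma smooth_deriv D f v : smooth_on D f -> smooth_on D (deriv_within D v f).
Proof. by move=> sf s p; have := sf (rcons s v) p; rewrite derivs_within_rcons. Qed.

Lemma smooth_derivs D f s : smooth_on D f -> smooth_on D (derivs_within D s f).
Proof. by move=> sf; elim: s => //= v s IH; exact: smooth_deriv. Qed.

Lemma eq_smooth D f g : (forall q, D q -> f q = g q) ->
  smooth_on D f -> smooth_on D g.
Proof.
move=> fg sf s; apply: eq_diff_on (sf s) => p Dp; exact: eq_derivs_within.
Qed.

(** Smoothness speaks of all iterated derivatives, hence the smooth functions are the largest class
    of functions differentiable on [D] that is closed under differentiation. Derivatives only have
    to agree on [D] with members of [P]. *)
Lemma smooth_coind D (P : (V -> R) -> Prop) :
  (forall f, P f -> diff_on D f /\
    forall v, exists2 g, P g & forall q, D q -> deriv_within D v f q = g q) ->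
  forall f, P f -> smooth_on D f.
Proof.
move=> HP f Pf s.
(* Generalised to functions that agree on [D] with a member of [P]. The induction removes the right
   end of [s], which is the derivative taken first. *)
suff H : forall f g, P g -> (forall q, D q -> f q = g q) ->
    diff_on D (derivs_within D s f) by exact: (H f f Pf).
move=> {f Pf}.
elim/last_ind: s => [|s v IH] f g Pg fg /=.
  have /= dg := (HP g Pg).1.
  by apply: eq_diff_on dg => q Dq; rewrite fg.
rewrite derivs_within_rcons; have [_ /(_ v)[h Ph hE]] := HP g Pg.
apply: IH Ph _ => q Dq; rewrite -hE //; exact: eq_deriv_within.
Qed.

(** Derivatives relative to [D] and to its intersection with an open [U] coincide on [U], so that
    differentials for the one serve for the other. *)
Lemma smooth_local D f :
  (forall p, D p -> exists U : set V, [/\ open U, U p & smooth_on (D `&` U) f]) ->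
  smooth_on D f.
Proof.
move=> loc s p Dp; have [U [oU Up sU]] := loc p Dp.
have [L [cL h]] := sU s p (conj Dp Up); exists L; split=> // e e0.
have := h e e0; rewrite !near_withinE.
have Un : \forall q \near p, U q by exact: open_nbhs_nbhs.
have E q : D q -> U q -> derivs_within (D `&` U) s f q = derivs_within D s f q.
  move=> Dq Uq; apply: (derivs_within_congr s oU) => // q' Uq'.
  by split=> [[]|].
move: Un; apply: filter_app2; near=> q => Uq hq Dq.
by rewrite -!E //; exact: hq.
Unshelve. all: by end_near. Qed.

End Smooth.

(** * Rules of differentiation *)

Section Rules.
Context {R : realType} {V : normedModType R} (B : coords V) (D : set V).
Hypothesis tD : thick B D.
Implicit Types (f g : V -> R) (p v : V).

Lemma diff_grad f p : diff_on D f -> D p ->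
  has_grad (B := B) D f p (fun k => deriv_within D (ce k) f p).
Proof. by move=> df Dp; apply: has_grad_deriv => //; exact: df. Qed.

Lemma grad_diff f : (forall p, D p -> exists a, has_grad (B := B) D f p a) ->
  diff_on D f.
Proof. by move=> h p Dp; apply/(ex_gradP B); exact: h. Qed.

Lemma deriv_within_lform f p v : diff_on D f -> D p ->
  deriv_within D v f p = \sum_(k : cI B) cc k v * deriv_within D (ce k) f p.
Proof.
move=> df Dp; rewrite (deriv_withinE v tD Dp (diff_grad df Dp)) /lform.
by apply: eq_bigr => k _; rewrite mulrC.
Qed.

Lemma deriv_within_cst (c : R) p v : D p -> deriv_within D v (fun=> c) p = 0.
Proof. by move=> Dp; rewrite (deriv_withinE v tD Dp (has_grad_cst B D p c)) lform0. Qed.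

Lemma deriv_withinD f g p v : diff_on D f -> diff_on D g -> D p ->
  deriv_within D v (fun q => f q + g q) p =
  deriv_within D v f p + deriv_within D v g p.
Proof.
move=> df dg Dp; have hf := diff_grad df Dp; have hg := diff_grad dg Dp.
rewrite (deriv_withinE v tD Dp (has_gradD hf hg)) lformD.
by rewrite (deriv_withinE v tD Dp hf) (deriv_withinE v tD Dp hg).
Qed.

Lemma deriv_withinM f g p v : diff_on D f -> diff_on D g -> D p ->
  deriv_within D v (fun q => f q * g q) p =
  deriv_within D v f p * g p + f p * deriv_within D v g p.
Proof.
move=> df dg Dp; have hf := diff_grad df Dp; have hg := diff_grad dg Dp.
rewrite (deriv_withinE v tD Dp (has_gradM hf hg)) lformD !lformZ.
rewrite (deriv_withinE v tD Dp hf) (deriv_withinE v tD Dp hg).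
by congr (_ + _); rewrite mulrC.
Qed.

Lemma deriv_withinV f p v : diff_on D f -> f p != 0 -> D p ->
  deriv_within D v (fun q => (f q)^-1) p =
  - (deriv_within D v f p * ((f p)^-1 * (f p)^-1)).
Proof.
move=> df f0 Dp; have hf := diff_grad df Dp.
rewrite (deriv_withinE v tD Dp (has_gradV f0 hf)) lformZ.
by rewrite (deriv_withinE v tD Dp hf) expr2 invfM; ring.
Qed.

Lemma diff_on_cst (c : R) : diff_on D (fun=> c).
Proof. by apply: grad_diff => p Dp; eexists; exact: has_grad_cst. Qed.

Lemma diff_onD f g : diff_on D f -> diff_on D g -> diff_on D (fun q => f q + g q).
Proof.
move=> df dg; apply: grad_diff => p Dp; eexists.
by apply: has_gradD; apply: diff_grad.
Qed.

Lemma diff_onM f g : diff_on D f -> diff_on D g -> diff_on D (fun q => f q * g q).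
Proof.
move=> df dg; apply: grad_diff => p Dp; eexists.
by apply: has_gradM; apply: diff_grad.
Qed.

Lemma diff_onV f : diff_on D f -> (forall p, D p -> f p != 0) ->
  diff_on D (fun q => (f q)^-1).
Proof.
move=> df f0; apply: grad_diff => p Dp; eexists.
by apply: has_gradV; [exact: f0|exact: diff_grad].
Qed.

Section Comp.
Context {W : normedModType R} (C : coords W) (D' : set W).
Hypothesis tD' : thick C D'.

Lemma diff_on_comp (f : W -> R) (psi : V -> W) :
  (forall q, D q -> D' (psi q)) ->
  (forall k : cI C, diff_on D (fun q => cc k (psi q))) -> diff_on D' f ->
  diff_on D (fun q => f (psi q)).
Proof.
move=> DD' dpsi df; apply: grad_diff => p Dp; eexists.
apply: (has_grad_comp (C := C) DD') => [k|]; first exact: diff_grad.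
by apply: has_grad_deriv => //; [exact: DD'|apply: df; exact: DD'].
Qed.

Lemma deriv_within_comp (f : W -> R) (psi : V -> W) p v :
  (forall q, D q -> D' (psi q)) ->
  (forall k : cI C, diff_on D (fun q => cc k (psi q))) -> diff_on D' f ->
  D p -> deriv_within D v (fun q => f (psi q)) p =
  \sum_(k : cI C) deriv_within D v (fun q => cc k (psi q)) p *
     deriv_within D' (ce k) f (psi p).
Proof.
move=> DD' dpsi df Dp.
have hf : has_grad (B := C) D' f (psi p) (fun k => deriv_within D' (ce k) f (psi p)).
  by apply: has_grad_deriv => //; [exact: DD'|apply: df; exact: DD'].
rewrite (deriv_withinE v tD Dp
  (has_grad_comp DD' (fun k => diff_grad (dpsi k) Dp) hf)) /lform.
rewrite (eq_bigr _ (fun l _ => mulr_suml _ _ _ _)) exchange_big /=.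
apply: eq_bigr => k _; rewrite (deriv_withinE v tD Dp (diff_grad (dpsi k) Dp)).
by rewrite /lform mulr_suml; apply: eq_bigr => l _; ring.
Qed.

End Comp.

(* The functions obtained from smooth ones by algebra and composition; the
   class is closed under differentiation, whence smooth_coind applies. *)
Inductive alg : (V -> R) -> Prop :=
| alg_smooth f of smooth_on D f : alg f
| alg_cst c : alg (fun=> c)
| alg_add f g of alg f & alg g : alg (fun q => f q + g q)
| alg_mul f g of alg f & alg g : alg (fun q => f q * g q)
| alg_inv f of alg f & (forall p, D p -> f p != 0) : alg (fun q => (f q)^-1)
| alg_comp (W : normedModType R) (C : coords W) (D' : set W) (f : W -> R) (psi : V -> W)
   of thick C D' & (forall q, D q -> D' (psi q)) &
   (forall k : cI C, alg (fun q => cc k (psi q))) & smooth_on D' f :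
   alg (fun q => f (psi q)).

Lemma alg_sum (I : Type) (r : seq I) (F : I -> V -> R) :
  (forall k, alg (F k)) -> alg (fun q => \sum_(k <- r) F k q).
Proof.
move=> aF; elim: r => [|k r IH].
  by under eq_fun do rewrite big_nil; exact: alg_cst.
by under eq_fun do rewrite big_cons; exact: alg_add.
Qed.

Lemma alg_diff f : alg f -> diff_on D f /\
  forall v, exists2 g, alg g & forall q, D q -> deriv_within D v f q = g q.
Proof.
elim=> {f} [f sf|c|f g af [df hf] ag [dg hg]|f g af [df hf] ag [dg hg]|
    f af [df hf] f0|W C D' f psi tD' DD' apsi dpsi sf].
- split=> [|v]; first exact: smooth_diff.
  by exists (deriv_within D v f) => //; apply/alg_smooth/smooth_deriv.
- split=> [|v]; first exact: diff_on_cst.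
  by exists (fun=> 0); [exact: alg_cst|move=> q Dq; rewrite deriv_within_cst].
- split=> [|v]; first exact: diff_onD.
  have [f' af' f'E] := hf v; have [g' ag' g'E] := hg v.
  by eexists; [exact: alg_add af' ag'|move=> q Dq; rewrite deriv_withinD // f'E // g'E].
- split=> [|v]; first exact: diff_onM.
  have [f' af' f'E] := hf v; have [g' ag' g'E] := hg v.
  eexists; first exact: alg_add (alg_mul af' ag) (alg_mul af ag').
  by move=> q Dq; rewrite deriv_withinM // f'E // g'E.
- split=> [|v]; first exact: diff_onV.
  have [f' af' f'E] := hf v; have afV := alg_inv af f0.
  eexists; first exact: alg_mul (alg_cst (-1)) (alg_mul af' (alg_mul afV afV)).
  by move=> q Dq; rewrite deriv_withinV // ?f0 // f'E // mulN1r.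
- have dp k := (dpsi k).1; have df := smooth_diff sf.
  split=> [|v]; first exact: (diff_on_comp tD' DD' dp df).
  have hd k := cid2 ((dpsi k).2 v).
  exists (fun q => \sum_(k : cI C) sval (cid2 ((dpsi k).2 v)) q *
     deriv_within D' (ce k) f (psi q)).
    apply: alg_sum => k; case: cid2 => g ag _ /=.
    apply: alg_mul ag _; apply: (alg_comp tD' DD' apsi); exact: smooth_deriv.
  move=> q Dq; rewrite (deriv_within_comp tD' v DD' dp df Dq).
  by apply: eq_bigr => k _; case: cid2 => g _ /= ->.
Qed.

Lemma smooth_alg f : alg f -> smooth_on D f.
Proof. by apply: smooth_coind => {}f; exact: alg_diff. Qed.

Lemma smooth_cst c : smooth_on D (fun=> c).
Proof. exact/smooth_alg/alg_cst. Qed.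

Lemma smoothD f g : smooth_on D f -> smooth_on D g ->
  smooth_on D (fun q => f q + g q).
Proof. by move=> sf sg; apply/smooth_alg/alg_add; apply: alg_smooth. Qed.

Lemma smoothM f g : smooth_on D f -> smooth_on D g ->
  smooth_on D (fun q => f q * g q).
Proof. by move=> sf sg; apply/smooth_alg/alg_mul; apply: alg_smooth. Qed.

Lemma smoothV f : smooth_on D f -> (forall p, D p -> f p != 0) ->
  smooth_on D (fun q => (f q)^-1).
Proof. by move=> sf f0; apply/smooth_alg/alg_inv => //; apply: alg_smooth. Qed.

Lemma smooth_comp (W : normedModType R) (C : coords W) (D' : set W)
    (f : W -> R) (psi : V -> W) :
  thick C D' -> (forall q, D q -> D' (psi q)) ->
  (forall k : cI C, smooth_on D (fun q => cc k (psi q))) -> smooth_on D' f ->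
  smooth_on D (fun q => f (psi q)).
Proof.
move=> tD' DD' sp sf; apply/smooth_alg/(alg_comp tD' DD') => // k.
exact: alg_smooth.
Qed.

Lemma smoothN f : smooth_on D f -> smooth_on D (fun q => - f q).
Proof.
move=> sf; apply: (@eq_smooth _ _ D (fun q => -1 * f q)).
  by move=> q _; rewrite mulN1r.
by apply: smoothM => //; exact: smooth_cst.
Qed.

Lemma smoothB f g : smooth_on D f -> smooth_on D g ->
  smooth_on D (fun q => f q - g q).
Proof. by move=> sf sg; apply: smoothD => //; exact: smoothN. Qed.

Lemma smooth_sum (I : Type) (r : seq I) (P : pred I) (F : I -> V -> R) :
  (forall k, smooth_on D (F k)) ->
  smooth_on D (fun q => \sum_(k <- r | P k) F k q).
Proof.
move=> sF; elim: r => [|k r IH].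
  by under eq_fun do rewrite big_nil; exact: smooth_cst.
by under eq_fun do rewrite big_cons; case: (P k) => //; exact: smoothD.
Qed.

Lemma smooth_prod (I : Type) (r : seq I) (P : pred I) (F : I -> V -> R) :
  (forall k, smooth_on D (F k)) ->
  smooth_on D (fun q => \prod_(k <- r | P k) F k q).
Proof.
move=> sF; elim: r => [|k r IH].
  by under eq_fun do rewrite big_nil; exact: smooth_cst.
by under eq_fun do rewrite big_cons; case: (P k) => //; exact: smoothM.
Qed.

(** Coordinate functions and constants together form a class closed under differentiation. *)
Lemma smooth_cc (k : cI B) : smooth_on D (cc k).
Proof.
pose P f := f = cc k \/ exists c, f = fun=> c.
apply: (@smooth_coind _ _ D P); last by left.
move=> f [->|[c ->]]; last first.
  split=> [|v]; first exact: diff_on_cst.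
  by exists (fun=> 0); [right; exists 0|move=> q Dq; rewrite deriv_within_cst].
have gk p : has_grad D (cc k) p (fun l => (k == l)%:R).
  apply: eq_small_within (small_within0 D p) => q _.
  rewrite /lform (bigD1 k) //= eqxx mul1r big1 ?addr0; last first.
    by move=> l lk; rewrite eq_sym (negPf lk) mul0r.
  by rewrite ccB subrr.
split=> [|v]; first by apply: grad_diff => p _; eexists; exact: gk.
exists (fun=> cc k v); first by right; exists (cc k v).
move=> q Dq; rewrite (deriv_withinE v tD Dq (gk q)) /lform (bigD1 k) //= eqxx mul1r.
by rewrite big1 ?addr0 // => l lk; rewrite eq_sym (negPf lk) mul0r.
Qed.

Lemma deriv_within_cc (k : cI B) p v : D p -> deriv_within D v (cc k) p = cc k v.
Proof.
move=> Dp; have gk : has_grad D (cc k) p (fun l => (k == l)%:R).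
  apply: eq_small_within (small_within0 D p) => q _.
  rewrite /lform (bigD1 k) //= eqxx mul1r big1 ?addr0; last first.
    by move=> l lk; rewrite eq_sym (negPf lk) mul0r.
  by rewrite ccB subrr.
rewrite (deriv_withinE v tD Dp gk) /lform (bigD1 k) //= eqxx mul1r.
by rewrite big1 ?addr0 // => l lk; rewrite eq_sym (negPf lk) mul0r.
Qed.

Lemma deriv_withinN f p v : diff_on D f -> D p ->
  deriv_within D v (fun q => - f q) p = - deriv_within D v f p.
Proof.
move=> df Dp; rewrite (@eq_deriv_within _ _ D _ (fun q => -1 * f q)) //; last first.
  by move=> q _; rewrite mulN1r.
by rewrite deriv_withinM // ?deriv_within_cst // ?mul0r ?add0r ?mulN1r //; exact: diff_on_cst.
Qed.

Lemma deriv_withinB f g p v : diff_on D f -> diff_on D g -> D p ->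
  deriv_within D v (fun q => f q - g q) p =
  deriv_within D v f p - deriv_within D v g p.
Proof.
move=> df dg Dp; rewrite deriv_withinD // ?deriv_withinN // => q Dq.
apply: (eq_diff_on (f := fun q => -1 * g q)) => // [q' _|]; first by rewrite mulN1r.
by apply: diff_onM => //; exact: diff_on_cst.
Qed.

Lemma deriv_withinZ (c : R) f p v : diff_on D f -> D p ->
  deriv_within D v (fun q => c * f q) p = c * deriv_within D v f p.
Proof.
by move=> df Dp; rewrite deriv_withinM ?deriv_within_cst ?mul0r ?add0r //; exact: diff_on_cst.
Qed.

Lemma deriv_within_sum (I : Type) (r : seq I) (F : I -> V -> R) p v :
  (forall k, diff_on D (F k)) -> D p ->
  deriv_within D v (fun q => \sum_(k <- r) F k q) p =
  \sum_(k <- r) deriv_within D v (F k) p.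
Proof.
move=> dF Dp; elim: r => [|k r IH].
  by under eq_fun do rewrite big_nil; rewrite deriv_within_cst ?big_nil.
under eq_fun do rewrite big_cons; rewrite big_cons deriv_withinD ?IH // => {IH}.
elim: r => [|l r IH]; first by under eq_fun do rewrite big_nil; exact: diff_on_cst.
by under eq_fun do rewrite big_cons; exact: diff_onD.
Qed.

End Rules.

(** * Restriction to a smaller set *)

Section Restrict.
Context {R : realType} {V : normedModType R} (B : coords V) (D D' : set V).
Hypotheses (tD : thick B D) (tD' : thick B D') (DD' : D' `<=` D).

(** A differential along [D] is also one along the smaller [D'], and thickness of [D'] makes it the
    only one. *)
Lemma deriv_within_restrict f p v : diff_on D f -> D' p ->
  deriv_within D' v f p = deriv_within D v f p.
Proof.
move=> df D'p; have hf := diff_grad tD df (DD' D'p).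
rewrite (deriv_withinE v tD (DD' D'p) hf).
apply: (deriv_withinE v tD' D'p); apply: has_grad_congr hf => //.
by apply: nearW => q /DD'.
Qed.

Lemma derivs_restrict f s p : smooth_on D f -> D' p ->
  derivs_within D' s f p = derivs_within D s f p.
Proof.
move=> sf; elim: s p => //= v s IH p D'p.
rewrite (@eq_deriv_within _ _ D' _ (derivs_within D s f)) //.
exact: deriv_within_restrict (sf s) D'p.
Qed.

Lemma smooth_restrict f : smooth_on D f -> smooth_on D' f.
Proof.
move=> sf s; have := smooth_derivs s sf => /smooth_diff ds p D'p.
apply: (@eq_diff_on _ _ D' (derivs_within D s f)) => // [q D'q|q D'q].
  by rewrite derivs_restrict.
have [L [cL h]] := ds q (DD' D'q); exists L; split=> // e e0; have := h e e0.
by rewrite !near_withinE; apply: filterS => q' hq /DD'.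
Qed.

End Restrict.

Lemma derivs_withinZ (R : realType) (V : normedModType R) (B : coords V) (D : set V)
  (tD : thick B D) (c : R) (f : V -> R) s x : smooth_on D f -> D x ->
  derivs_within D s (fun y => c * f y) x = c * derivs_within D s f x.
Proof.
move=> sf; elim: s x => //= v s IH x Dx.
rewrite (@eq_deriv_within _ _ D _ (fun y => c * derivs_within D s f y)) //.
by rewrite (deriv_withinZ tD) //; exact/smooth_diff/smooth_derivs.
Qed.

(** * Corners, mean values and symmetry of second derivatives *)

Section Corner.
Context {R : realType} {V : normedModType R} (B : coords V) (D : set V).

(** One sign per basis direction allows for boundary points; two directions at once give the squares
    on which second differences are formed. *)
Definition corner := forall p, D p -> exists (sg : cI B -> R) (d : R),
  [/\ 0 < d, forall k, `|sg k| = 1 & forall k l x y, 0 <= x <= d ->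
    0 <= y <= d -> D (p + (x * sg k) *: ce k + (y * sg l) *: ce l)].

Lemma small_along (p w : V) (u : V -> R) (d : R) : 0 < d ->
  (forall x, 0 <= x <= d -> D (p + x *: w)) -> small_within D p u ->
  forall e, 0 < e -> exists2 r, 0 < r <= d &
    forall x, 0 <= x <= r -> `|u (p + x *: w)| <= e * (x * `|w|).
Proof.
move=> d0 Dw su e e0; have := su e e0.
rewrite near_withinE => /nbhs_normP[r /= r0 hr].
have w1 : 0 < `|w| + 1 by rewrite ltr_wpDl.
exists (Num.min d (r / 2 / (`|w| + 1))).
  by rewrite lt_min d0 !divr_gt0 //= ge_min lexx.
move=> x /andP[x0]; rewrite le_min => /andP[xd]; rewrite ler_pdivlMr // => xr.
have /= := hr (p + x *: w) _ (Dw x _).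
rewrite addrAC subrr add0r normrZ ger0_norm //; apply; last by rewrite x0.
rewrite opprD addrA subrr add0r normrN normrZ ger0_norm //.
by move: xr; rewrite mulrDr mulr1; lra.
Qed.

(** Along the short segment in direction [sg k *: ce k] the form equals the parameter times
    [sg k * a k]; being little-o there, it has [a k = 0]. *)
Lemma corner_thick : corner -> thick B D.
Proof.
move=> cD p a Dp sa k; have [sg [d [d0 sg1 hD]]] := cD p Dp.
have Dw x : 0 <= x <= d -> D (p + x *: (sg k *: ce k)).
  move=> xd; have := hD k k x 0 xd; rewrite lexx ltW // => /(_ isT).
  by rewrite mul0r scale0r addr0 scalerA.
apply/eqP; rewrite -normr_le0; apply/ler_addgt0Pl => e e0; rewrite addr0.
pose e' := e / (`|ce (c := B) k| + 1).
have c1 : 0 < `|ce (c := B) k| + 1 by rewrite ltr_wpDl.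
have [r /andP[r0 rd] hr] := small_along d0 Dw sa (divr_gt0 e0 c1).
have := hr r; rewrite ltW // lexx => /(_ isT) /=.
rewrite addrAC subrr add0r !lformZr lform_ce !normrM normrZ sg1 !mul1r.
rewrite (ger0_norm (ltW r0)) mulrCA ler_pM2l // => h.
apply: le_trans h _; rewrite -mulrA -[leRHS]mulr1 ler_wpM2l ?(ltW e0) //.
by rewrite ler_pdivrMl // mulr1 lerDl.
Qed.

Lemma segment_derive f (p w : V) (x : R) : thick B D -> diff_on D f ->
  (forall y, 0 <= y <= 1 -> D (p + y *: w)) -> 0 < x < 1 ->
  is_derive x 1 (fun y : R => f (p + y *: w)) (deriv_within D w f (p + x *: w)).
Proof.
move=> tD df Dw x01.
have Dx : D (p + x *: w) by apply: Dw; move/andP: x01 => [] *; rewrite !ltW.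
have hf := diff_grad tD df Dx; set a := (fun k => _) in hf.
have dE : deriv_within D w f (p + x *: w) = lform a w by exact: (deriv_withinE w tD Dx hf).
suff H : (h^-1 *: ((fun y => f (p + y *: w)) (h *: 1 + x) - f (p + x *: w)))
    @[h --> 0^'] --> (lform a w : R^o).
  by apply: DeriveDef; [apply: cvgP H|rewrite dE; exact: (cvg_lim _ H)].
apply/cvgrPdist_le => e e0.
have w1 : 0 < `|w| + 1 by rewrite ltr_wpDl.
have := hf (e / (`|w| + 1)) (divr_gt0 e0 w1).
rewrite near_withinE => /nbhs_normP[r /= r0 hr].
near=> h; have h0 : h != 0 by near: h; exact: nbhs_dnbhs_neq.
rewrite /GRing.scale /= mulr1.
have hx : 0 <= h + x <= 1.
  have : `|h| <= Num.min x (1 - x).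
    near: h; apply: dnbhs0_le; rewrite lt_min; move/andP: x01 => [? ?].
    by apply/andP; split; lra.
  by rewrite le_min ler_norml => /andP[/andP[? ?] ]; rewrite ler_norml => /andP[? ?]; apply/andP; split; lra.
have hw : (p + (h + x) *: w) - (p + x *: w) = h *: w.
  by rewrite scalerDl opprD addrACA subrr add0r addrK.
have /= := hr (p + (h + x) *: w) _ (Dw _ hx); rewrite hw lformZr => hh.
rewrite distrC; have -> : h^-1 * (f (p + (h + x) *: w) - f (p + x *: w)) - lform a w =
  h^-1 * (f (p + (h + x) *: w) - f (p + x *: w) - h * lform a w).
  by field.
rewrite normrM normfV ler_pdivrMl ?normr_gt0 //; apply: le_trans (hh _) _.
  rewrite -opprB normrN hw normrZ.
  have : `|h| <= r / 2 / (`|w| + 1) by near: h; apply: dnbhs0_le; rewrite !divr_gt0.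
  rewrite ler_pdivlMr // mulrDr mulr1; have := normr_ge0 h; lra.
rewrite normrZ mulrCA ler_wpM2l // -mulrA -[leRHS]mulr1 ler_wpM2l ?(ltW e0) //.
by rewrite ler_pdivrMl // mulr1 lerDl.
Unshelve. all: by end_near. Qed.

Lemma segment_continuous f (p w : V) : thick B D -> diff_on D f ->
  (forall y, 0 <= y <= 1 -> D (p + y *: w)) ->
  {within `[0, 1], continuous (fun y : R => f (p + y *: w))}.
Proof.
move=> tD df Dw; apply/subspace_continuousP => x /=.
rewrite in_itv /= => x01; apply/cvgrPdist_le => e e0.
have Dx := Dw x x01.
have := lip_within_near e0 (has_grad_lip (diff_grad tD df Dx)).
rewrite !near_withinE => /nbhs_normP[r /= r0 hr].
have w1 : 0 < `|w| + 1 by rewrite ltr_wpDl.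
have : \forall y \near x, `|y - x| <= r / 2 / (`|w| + 1).
  by apply: (@near_ball_norm R R^o); rewrite !divr_gt0.
apply: filterS => y; rewrite ler_pdivlMr // => yx; rewrite in_itv /= => y01.
rewrite distrC; apply: hr; last exact: Dw.
rewrite /= opprD addrACA subrr add0r -scalerBl normrZ distrC.
by move: yx; rewrite mulrDr mulr1; have := normr_ge0 (y - x); lra.
Qed.

Lemma segment_MVT f (p w : V) : thick B D -> diff_on D f ->
  (forall y, 0 <= y <= 1 -> D (p + y *: w)) ->
  exists2 y : R, 0 <= y <= 1 & f (p + w) - f p = deriv_within D w f (p + y *: w).
Proof.
move=> tD df Dw.
have [|y] := @MVT R (fun y => f (p + y *: w))
  (fun y => deriv_within D w f (p + y *: w)) 0 1 ltr01 _
  (segment_continuous tD df Dw).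
  by move=> x; rewrite in_itv /=; exact: segment_derive.
rewrite in_itv /= => /andP[y0 y1]; rewrite scale1r scale0r addr0 subr0 mulr1.
by move=> h; exists y; rewrite ?ltW.
Qed.

(** The product of [f] with [exp (- C y)] has nonpositive derivative along the segment, and the mean
    value theorem compares its ends. *)
Lemma segment_gronwall f (p w : V) (C : R) : thick B D -> diff_on D f ->
  (forall y, 0 <= y <= 1 -> D (p + y *: w)) ->
  (forall y, 0 <= y <= 1 ->
     deriv_within D w f (p + y *: w) <= C * f (p + y *: w)) ->
  f (p + w) <= f p * expR C.
Proof.
move=> tD df Dw fC.
pose u : R -> R := fun y => f (p + y *: w); pose E : R -> R := expR \o ((- C) \*: (id : R -> R)).
have dE (y : R) : is_derive y 1 E (expR (- C * y) * (- C *: 1)).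
  apply: (@is_derive1_comp _ expR ((- C) \*: (id : R -> R))).
have cE : continuous E.
  by move=> y; apply/differentiable_continuous/derivable1_diffP; apply: ex_derive.
have cuE : {within `[0, 1], continuous (u * E)}.
  have /subspace_continuousP cu := segment_continuous tD df Dw.
  apply/subspace_continuousP => x Ax; apply: cvgM; first exact: cu.
  by apply: cvg_within_filter; exact: cE.
have [y||y] := @MVT R (u * E) (fun y => u y *: (expR (- C * y) * (- C *: 1)) +
    E y *: deriv_within D w f (p + y *: w)) 0 1 ltr01.
- rewrite in_itv /= => y01; apply: is_deriveM; exact: segment_derive.
- exact: cuE.
rewrite in_itv /= => /andP[y0 y1]; rewrite subr0 mulr1 => h.
have {}y01 : 0 <= y <= 1 by rewrite !ltW.
have Ey : E y = expR (- C * y) by [].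
have h1 : (u * E) 1 - (u * E) 0 <= 0.
  rewrite h Ey /GRing.scale /= mulr1 mulrCA -mulrDr pmulr_rle0 ?expR_gt0 //.
  by have := fC y y01; rewrite /u; lra.
move: h1; rewrite /GRing.mul /= /u /E /= scale1r scale0r addr0.
rewrite /GRing.scale /= mulr1 mulr0 expR0 mulr1 expRN subr_le0.
by rewrite ler_pdivrMr ?expR_gt0.
Qed.

Lemma deriv_within_scale f (p v : V) (c : R) : thick B D -> diff_on D f -> D p ->
  deriv_within D (c *: v) f p = c * deriv_within D v f p.
Proof.
move=> tD df Dp; have hf := diff_grad tD df Dp.
by rewrite !(deriv_withinE _ tD Dp hf) lformZr.
Qed.

(** The second difference is the increment, in direction [a], of the difference of [f] on two
    parallel segments. The mean value theorem turns it into a difference of two values of the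
    derivative along [a], which is expanded to first order at [p]. *)
Lemma second_difference f (p a b : V) (d : R) : thick B D -> diff_on D f ->
  diff_on D (deriv_within D a f) -> D p -> 0 < d ->
  (forall x y, 0 <= x <= d -> 0 <= y <= d -> D (p + x *: a + y *: b)) ->
  forall e, 0 < e -> exists2 r, 0 < r <= d & forall s, 0 <= s <= r ->
  `|f (p + s *: a + s *: b) - f (p + s *: a) - f (p + s *: b) + f p
    - s * (s * deriv_within D b (deriv_within D a f) p)| <= e * (s * s).
Proof.
move=> tD df dfa Dp d0 Dab e e0.
(* Two errors of size [e / K * s * (|a| + |b|)] then add up to at most [e * s]. *)
pose K := 2 * (`|a| + `|b|) + 1.
have K0 : 0 < K by rewrite /K ltr_wpDl // mulr_ge0 // addr_ge0.
have hfa := diff_grad tD dfa Dp; set c := (fun k => _) in hfa.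
have cE : deriv_within D b (deriv_within D a f) p = lform c b.
  exact: (deriv_withinE b tD Dp hfa).
have := hfa (e / K) (divr_gt0 e0 K0).
rewrite near_withinE => /nbhs_normP[r /= r0 hr].
exists (Num.min d (r / 2 / K)); first by rewrite lt_min d0 !divr_gt0 //= ge_min lexx.
move=> s /andP[s0]; rewrite le_min => /andP[sd]; rewrite ler_pdivlMr // => sr.
have Ds x y : 0 <= x <= 1 -> 0 <= y <= 1 -> D (p + (x * s) *: a + (y * s) *: b).
  move=> /andP[x0 x1] /andP[y0 y1]; apply: Dab.
    by rewrite mulr_ge0 //= (le_trans _ sd) // -[leRHS]mul1r ler_wpM2r.
  by rewrite mulr_ge0 //= (le_trans _ sd) // -[leRHS]mul1r ler_wpM2r.
have i01 : (0 <= 1 :> R) && (1 <= 1 :> R) by rewrite ler01 lexx.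
have i00 : (0 <= 0 :> R) && (0 <= 1 :> R) by rewrite ler01 lexx.
have D1 x : 0 <= x <= 1 -> D (p + s *: b + x *: (s *: a)).
  by move=> /Ds/(_ i01); rewrite mul1r scalerA addrAC.
have D0 x : 0 <= x <= 1 -> D (p + x *: (s *: a)).
  by move=> /Ds/(_ i00); rewrite mul0r scale0r addr0 scalerA.
pose u x := f (p + s *: b + x *: (s *: a)); pose v x := f (p + x *: (s *: a)).
have [x||x] := @MVT R (u - v) (fun x => deriv_within D (s *: a) f (p + s *: b + x *: (s *: a))
   - deriv_within D (s *: a) f (p + x *: (s *: a))) 0 1 ltr01.
- by rewrite in_itv /= => x01; apply: is_deriveB; exact: segment_derive.
- by apply: within_continuousB; exact: segment_continuous.
rewrite in_itv /= => /andP[x0 x1]; rewrite subr0 mulr1.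
have {}x01 : 0 <= x <= 1 by rewrite !ltW.
rewrite !deriv_within_scale //; [|exact: D0|exact: D1].
have bnd y : 0 <= y <= 1 -> `|deriv_within D a f (p + (x * s) *: a + (y * s) *: b)
     - deriv_within D a f p - ((x * s) * lform c a + (y * s) * lform c b)| <=
     e / K * (s * (`|a| + `|b|)).
  move=> y01; have /= := hr _ _ (Ds x y x01 y01).
  have -> : p + (x * s) *: a + (y * s) *: b - p = (x * s) *: a + (y * s) *: b.
    by rewrite -[p + _ + _]addrA [p + _]addrC addrK.
  rewrite lformDr !lformZr => H.
  have nb : `|(x * s) *: a + (y * s) *: b| <= s * (`|a| + `|b|).
    apply: le_trans (ler_normD _ _) _; rewrite !normrZ mulrDr.
    move/andP: y01 => [y0 y1]; rewrite !ger0_norm ?mulr_ge0 // ?(ltW x0) //.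
    by apply: lerD; apply: ler_wpM2r => //; rewrite -[leRHS]mul1r ler_wpM2r // (ltW x1).
  apply: le_trans (H _) _.
    rewrite -[p + _ + _]addrA opprD addrA subrr add0r normrN (le_lt_trans nb) //.
    by move: sr; rewrite /K; have := mulr_ge0 s0 (addr_ge0 (normr_ge0 a) (normr_ge0 b)); lra.
  by rewrite ler_wpM2l // divr_ge0 ?ltW.
move: (bnd 0 i00) (bnd 1 i01); rewrite mul0r scale0r addr0 mul1r mul0r addr0.
have uvE y : (u - v) y = u y - v y by [].
rewrite !uvE /u /v !scale1r !scale0r !addr0 scalerA.
rewrite [p + s *: b + _]addrAC [p + s *: b + _]addrAC.
set A1 := deriv_within _ _ _ (p + _ + _); set A0 := deriv_within _ _ _ (p + _ *: a).
move=> b0 b1 h; rewrite cE.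
have -> : f (p + s *: a + s *: b) - f (p + s *: a) - f (p + s *: b) + f p =
  s * A1 - s * A0 by rewrite -h; ring.
have -> : s * A1 - s * A0 - s * (s * lform c b) = s * ((A1 - deriv_within D a f p -
  (x * s * lform c a + s * lform c b)) - (A0 - deriv_within D a f p - x * s * lform c a)).
  ring.
rewrite normrM ger0_norm // mulrCA ler_wpM2l //.
apply: le_trans (ler_normB _ _) _.
apply: le_trans (lerD b1 b0) _.
have -> : e / K * (s * (`|a| + `|b|)) + e / K * (s * (`|a| + `|b|)) =
  e * (K^-1 * (2 * (s * (`|a| + `|b|)))) by ring.
rewrite ler_wpM2l ?(ltW e0) // ler_pdivrMl // /K; lra.
Qed.

(** The second difference is symmetric in [a] and [b], and both mixed derivatives, multiplied by
    [s^2], lie within [e / 2 * s^2] of it. *)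
Lemma schwarz f (p a b : V) (d : R) : thick B D -> diff_on D f ->
  diff_on D (deriv_within D a f) -> diff_on D (deriv_within D b f) ->
  D p -> 0 < d ->
  (forall x y, 0 <= x <= d -> 0 <= y <= d -> D (p + x *: a + y *: b)) ->
  deriv_within D b (deriv_within D a f) p = deriv_within D a (deriv_within D b f) p.
Proof.
move=> tD df dfa dfb Dp d0 Dab.
have Dba x y : 0 <= x <= d -> 0 <= y <= d -> D (p + x *: b + y *: a).
  by move=> xd yd; rewrite addrAC; exact: Dab.
apply/eqP; rewrite -subr_eq0 -normr_le0; apply/ler_addgt0Pl => e e0; rewrite addr0.
have e2 : 0 < e / 2 by rewrite divr_gt0.
have [r1 /andP[r10 r1d] h1] := second_difference tD df dfa Dp d0 Dab e2.
have [r2 /andP[r20 r2d] h2] := second_difference tD df dfb Dp d0 Dba e2.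
pose s := Num.min r1 r2.
have s0 : 0 < s by rewrite lt_min r10.
have := h1 s; rewrite (ltW s0) ge_min lexx /= => /(_ isT) {}h1.
have := h2 s; rewrite (ltW s0) ge_min lexx orbT /= => /(_ isT) {}h2.
move: h1 h2; rewrite [p + s *: b + s *: a]addrAC.
set A := deriv_within D b _ p; set A' := deriv_within D a _ p => h1 h2.
have : `|s * s * (A - A')| <= s * s * e.
  move: h1 h2; rewrite !ler_norml => /andP[? ?] /andP[? ?].
  by apply/andP; split; lra.
by rewrite normrM (ger0_norm (mulr_ge0 (ltW s0) (ltW s0))) ler_pM2l // mulr_gt0.
Qed.

(** The square at [p] is spanned by signed basis vectors; both signs factor out of the two sides and
    cancel. *)
Lemma corner_schwarz f p k l : corner -> smooth_on D f -> D p ->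
  deriv_within D (ce (c := B) l) (deriv_within D (ce (c := B) k) f) p =
  deriv_within D (ce k) (deriv_within D (ce l) f) p.
Proof.
move=> cD sf Dp; have tD := corner_thick cD.
have [sg [d [d0 sg1 hD]]] := cD p Dp.
have sg0 m : sg m != 0 by rewrite -normr_gt0 sg1.
have df := smooth_diff sf.
have ds m : diff_on D (deriv_within D (sg m *: ce m) f).
  exact/smooth_diff/smooth_deriv.
have dm m : diff_on D (deriv_within D (ce (c := B) m) f).
  exact/smooth_diff/smooth_deriv.
have H : deriv_within D (sg l *: ce l) (deriv_within D (sg k *: ce k) f) p =
  deriv_within D (sg k *: ce k) (deriv_within D (sg l *: ce l) f) p.
  apply: (schwarz tD df (ds k) (ds l) Dp d0) => x y xd yd.
  by rewrite !scalerA; exact: hD.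
have E m j : deriv_within D (sg m *: ce m) (deriv_within D (sg j *: ce j) f) p =
    sg m * (sg j * deriv_within D (ce m) (deriv_within D (ce j) f) p).
  rewrite (@eq_deriv_within _ _ D _ (fun q => sg j * deriv_within D (ce j) f q)) //.
    by rewrite (deriv_withinZ tD) // deriv_within_scale //; ring.
  by move=> q Dq; rewrite deriv_within_scale.
move: H; rewrite !E mulrCA => /(mulfI (sg0 k)) /(mulfI (sg0 l)).
exact.
Qed.

End Corner.

(** * Space, space-time and domains with corners *)

Section CoordsRow.
Context {R : realType} (N : nat).

Lemma row_entry_le (v : 'rV[R]_N) k : `|v 0 k| <= `|v|.
Proof. by rewrite [leRHS]mx_normrE; apply: (le_bigmax _ _ (0, k)). Qed.

Lemma row_norm_le (v : 'rV[R]_N) (c : R) : 0 <= c ->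
  (forall k, `|v 0 k| <= c) -> `|v| <= c.
Proof.
move=> c0 h; rewrite [leLHS]mx_normrE; apply/bigmax_leP; split=> // -[i k] _ /=.
by rewrite ord1.
Qed.

Lemma row_delta_norm_le k : `|delta_mx 0 k : 'rV[R]_N| <= 1.
Proof.
apply: row_norm_le => // l; rewrite mxE /=.
by case: (l == k); rewrite ?normr1 ?normr0.
Qed.

Definition coords_rV : coords 'rV[R]_N.
Proof.
apply: (@Coords R 'rV[R]_N 'I_N (fun k => delta_mx 0 k) (fun k v => v 0 k)).
- by move=> k a u v; rewrite !mxE.
- by move=> k l; rewrite mxE eqxx.
- by move=> v; exact: row_sum_delta.
- by move=> k v; exact: row_entry_le.
Defined.

(** The index [None] is the time direction, [Some k] the spatial direction [k]. *)
Definition coords_st : coords ('rV[R]_N * R)%type.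
Proof.
apply: (@Coords R ('rV[R]_N * R)%type (option 'I_N)
  (fun k => if k is Some k then (delta_mx 0 k, 0) else (0, 1))
  (fun k v => if k is Some k then v.1 0 k else v.2)).
- by move=> [k|] a u v //=; rewrite !mxE.
- by move=> [k|] [l|] //=; rewrite ?mxE ?eqxx.
- move=> [u t]; rewrite (bigD1 None) //= (@reindex_omap _ _ _ _ _ Some id) /=; last by case.
  rewrite (eq_bigl xpredT) => [|k]; last by rewrite eqxx.
  rewrite (_ : \sum_(k < N) _ = (u, 0)); last first.
    rewrite [X in (X, _)]row_sum_delta; elim/big_rec2: _ => // k y z _ ->.
    by congr (_, _); rewrite /= scaler0 addr0.
  by congr (_, _); rewrite /= ?scaler0 ?add0r // addr0 /GRing.scale /= mulr1.
- move=> [k|] [u t] /=; rewrite prod_normE /= le_max.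
    by rewrite row_entry_le.
  by rewrite lexx orbT.
Defined.

(** The common shape of the domains below. Only increasing coordinates are allowed, since the radius
    is one of them and the top [eps * r^2] of the time interval increases with it. *)
Definition upper_rV (D : set 'rV[R]_N) := forall q, D q -> exists2 d : R, 0 < d &
  forall q', `|q' - q| <= d -> (forall k, q 0 k <= q' 0 k) -> D q'.

(** The sign [s] is the direction in which time can move: forwards at [t = 0], backwards at a point
    of the top [t = eps * r^2]. *)
Definition upper_st (D : set ('rV[R]_N * R)) := forall q t, D (q, t) ->
  exists d s : R, [/\ 0 < d, `|s| = 1 & forall q' t', `|q' - q| <= d ->
    (forall k, q 0 k <= q' 0 k) -> `|t' - t| <= d -> 0 <= s * (t' - t) ->
    D (q', t')].

Lemma upper_rV_corner D : upper_rV D -> corner coords_rV D.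
Proof.
move=> uD q Dq; have [d d0 hd] := uD q Dq; exists (fun=> 1), (d / 2).
split=> [||k l x y /andP[x0 xd] /andP[y0 yd]]; rewrite ?divr_gt0 ?normr1 //.
rewrite !mulr1; apply: hd => [|j].
  rewrite -[q + _ + _]addrA [q + _]addrC addrK; apply: le_trans (ler_normD _ _) _.
  rewrite !normrZ !ger0_norm //.
  have := ler_wpM2l x0 (row_delta_norm_le k).
  by have := ler_wpM2l y0 (row_delta_norm_le l); lra.
by rewrite !mxE -addrA lerDl addr_ge0 // mulr_ge0.
Qed.

Lemma upper_st_corner D : upper_st D -> corner coords_st D.
Proof.
move=> uD [q t] Dq; have [d [s [d0 s1 hd]]] := uD q t Dq.
exists (fun k => if k is Some _ then 1 else s), (d / 2).
split=> [|[k|]|k l x y /andP[x0 xd] /andP[y0 yd]]; rewrite ?divr_gt0 ?normr1 //.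
have ss : s * s = 1 by rewrite -expr2 -real_normK ?num_real // s1 expr1n.
pose w (k : option 'I_N) : 'rV[R]_N := if k is Some k then delta_mx 0 k else 0.
pose z (k : option 'I_N) : R := if k is Some k then 0 else s.
have E x' (k' : cI coords_st) : (x' * (if k' is Some _ then 1 else s)) *: ce k' =
    (x' *: w k', x' * z k').
  by case: k' => [k'|] /=; congr (_, _); rewrite /= ?mulr1 ?mulr0 ?scaler0 //
    /GRing.scale /= ?mulr0 ?mulr1.
have w0 k' j : 0 <= w k' 0 j by case: k' => [k'|]; rewrite mxE.
have w1 k' : `|w k'| <= 1.
  by case: k' => [k'|] /=; [exact: row_delta_norm_le|rewrite normr0].
have z0 k' : 0 <= s * z k' by case: k' => [k'|] /=; rewrite ?mulr0 // ss.
have z1 k' : `|z k'| <= 1 by case: k' => [k'|] /=; rewrite ?normr0 ?s1.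
rewrite !E; apply: hd => [|j||] /=.
- rewrite -[q + _ + _]addrA [q + _]addrC addrK; apply: le_trans (ler_normD _ _) _.
  rewrite !normrZ !ger0_norm //.
  have := ler_wpM2l x0 (w1 k).
  by have := ler_wpM2l y0 (w1 l); lra.
- by rewrite !mxE -addrA lerDl addr_ge0 // mulr_ge0 // w0.
- rewrite -[t + _ + _]addrA [t + _]addrC addrK; apply: le_trans (ler_normD _ _) _.
  rewrite !normrM !(ger0_norm x0) !(ger0_norm y0).
  have := ler_wpM2l x0 (z1 k).
  by have := ler_wpM2l y0 (z1 l); lra.
- rewrite -[t + _ + _]addrA [t + _]addrC addrK mulrDr !(mulrCA s).
  by rewrite addr_ge0 // mulr_ge0.
Qed.

Lemma upper_slice D t : upper_st D -> upper_rV [set q | D (q, t)].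
Proof.
move=> uD q Dq; have [d [s [d0 s1 hd]]] := uD q t Dq; exists d => // q' qd qk.
by apply: hd => //; rewrite subrr ?normr0 ?mulr0 // ltW.
Qed.

Lemma upper_rV_thick D : upper_rV D -> thick coords_rV D.
Proof. by move=> uD; exact/corner_thick/upper_rV_corner. Qed.

Lemma upper_st_thick D : upper_st D -> thick coords_st D.
Proof. by move=> uD; exact/corner_thick/upper_st_corner. Qed.

Lemma open_upper_rV D : open D -> upper_rV D.
Proof.
move=> oD q Dq; have /nbhs_normP[d /= d0 hd] : nbhs q D by exact: open_nbhs_nbhs.
exists (d / 2); first by rewrite divr_gt0.
by move=> q' qd _; apply: hd => /=; rewrite distrC; lra.
Qed.

Section Slice.
Variables (D : set ('rV[R]_N * R)) (t : R).
Hypothesis uD : upper_st D.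
Let Dt := [set q | D (q, t)].

Let compo (k : cI coords_st) : diff_on Dt (fun q => cc k (q, t)).
Proof.
have tDt := upper_rV_thick (upper_slice (t := t) uD).
case: k => [k|] /=; last exact: (diff_on_cst coords_rV).
exact: smooth_diff (smooth_cc tDt k).
Qed.

Lemma deriv_within_slice f q v : diff_on D f -> D (q, t) ->
  deriv_within Dt v (fun q => f (q, t)) q = deriv_within D (v, 0) f (q, t).
Proof.
move=> df Dq; have tDt := upper_rV_thick (upper_slice (t := t) uD).
have tD := upper_st_thick uD.
rewrite (deriv_within_comp tDt tD _ (fun q => id) compo df Dq).
rewrite (deriv_within_lform tD _ df Dq); apply: eq_bigr => -[k|] _ /=; last first.
  by rewrite (deriv_within_cst tDt).
by rewrite (deriv_within_cc tDt k v Dq).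
Qed.

Lemma smooth_slice f : smooth_on D f -> smooth_on Dt (fun q => f (q, t)).
Proof.
move=> sf; have tDt := upper_rV_thick (upper_slice (t := t) uD).
apply: (smooth_comp tDt (upper_st_thick uD)) sf => //= -[k|] /=.
  exact: (smooth_cc tDt k).
exact: smooth_cst tDt _.
Qed.

End Slice.

End CoordsRow.

(** * Matrices and local Riemannian geometry *)

Section MatrixDerivative.
Context {R : realType} {V : normedModType R} (B : coords V) (D : set V).
Hypothesis tD : thick B D.

Definition dmx m n (v : V) (M : V -> 'M[R]_(m, n)) (p : V) : 'M[R]_(m, n) :=
  \matrix_(i, j) deriv_within D v (fun q => M q i j) p.

Definition smoothmx m n (M : V -> 'M[R]_(m, n)) :=
  forall i j, smooth_on D (fun q => M q i j).

Lemma smooth_mulmx m n k (M : V -> 'M[R]_(m, n)) (M' : V -> 'M[R]_(n, k)) :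
  smoothmx M -> smoothmx M' -> smoothmx (fun q => M q *m M' q).
Proof.
move=> sM sM' i j; under eq_fun do rewrite mxE.
by apply: (smooth_sum tD) => l; exact: (smoothM tD).
Qed.

Lemma smooth_trmx m n (M : V -> 'M[R]_(m, n)) :
  smoothmx M -> smoothmx (fun q => (M q)^T).
Proof. by move=> sM i j; under eq_fun do rewrite mxE; exact: sM. Qed.

Lemma smooth_scalemx m n (f : V -> R) (M : V -> 'M[R]_(m, n)) :
  smooth_on D f -> smoothmx M -> smoothmx (fun q => f q *: M q).
Proof. by move=> sf sM i j; under eq_fun do rewrite mxE; exact: (smoothM tD). Qed.

Lemma smooth_summx m n (I : Type) (r : seq I) (M : I -> V -> 'M[R]_(m, n)) :
  (forall k, smoothmx (M k)) -> smoothmx (fun q => \sum_(k <- r) M k q).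
Proof.
move=> sM i j; under eq_fun do rewrite summxE.
by apply: (smooth_sum tD) => k; exact: sM.
Qed.

Lemma smooth_dmx m n v (M : V -> 'M[R]_(m, n)) : smoothmx M -> smoothmx (dmx v M).
Proof. by move=> sM i j; under eq_fun do rewrite mxE; exact: smooth_deriv. Qed.

Lemma smooth_det n (M : V -> 'M[R]_n) : smoothmx M -> smooth_on D (fun q => \det (M q)).
Proof.
move=> sM; rewrite /determinant; apply: (smooth_sum tD) => s; apply: (smoothM tD).
  exact: (smooth_cst tD).
by apply: (smooth_prod tD) => i.
Qed.

Lemma smooth_invmx n (M : V -> 'M[R]_n) : smoothmx M ->
  (forall p, D p -> M p \in unitmx) -> smoothmx (fun q => invmx (M q)).
Proof.
move=> sM uM i j.
apply: (@eq_smooth _ _ D (fun q => (\det (M q))^-1 * ((-1) ^+ (j + i) *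
    \det (row' j (col' i (M q)))))).
  by move=> q Dq; rewrite /invmx uM // !mxE.
apply: (smoothM tD).
  apply: (smoothV tD); first exact: smooth_det.
  by move=> p /uM; rewrite unitmxE unitfE.
apply: (smoothM tD); first exact: (smooth_cst tD).
by apply: smooth_det => k l; under eq_fun do rewrite !mxE; exact: sM.
Qed.

Lemma dmxM m n k v (M : V -> 'M[R]_(m, n)) (M' : V -> 'M[R]_(n, k)) p :
  smoothmx M -> smoothmx M' -> D p ->
  dmx v (fun q => M q *m M' q) p = dmx v M p *m M' p + M p *m dmx v M' p.
Proof.
move=> sM sM' Dp; apply/matrixP => i j; rewrite !mxE -big_split /=.
under eq_fun do rewrite mxE.
rewrite (deriv_within_sum tD) => // [|l]; last first.
  by apply: smooth_diff; exact: (smoothM tD).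
apply: eq_bigr => l _; rewrite !mxE.
by rewrite (deriv_withinM tD) //; exact: smooth_diff.
Qed.

Lemma dmxD m n v (M M' : V -> 'M[R]_(m, n)) p : smoothmx M -> smoothmx M' -> D p ->
  dmx v (fun q => M q + M' q) p = dmx v M p + dmx v M' p.
Proof.
move=> sM sM' Dp; apply/matrixP => i j; rewrite !mxE.
under eq_fun do rewrite mxE.
by rewrite (deriv_withinD tD) //; exact: smooth_diff.
Qed.

Lemma dmxZ m n v (c : R) (M : V -> 'M[R]_(m, n)) p : smoothmx M -> D p ->
  dmx v (fun q => c *: M q) p = c *: dmx v M p.
Proof.
move=> sM Dp; apply/matrixP => i j; rewrite !mxE.
under eq_fun do rewrite mxE.
by rewrite (deriv_withinZ tD) //; exact: smooth_diff.
Qed.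

Lemma dmx_scale m n v (f : V -> R) (M : V -> 'M[R]_(m, n)) p :
  smooth_on D f -> smoothmx M -> D p ->
  dmx v (fun q => f q *: M q) p = deriv_within D v f p *: M p + f p *: dmx v M p.
Proof.
move=> sf sM Dp; apply/matrixP => i j; rewrite !mxE.
under eq_fun do rewrite mxE.
by rewrite (deriv_withinM tD) //; exact: smooth_diff.
Qed.

Lemma dmx_sum m n v (I : Type) (r : seq I) (M : I -> V -> 'M[R]_(m, n)) p :
  (forall k, smoothmx (M k)) -> D p ->
  dmx v (fun q => \sum_(k <- r) M k q) p = \sum_(k <- r) dmx v (M k) p.
Proof.
move=> sM Dp; apply/matrixP => i j; rewrite !mxE summxE.
under eq_fun do rewrite summxE.
rewrite (deriv_within_sum tD) => // [|k]; last by apply: smooth_diff; exact: sM.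
by apply: eq_bigr => k _; rewrite mxE.
Qed.

Lemma dmx_tr m n v (M : V -> 'M[R]_(m, n)) p : dmx v (fun q => (M q)^T) p = (dmx v M p)^T.
Proof.
by apply/matrixP => i j; rewrite !mxE; under eq_fun do rewrite mxE.
Qed.

Lemma eq_dmx m n v (M M' : V -> 'M[R]_(m, n)) p : (forall q, D q -> M q = M' q) ->
  D p -> dmx v M p = dmx v M' p.
Proof.
move=> MM' Dp; apply/matrixP => i j; rewrite !mxE.
by apply: eq_deriv_within => // q Dq; rewrite MM'.
Qed.

Lemma dmx_invmx n v (M : V -> 'M[R]_n) p : smoothmx M ->
  (forall p, D p -> M p \in unitmx) -> D p ->
  dmx v (fun q => invmx (M q)) p = - (invmx (M p) *m dmx v M p *m invmx (M p)).
Proof.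
move=> sM uM Dp; have sV := smooth_invmx sM uM.
have : dmx v (fun q => M q *m invmx (M q)) p = 0.
  rewrite (@eq_dmx _ _ _ _ (fun=> 1%:M)) // => [|q Dq]; last by rewrite mulmxV ?uM.
  by apply/matrixP => i j; rewrite !mxE (deriv_within_cst tD).
rewrite dmxM // => /(congr1 (mulmx (invmx (M p)))).
rewrite mulmxDr mulmx0 !mulmxA mulVmx ?uM // mul1mx => /eqP.
by rewrite addrC addr_eq0 => /eqP.
Qed.

End MatrixDerivative.

(** * The Levi-Civita connection and its curvature in matrix form *)

Section Geometry.
Context {R : realType} {V : normedModType R} {N : nat}.
Variables (D : set V) (e : 'I_N -> V) (G : V -> 'M[R]_N).

(** From here on the formulas of [LocalGeometry] are repeated for directions [e i] in any space [V].
    With [V] space-time and [e] the spatial directions, curvature becomes a function on space-time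
    that can be differentiated in time as well. *)
Definition gpd (i : 'I_N) (f : V -> R) : V -> R := deriv_within D (e i) f.

Definition gchr (k i j : 'I_N) (x : V) : R :=
  2^-1 * \sum_(l < N) invmx (G x) k l *
    (gpd i (fun y => G y j l) x + gpd j (fun y => G y i l) x
     - gpd l (fun y => G y i j) x).

Definition griem (l i j k : 'I_N) (x : V) : R :=
  gpd i (gchr l j k) x - gpd j (gchr l i k) x
  + \sum_(m < N) (gchr l i m x * gchr m j k x - gchr l j m x * gchr m i k x).

Definition gricci (j k : 'I_N) (x : V) : R := \sum_(i < N) griem i i j k x.

Definition gtensor : Type := seq 'I_N -> V -> R.

Definition gRm : gtensor := fun I x =>
  if I is [:: i; j; k; l] then \sum_(m < N) griem m i j k x * G x m l else 0.

Definition gnabla (T : gtensor) : gtensor := fun I x =>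
  if I is i :: J then
    gpd i (T J) x
    - \sum_(p < size J) \sum_(m < N)
        gchr m i (nth i J p) x * T (set_nth i J p m) x
  else 0.

(** Connection and curvature matrices in the row convention: row [j] of [gchrmx i] holds the
    components of the derivative of the [j]-th coordinate field along the [i]-th. *)
Definition gchrmx (i : 'I_N) (x : V) : 'M[R]_N := \matrix_(j, k) gchr k i j x.
Definition griemmx (i j : 'I_N) (x : V) : 'M[R]_N := \matrix_(k, l) griem l i j k x.

(** The action of the endomorphism [C] on a covariant tensor as a derivation, one slot at a time;
    the recursion on the index list replaces the sum over positions with [set_nth]. *)
Fixpoint slots (C : 'M[R]_N) (I : seq 'I_N) (T : seq 'I_N -> R) : R :=
  if I is j :: J then
    \sum_m C j m * T (m :: J) + slots C J (fun L => T (j :: L))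
  else 0.

Lemma slotsE i J (T : gtensor) x :
  \sum_(p < size J) \sum_(m < N)
        gchr m i (nth i J p) x * T (set_nth i J p m) x =
  slots (gchrmx i x) J (T^~ x).
Proof.
elim: J T => [|j J IH] T /=; first by rewrite big_ord0.
rewrite big_ord_recl /=; congr (_ + _); last exact: (IH (fun L => T (j :: L))).
by apply: eq_bigr => m _; rewrite mxE.
Qed.

Lemma gnablaE T i J x :
  gnabla T (i :: J) x = gpd i (T J) x - slots (gchrmx i x) J (T^~ x).
Proof. by rewrite /gnabla slotsE. Qed.

Context (B : coords V).
Hypotheses (tD : thick B D) (sG : smoothmx D G).
Hypothesis (symG : forall x, D x -> (G x)^T = G x).
Hypothesis (uG : forall x, D x -> G x \in unitmx).

Lemma gsym x i j : D x -> G x i j = G x j i.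
Proof. by move=> Dx; rewrite -{1}(symG Dx) mxE. Qed.

Lemma gpd_sym x k i j : D x ->
  gpd k (fun y => G y i j) x = gpd k (fun y => G y j i) x.
Proof. by move=> Dx; apply: eq_deriv_within => // y Dy; exact: gsym. Qed.

Lemma smooth_gpd i f : smooth_on D f -> smooth_on D (gpd i f).
Proof. exact: smooth_deriv. Qed.

Lemma smooth_gchr k i j : smooth_on D (gchr k i j).
Proof.
apply: (smoothM tD); first exact: (smooth_cst tD).
apply: (smooth_sum tD) => l; apply: (smoothM tD); first exact: (smooth_invmx tD).
by apply: (smoothB tD); first apply: (smoothD tD); apply: smooth_gpd.
Qed.

Lemma smooth_gchrmx i : smoothmx D (gchrmx i).
Proof. by move=> j k; under eq_fun do rewrite mxE; exact: smooth_gchr. Qed.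

Lemma smooth_griem l i j k : smooth_on D (griem l i j k).
Proof.
apply: (smoothD tD); first by apply: (smoothB tD); apply/smooth_gpd/smooth_gchr.
by apply: (smooth_sum tD) => m; apply: (smoothB tD); apply: (smoothM tD);
  exact: smooth_gchr.
Qed.

Lemma smooth_gricci j k : smooth_on D (gricci j k).
Proof. by apply: (smooth_sum tD) => i; exact: smooth_griem. Qed.

Lemma smooth_gRm I : smooth_on D (gRm I).
Proof.
case: I => [|i [|j [|k [|l [|m I]]]]]; try exact: (smooth_cst tD).
by apply: (smooth_sum tD) => m; apply: (smoothM tD); first exact: smooth_griem.
Qed.

Lemma smooth_gnabla T : (forall I, smooth_on D (T I)) ->
  forall I, smooth_on D (gnabla T I).
Proof.
move=> sT [|i J]; first exact: (smooth_cst tD).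
apply: (smoothB tD); first exact: smooth_gpd.
by apply: (smooth_sum tD) => p; apply: (smooth_sum tD) => m; apply: (smoothM tD);
  first exact: smooth_gchr.
Qed.

Lemma smooth_nablaRm k I : smooth_on D (iter k gnabla gRm I).
Proof. by elim: k I => [|k IH] I /=; [exact: smooth_gRm|exact: smooth_gnabla]. Qed.

Lemma gchr_sym k i j x : D x -> gchr k i j x = gchr k j i x.
Proof.
move=> Dx; congr (_ * _); apply: eq_bigr => l _; congr (_ * _).
by rewrite (gpd_sym l i j) //; congr (_ - _); rewrite addrC.
Qed.

Lemma gchrmx_lower i j l x : D x -> (gchrmx i x *m G x) j l =
  2^-1 * (gpd i (fun y => G y j l) x + gpd j (fun y => G y i l) x
     - gpd l (fun y => G y i j) x).
Proof.
move=> Dx; set F := fun l => 2^-1 * (gpd i (fun y => G y j l) x +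
  gpd j (fun y => G y i l) x - gpd l (fun y => G y i j) x).
have -> : gchrmx i x = \matrix_(j', k) (\row_l (2^-1 * (gpd i (fun y => G y j' l) x +
  gpd j' (fun y => G y i l) x - gpd l (fun y => G y i j') x)) *m invmx (G x)) 0 k.
  apply/matrixP => j' k; rewrite !mxE /gchr mulr_sumr; apply: eq_bigr => m _.
  rewrite mxE; have -> : invmx (G x) k m = invmx (G x) m k.
    by rewrite -[in LHS](symG Dx) -trmx_inv mxE.
  ring.
rewrite mxE; under eq_bigr do rewrite mxE.
have := congr1 (fun M : 'rV_N => M 0 l) (mulmxKV (uG Dx) (\row_l F l)).
by rewrite mxE => ->; rewrite mxE.
Qed.

(** Parallelism of the metric: in the symmetric part of the Christoffel symbols of the first kind
    two of the three derivatives cancel. *)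
Lemma gchr_compat i x : D x ->
  dmx D (e i) G x = gchrmx i x *m G x + G x *m (gchrmx i x)^T.
Proof.
move=> Dx; apply/matrixP => j l.
have -> : G x *m (gchrmx i x)^T = (gchrmx i x *m G x)^T by rewrite trmx_mul symG.
have L := gchrmx_lower i _ _ Dx.
rewrite [RHS]mxE [_^T _ _]mxE !L mxE -/(gpd i _ x) (gpd_sym i l j) //.
by field.
Qed.

(** Koszul's argument: a torsion-free family compatible with the metric is the Levi-Civita
    connection. It identifies transformed connections without expanding the Christoffel formula. *)
Lemma gchr_uniq (C : 'I_N -> 'M[R]_N) x : D x ->
  (forall i j k, C i j k = C j i k) ->
  (forall i, dmx D (e i) G x = C i *m G x + G x *m (C i)^T) ->
  forall i, C i = gchrmx i x.
Proof.
move=> Dx symC compC i.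
rewrite -[LHS](mulmxK (uG Dx)) -[RHS](mulmxK (uG Dx)); congr (_ *m _).
have symL a b c : (C a *m G x) b c = (C b *m G x) a c.
  by rewrite !mxE; apply: eq_bigr => m _; rewrite symC.
have comp a b c : gpd a (fun y => G y b c) x = (C a *m G x) b c + (C a *m G x) c b.
  have := congr1 (fun M : 'M[R]_N => M b c) (compC a); rewrite /gpd mxE => ->.
  have -> : G x *m (C a)^T = (C a *m G x)^T by rewrite trmx_mul symG.
  by rewrite [LHS]mxE [_^T _ _]mxE.
apply/matrixP => j l; rewrite gchrmx_lower // !comp.
rewrite (symL l i j) (symL l j i) (symL j i l); by field.
Qed.

(** The products come in the order opposite to the usual one because the matrices act on rows. *)
Lemma griemmxE i j x : D x -> griemmx i j x =
  dmx D (e i) (gchrmx j) x - dmx D (e j) (gchrmx i) x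
  + (gchrmx j x *m gchrmx i x - gchrmx i x *m gchrmx j x).
Proof.
move=> Dx; apply/matrixP => k l; rewrite [LHS]mxE /griem.
rewrite !mxE -sumrB; congr (_ - _ + _); rewrite /gpd.
- by apply: eq_deriv_within => // y _; rewrite mxE.
- by apply: eq_deriv_within => // y _; rewrite mxE.
- by apply: eq_bigr => m _; rewrite !mxE; congr (_ - _); rewrite mulrC.
Qed.

Lemma gRmE i j k l x : gRm [:: i; j; k; l] x = (griemmx i j x *m G x) k l.
Proof. by rewrite mxE; apply: eq_bigr => m _; rewrite mxE. Qed.

Lemma gricciE j k x : gricci j k x = \sum_i griemmx i j x k i.
Proof. by apply: eq_bigr => i _; rewrite mxE. Qed.

End Geometry.

Arguments gnabla {R V N} D e G T I x : simpl never.

(** Abelian-group identities between matrices: every product is made opaque and [ring] is run on the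
    entries. *)
Ltac mx_abel := repeat match goal with
  |- context [@mulmx ?F ?m ?n ?p ?A ?B] =>
    let X := fresh "X" in set X := (@mulmx F m n p A B); clearbody X end;
  apply/matrixP => ? ?; rewrite !mxE; ring.

(** * Transformation of covariant tensors *)

Section Pull.
Context {R : realType} {N : nat}.

(** Applies [J] in every slot of a covariant tensor, for all ranks at once by recursion on the index
    list. It serves both for pullbacks, with [J] a Jacobian, and for components in a frame. *)
Fixpoint pull (J : 'M[R]_N) (I : seq 'I_N) (T : seq 'I_N -> R) : R :=
  if I is i :: I' then \sum_a J i a * pull J I' (fun L => T (a :: L)) else T [::].

Lemma eq_pull J I T T' : (forall L, size L = size I -> T L = T' L) ->
  pull J I T = pull J I T'.
Proof.
elim: I T T' => [|i I IH] T T' TT' /=; first exact: TT'.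
by apply: eq_bigr => a _; congr (_ * _); apply: IH => L sL; rewrite TT' //= sL.
Qed.

Lemma pull_sum J I (K : Type) (r : seq K) (c : K -> R) (T : K -> seq 'I_N -> R) :
  pull J I (fun L => \sum_(k <- r) c k * T k L) =
  \sum_(k <- r) c k * pull J I (T k).
Proof.
elim: I T => [|i I IH] T //=.
under eq_bigr do rewrite IH mulr_sumr.
rewrite exchange_big /=; apply: eq_bigr => k _; rewrite mulr_sumr.
by apply: eq_bigr => a _; rewrite mulrCA.
Qed.

Lemma pullB J I T T' : pull J I (fun L => T L - T' L) = pull J I T - pull J I T'.
Proof.
elim: I T T' => [|i I IH] T T' //=.
by under eq_bigr do rewrite IH mulrBr; rewrite sumrB.
Qed.

Lemma pull_comp J K I T : pull J I (fun L => pull K L T) = pull (J *m K) I T.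
Proof.
elim: I T => [|i I IH] T //=.
under eq_bigr do rewrite pull_sum mulr_sumr.
rewrite exchange_big /=; apply: eq_bigr => b _; rewrite mxE mulr_suml.
by apply: eq_bigr => a _; rewrite IH mulrA.
Qed.

Lemma pull1 I T : pull 1%:M I T = T I.
Proof.
elim: I T => [|i I IH] T //=; rewrite (bigD1 i) //= mxE eqxx mul1r IH big1 ?addr0 //.
by move=> a ai; rewrite mxE eq_sym (negPf ai) mul0r.
Qed.

Lemma pullZ J I c T : pull J I (fun L => c * T L) = c * pull J I T.
Proof. by have := pull_sum J I [:: tt] (fun=> c) (fun=> T); rewrite big_seq1 => <-; apply: eq_pull => L _; rewrite big_seq1. Qed.

Lemma slots_sum (C : 'M[R]_N) I (K : Type) (r : seq K) (c : K -> R)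
    (T : K -> seq 'I_N -> R) :
  slots C I (fun L => \sum_(k <- r) c k * T k L) =
  \sum_(k <- r) c k * slots C I (T k).
Proof.
elim: I T => [|i I IH] T /=; first by rewrite big1 // => k _; rewrite mulr0.
rewrite IH; under [RHS]eq_bigr do rewrite mulrDr; rewrite big_split; congr (_ + _).
under eq_bigr do rewrite mulr_sumr; rewrite exchange_big; apply: eq_bigr => k _.
by rewrite mulr_sumr; apply: eq_bigr => m _; rewrite mulrCA.
Qed.

Lemma eq_slots (C : 'M[R]_N) I T T' : T =1 T' -> slots C I T = slots C I T'.
Proof. by move=> /funext ->. Qed.

End Pull.

(** * Naturality of curvature under maps and constant scaling *)

Section Natural.
Context {R : realType} {V W : normedModType R} {N : nat}.
Variables (B : coords V) (C : coords W) (D : set V) (D' : set W).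
Variables (e : 'I_N -> V) (e' : 'I_N -> W).
Variables (G : W -> 'M[R]_N) (H : V -> 'M[R]_N) (J : V -> 'M[R]_N).
Variables (psi : V -> W) (c : R).
Hypotheses (tD : thick B D) (tD' : thick C D').
Hypotheses (c0 : c != 0) (DD' : forall x, D x -> D' (psi x)).
Hypothesis chain : forall f i x, smooth_on D' f -> D x ->
  gpd D e i (fun y => f (psi y)) x = \sum_a J x i a * gpd D' e' a f (psi x).
Hypothesis schw : forall f i j x, smooth_on D f -> D x ->
  gpd D e i (gpd D e j f) x = gpd D e j (gpd D e i f) x.
Hypothesis spsi : forall f, smooth_on D' f -> smooth_on D (fun y => f (psi y)).
Hypotheses (sJ : smoothmx D J) (uJ : forall x, D x -> J x \in unitmx).
Hypothesis symJ : forall i j a x, D x ->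
  gpd D e i (fun y => J y j a) x = gpd D e j (fun y => J y i a) x.
Hypotheses (sG : smoothmx D' G) (symG : forall x, D' x -> (G x)^T = G x).
Hypothesis (uG : forall x, D' x -> G x \in unitmx).
Hypothesis HE : forall x, D x -> H x = c *: (J x *m G (psi x) *m (J x)^T).

Let Gp x := G (psi x).
(** The connection of [G] pulled back along [psi], still expressed in the coordinate frame of the
    target. *)
Let Cp i x := \sum_a J x i a *: gchrmx D' e' G a (psi x).

Lemma dmx_psi m n (M : W -> 'M[R]_(m, n)) i x : smoothmx D' M -> D x ->
  dmx D (e i) (fun y => M (psi y)) x = \sum_a J x i a *: dmx D' (e' a) M (psi x).
Proof.
move=> sM Dx; apply/matrixP => k l; rewrite mxE summxE.
rewrite [LHS](chain i (sM k l) Dx); apply: eq_bigr => a _; by rewrite !mxE.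
Qed.

Lemma smooth_psi m n (M : W -> 'M[R]_(m, n)) :
  smoothmx D' M -> smoothmx D (fun y => M (psi y)).
Proof. by move=> sM k l; exact: (spsi (sM k l)). Qed.

Let sH0 : smoothmx D (fun x => J x *m G (psi x) *m (J x)^T).
Proof.
apply: (smooth_mulmx tD); last exact: smooth_trmx.
by apply: (smooth_mulmx tD) => //; exact: smooth_psi.
Qed.

Lemma natural_smooth : smoothmx D H.
Proof.
move=> i j; apply: (@eq_smooth _ _ D (fun x => (c *: (J x *m G (psi x) *m (J x)^T)) i j)).
  by move=> q Dq; rewrite -HE.
by apply: (smooth_scalemx tD (f := fun=> c)) => //; exact: (smooth_cst tD).
Qed.

Lemma natural_sym x : D x -> (H x)^T = H x.
Proof. by move=> Dx; rewrite HE // linearZ /= !trmx_mul trmxK symG ?mulmxA //; exact: DD'. Qed.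

Lemma natural_unit x : D x -> H x \in unitmx.
Proof.
move=> Dx; rewrite HE // unitmxZ ?unitfE // !unitmx_mul unitmx_tr uJ // uG //.
exact: DD'.
Qed.

(** The gauge law of a connection under the change of frame [J]. The matrices [(dJ + J Cp) J^-1] are
    torsion-free, by symmetry of the second derivatives of the map, and compatible with [H], so
    uniqueness of the Levi-Civita connection applies. The constant [c] drops out. *)
Lemma natural_gauge i x : D x ->
  gchrmx D e H i x *m J x = dmx D (e i) J x + J x *m Cp i x.
Proof.
move=> Dx; have D'x := DD' Dx.
pose K i := (dmx D (e i) J x + J x *m Cp i x) *m invmx (J x).
rewrite -(@gchr_uniq _ _ _ D e H natural_sym natural_unit K) // => [|a b k|a].
- by rewrite /K mulmxKV ?uJ.
- rewrite /K !mxE; apply: eq_bigr => m _; congr (_ * _).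
  have := symJ a b m Dx; rewrite /gpd !mxE => ->; congr (_ + _).
  under eq_bigr do rewrite summxE mulr_sumr.
  rewrite exchange_big /=; apply: eq_bigr => s _.
  rewrite summxE mulr_sumr; apply: eq_bigr => t _; rewrite !mxE.
  by rewrite (gchr_sym e' symG m t s) //; ring.
have -> : dmx D (e a) H x = c *: (dmx D (e a) J x *m Gp x *m (J x)^T +
    J x *m (Cp a x *m Gp x + Gp x *m (Cp a x)^T) *m (J x)^T +
    J x *m Gp x *m (dmx D (e a) J x)^T).
  rewrite (eq_dmx _ (M' := fun x => c *: (J x *m G (psi x) *m (J x)^T))) //.
  rewrite (dmxZ tD) // (dmxM tD) // ?dmx_tr //; last first.
  - exact: smooth_trmx.
  - by apply: (smooth_mulmx tD) => //; exact: smooth_psi.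
  rewrite (dmxM tD) //; last exact: smooth_psi.
  rewrite mulmxDl dmx_psi //; congr (_ *: (_ + _ *m _ *m _ + _)).
  rewrite /Cp linear_sum /= mulmx_suml mulmx_sumr -big_split /=.
  apply: eq_bigr => b _; rewrite (gchr_compat e' symG uG) //.
  by rewrite scalerDr linearZ /= -scalemxAl -scalemxAr.
rewrite HE // /K -!scalemxAr -!scalemxAl -scalerDr; congr (_ *: _).
rewrite !mulmxA mulmxKV ?uJ // !trmx_mul [(_ + _)^T]linearD /= trmx_mul.
rewrite !mulmxDl !mulmxDr !mulmxDl !mulmxA.
have -> : J x *m G (psi x) *m (J x)^T *m (invmx (J x))^T = J x *m G (psi x).
  by rewrite -mulmxA -trmx_mul mulVmx ?uJ // trmx1 mulmx1.
rewrite -!addrA; congr (_ + (_ + _)).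
by rewrite addrC.
Qed.

(** Differentiating the gauge law and antisymmetrising cancels the second derivatives of [J]; what
    remains is [J] times the curvature of [Cp]. *)
Lemma natural_riem i j x : D x -> griemmx D e H i j x *m J x =
  J x *m (\sum_a \sum_b (J x i a * J x j b) *: griemmx D' e' G a b (psi x)).
Proof.
move=> Dx; have D'x := DD' Dx.
have sC i' := smooth_gchrmx e tD natural_smooth natural_unit i'.
have sC' i' := smooth_gchrmx e' tD' sG uG i'.
have sCp i' : smoothmx D (Cp i').
  apply: (smooth_summx tD) => a; apply: (smooth_scalemx tD (f := fun x => J x i' a)) => //.
  exact: smooth_psi.
have dg i' j' : dmx D (e i') (gchrmx D e H j') x *m J x =
   dmx D (e i') (dmx D (e j') J) x + dmx D (e i') J x *m Cp j' x +
   J x *m dmx D (e i') (Cp j') x - gchrmx D e H j' x *m dmx D (e i') J x.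
  have : dmx D (e i') (fun y => gchrmx D e H j' y *m J y) x =
      dmx D (e i') (fun y => dmx D (e j') J y + J y *m Cp j' y) x.
    by apply: eq_dmx => // y; exact: natural_gauge.
  rewrite (dmxM tD) // (dmxD tD) //; last first.
  - exact: (smooth_mulmx tD).
  - exact: smooth_dmx.
  by rewrite (dmxM tD) // => h; rewrite -[X in _ = X - _]addrA -h addrK.
have comm : dmx D (e i) (dmx D (e j) J) x = dmx D (e j) (dmx D (e i) J) x.
  apply/matrixP => k l; have := schw i j (sJ k l) Dx; rewrite /gpd !mxE => h.
  transitivity (deriv_within D (e i) (deriv_within D (e j) (fun y => J y k l)) x).
    by apply: eq_deriv_within => // y _; rewrite mxE.
  by rewrite h; apply: eq_deriv_within => // y _; rewrite mxE.
have dCp i' j' : dmx D (e i') (Cp j') x = \sum_a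
   (dmx D (e i') J x j' a *: gchrmx D' e' G a (psi x) +
    J x j' a *: \sum_b J x i' b *: dmx D' (e' b) (gchrmx D' e' G a) (psi x)).
  rewrite (dmx_sum tD) // => [|a]; last first.
    apply: (smooth_scalemx tD (f := fun x => J x j' a)) => //.
    exact: smooth_psi.
  apply: eq_bigr => a _; rewrite (dmx_scale tD _ (sJ j' a)) //; last exact: smooth_psi.
  by rewrite dmx_psi // mxE.
have gG i' := natural_gauge i' Dx.
rewrite (griemmxE e H) // mulmxDl mulmxBl !dg mulmxBl -!mulmxA !gG.
rewrite !mulmxDr !mulmxA !gG comm.
have -> : \sum_a \sum_b (J x i a * J x j b) *: griemmx D' e' G a b (psi x) =
  (dmx D (e i) (Cp j) x - dmx D (e j) (Cp i) x) + (Cp j x *m Cp i x - Cp i x *m Cp j x).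
  (* The terms in which [J] is differentiated cancel by [symJ], leaving derivatives of the
     connection of [G]. *)
  have E1 : dmx D (e i) (Cp j) x - dmx D (e j) (Cp i) x =
    \sum_a \sum_b (J x i a * J x j b) *:
      (dmx D' (e' a) (gchrmx D' e' G b) (psi x) - dmx D' (e' b) (gchrmx D' e' G a) (psi x)).
    rewrite !dCp !big_split /= opprD addrACA -sumrB big1 ?add0r; last first.
      move=> a _; have := symJ i j a Dx; rewrite /gpd !mxE => ->; exact: subrr.
    have -> : \sum_b J x j b *: \sum_a J x i a *: dmx D' (e' a) (gchrmx D' e' G b) (psi x)
      = \sum_a \sum_b (J x i a * J x j b) *: dmx D' (e' a) (gchrmx D' e' G b) (psi x).
      rewrite exchange_big; apply: eq_bigr => b _; rewrite scaler_sumr.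
      by apply: eq_bigr => a _; rewrite scalerA mulrC.
    rewrite -sumrB; apply: eq_bigr => a _; rewrite scaler_sumr -sumrB.
    by apply: eq_bigr => b _; rewrite scalerA scalerBr.
  have E2 i' j' : Cp i' x *m Cp j' x = \sum_a \sum_b (J x i' a * J x j' b) *:
      (gchrmx D' e' G a (psi x) *m gchrmx D' e' G b (psi x)).
    rewrite mulmx_suml; apply: eq_bigr => a _; rewrite mulmx_sumr.
    by apply: eq_bigr => b _; rewrite -scalemxAl -scalemxAr scalerA.
  rewrite E1 !E2 [X in _ + (X - _)]exchange_big /= -sumrB -big_split /=.
  apply: eq_bigr => a _; rewrite -sumrB -big_split /=; apply: eq_bigr => b _.
  rewrite (griemmxE e' G) // scalerDr.
  by congr (_ + _); rewrite scalerBr [J x j b * _]mulrC.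
rewrite mulmxDr !mulmxBr !mulmxDl !mulmxA.
mx_abel.
Qed.

Lemma sandwich (A Z : 'M[R]_N) l m :
  (A *m Z *m A^T) l m = \sum_p A l p * \sum_q A m q * Z p q.
Proof.
rewrite -mulmxA mxE; apply: eq_bigr => p _; rewrite mxE; congr (_ * _).
by apply: eq_bigr => q _; rewrite mxE mulrC.
Qed.

Lemma natural_Rm I x : D x -> gRm D e H I x =
  c * pull (J x) I (fun L => gRm D' e' G L (psi x)).
Proof.
move=> Dx; have pull0 I' T : (forall L, size L = size I' -> T L = 0) -> pull (J x) I' T = 0.
  move=> T0; rewrite (@eq_pull _ _ (J x) I' T (fun L => 0 * T L)) => [|L /T0 ->].
    by rewrite pullZ mul0r.
  by rewrite mulr0.
case: I => [|i [|k [|l [|m [|a I]]]]].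
(* For index lists of length other than four both sides vanish. *)
1-4,6: rewrite [LHS]/= pull0 ?mulr0 //; move=> [|? [|? [|? [|? [|? ?]]]]] //.
rewrite gRmE HE // -scalemxAr mxE; congr (_ * _).
rewrite !mulmxA natural_riem // -[J x *m _ *m _]mulmxA.
rewrite mulmx_suml mulmx_sumr mulmx_suml summxE; apply: eq_bigr => a _.
rewrite mulmx_suml mulmx_sumr mulmx_suml summxE mulr_sumr; apply: eq_bigr => b _.
rewrite -scalemxAl -scalemxAr -scalemxAl mxE sandwich -mulrA; congr (_ * (_ * _)).
by apply: eq_bigr => p _; congr (_ * _); apply: eq_bigr => q _; rewrite -gRmE.
Qed.

(** Ricci is a trace of the curvature endomorphism, in which no index is lowered: the [J] and [J^-1]
    of the trace cancel, and no factor [c] appears. *)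
Lemma natural_ricci k l x : D x -> gricci D e H k l x =
  (J x *m (\matrix_(b, d) gricci D' e' G b d (psi x)) *m (J x)^T) k l.
Proof.
move=> Dx; rewrite gricciE sandwich.
have E i : griemmx D e H i k x l i = \sum_a \sum_b \sum_d
    (J x k b * (J x l d * (J x i a * (griemmx D' e' G a b (psi x) *m invmx (J x)) d i))).
  rewrite -[griemmx _ _ _ _ _ _](mulmxK (uJ Dx)) natural_riem // -mulmxA.
  rewrite mulmx_suml mulmx_sumr summxE; apply: eq_bigr => a _.
  rewrite mulmx_suml mulmx_sumr summxE; apply: eq_bigr => b _.
  rewrite -scalemxAl -scalemxAr mxE [X in _ * X]mxE mulr_sumr.
  by apply: eq_bigr => d _; ring.
rewrite (eq_bigr _ (fun i _ => E i)).
have -> : \sum_i \sum_a \sum_b \sum_d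
    (J x k b * (J x l d * (J x i a * (griemmx D' e' G a b (psi x) *m invmx (J x)) d i))) =
  \sum_b \sum_d \sum_a \sum_i
    (J x k b * (J x l d * (J x i a * (griemmx D' e' G a b (psi x) *m invmx (J x)) d i))).
  rewrite exchange_big /=; under eq_bigr do rewrite exchange_big /=.
  rewrite exchange_big /=; apply: eq_bigr => b _.
  under eq_bigr do rewrite exchange_big /=.
  by rewrite exchange_big.
apply: eq_bigr => b _; rewrite mulr_sumr; apply: eq_bigr => d _.
rewrite mxE gricciE !mulr_sumr; apply: eq_bigr => a _.
rewrite -!mulr_sumr; congr (_ * (_ * _)).
rewrite -[in RHS](mulmxKV (uJ Dx) (griemmx D' e' G a b (psi x))) mxE.
by apply: eq_bigr => i _; rewrite mulrC.
Qed.

Lemma smooth_pull I (T : gtensor) : (forall L, smooth_on D' (T L)) ->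
  smooth_on D (fun y => pull (J y) I (T^~ (psi y))).
Proof.
elim: I T => [|j I IH] T sT /=; first exact: (spsi (sT _)).
apply: (smooth_sum tD) => a; apply: (smoothM tD) => //.
by apply: (IH (fun L => T (a :: L))).
Qed.

(* The gauge law of the Christoffel symbols makes the slot corrections match. *)
Lemma natural_nabla i I (T : gtensor) x : (forall L, smooth_on D' (T L)) -> D x ->
  gpd D e i (fun y => pull (J y) I (T^~ (psi y))) x
   - slots (gchrmx D e H i x) I (fun L => pull (J x) L (T^~ (psi x))) =
  pull (J x) (i :: I) (fun L => gnabla D' e' G T L (psi x)).
Proof.
move=> sT Dx; elim: I T sT => [|j I IH] T sT.
  rewrite /= subr0 [LHS](chain i (sT [::]) Dx).
  by apply: eq_bigr => a _; rewrite gnablaE /= subr0.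
have sTa a L : smooth_on D' (T (a :: L)) by [].
have {}IH a := IH (fun L => T (a :: L)) (sTa a).
have -> : gpd D e i (fun y => pull (J y) (j :: I) (T^~ (psi y))) x =
    \sum_a deriv_within D (e i) (fun y => J y j a *
      pull (J y) I (fun L => T (a :: L) (psi y))) x.
  apply: (deriv_within_sum tD) => // a; apply/smooth_diff/(smoothM tD) => //.
  exact: (smooth_pull I (T := fun L => T (a :: L))).
set P := fun a => pull (J x) I (fun L => T (a :: L) (psi x)).
have -> : slots (gchrmx D e H i x) (j :: I) (fun L => pull (J x) L (T^~ (psi x))) =
  \sum_b ((gchrmx D e H i x *m J x) j b * P b + J x j b *
     slots (gchrmx D e H i x) I (fun L => pull (J x) L (fun L' => T (b :: L') (psi x)))).
  rewrite big_split [slots _ _ _]/=; congr (_ + _); last by rewrite -slots_sum.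
  under eq_bigr do rewrite mulr_sumr; rewrite exchange_big; apply: eq_bigr => b _.
  by rewrite mxE mulr_suml; apply: eq_bigr => m _; rewrite mulrA.
(* The [dJ] part of the gauge law cancels the derivative of the factor [J y j b]; the part [J Cp]
   becomes the slot correction on the target. *)
rewrite -sumrB natural_gauge //.
have -> : pull (J x) (i :: j :: I) (fun L => gnabla D' e' G T L (psi x)) =
  \sum_b (J x j b * pull (J x) (i :: I) (fun L => gnabla D' e' G (fun L => T (b :: L)) L (psi x))
          - (J x *m Cp i x) j b * P b).
  rewrite sumrB.
  have -> : \sum_b (J x *m Cp i x) j b * P b = \sum_s J x i s * \sum_a J x j a *
     \sum_m gchrmx D' e' G s (psi x) a m * P m.
    transitivity (\sum_s \sum_a \sum_m J x i s * (J x j a * (gchrmx D' e' G s (psi x) a m * P m))).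
      under [RHS]eq_bigr do rewrite exchange_big /=.
      rewrite [RHS]exchange_big /=; apply: eq_bigr => m _; rewrite mxE mulr_suml.
      rewrite [RHS]exchange_big /=; apply: eq_bigr => a _; rewrite summxE mulr_sumr mulr_suml.
      by apply: eq_bigr => s _; rewrite mxE; ring.
    by apply: eq_bigr => s _; rewrite mulr_sumr; apply: eq_bigr => a _; rewrite !mulr_sumr.
  rewrite /=; have -> : \sum_b J x j b * (\sum_s J x i s * pull (J x) I
      (fun L => gnabla D' e' G (fun L' => T (b :: L')) (s :: L) (psi x))) =
      \sum_s J x i s * \sum_b J x j b * pull (J x) I
      (fun L => gnabla D' e' G (fun L' => T (b :: L')) (s :: L) (psi x)).
    under eq_bigr do rewrite mulr_sumr; rewrite exchange_big /=.
    by apply: eq_bigr => s _; rewrite mulr_sumr; apply: eq_bigr => b _; rewrite mulrCA.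
  rewrite -sumrB; apply: eq_bigr => s _; rewrite -mulrBr -sumrB; congr (_ * _).
  apply: eq_bigr => a _; rewrite -mulrBr; congr (_ * _).
  rewrite -pull_sum -pullB; apply: eq_pull => L _.
  by rewrite !gnablaE [slots _ (a :: L) _]/=; ring.
apply: eq_bigr => b _; rewrite -(IH b) !mxE (deriv_withinM tD) //.
- rewrite /P /gpd; ring.
- exact: smooth_diff.
- by apply: smooth_diff; exact: (smooth_pull I (T := fun L => T (b :: L))).
Qed.

Lemma natural_nablaRm k I x : D x -> iter k (gnabla D e H) (gRm D e H) I x =
  c * pull (J x) I (fun L => iter k (gnabla D' e' G) (gRm D' e' G) L (psi x)).
Proof.
elim: k I x => [|k IH] I x Dx; first exact: natural_Rm.
rewrite !iterS; case: I => [|i I]; first by rewrite /= mulr0.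
have sT L := smooth_nablaRm e' tD' sG uG k L.
rewrite -natural_nabla // gnablaE mulrBr; congr (_ - _).
  rewrite /gpd -(deriv_withinZ tD) //; last exact: smooth_diff (smooth_pull I sT).
  by apply: eq_deriv_within => // y Dy; exact: IH.
have /= := slots_sum (gchrmx D e H i x) I [:: tt] (fun=> c)
   (fun=> fun L => pull (J x) L (fun L => iter k (gnabla D' e' G) (gRm D' e' G) L (psi x))).
by rewrite big_seq1 => <-; apply: eq_slots => L; rewrite big_seq1 -IH.
Qed.

End Natural.

(** * Curvature of time slices as a function on space-time *)

Section SliceGeometry.
Context {R : realType} {N : nat}.
Variables (D : set ('rV[R]_N * R)) (G : 'rV[R]_N * R -> 'M[R]_N) (t : R).

Definition est (i : 'I_N) : 'rV[R]_N * R := (delta_mx 0 i, 0).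

Hypotheses (uD : upper_st D) (sG : smoothmx D G).
Hypothesis (uG : forall x, D x -> G x \in unitmx).
Let Dt := [set q | D (q, t)].
Let Gt q := G (q, t).
Let tD := upper_st_thick uD.

Lemma pd_slice i f q : smooth_on D f -> D (q, t) ->
  pd Dt i (fun q => f (q, t)) q = gpd D est i f (q, t).
Proof. by move=> sf Dq; exact: (deriv_within_slice uD _ (smooth_diff sf) Dq). Qed.

Lemma eq_pd (D' : set 'rV[R]_N) i f g q : (forall q', D' q' -> f q' = g q') -> D' q ->
  pd D' i f q = pd D' i g q.
Proof. exact: eq_deriv_within. Qed.

Lemma christoffel_slice k i j q : D (q, t) ->
  christoffel Dt Gt k i j q = gchr D est G k i j (q, t).
Proof.
move=> Dq; congr (_ * _); apply: eq_bigr => l _; congr (_ * _).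
by rewrite /Gt (pd_slice i (sG j l)) // (pd_slice j (sG i l)) // (pd_slice l (sG i j)).
Qed.

Lemma riem_slice l i j k q : D (q, t) ->
  riem Dt Gt l i j k q = griem D est G l i j k (q, t).
Proof.
move=> Dq; have sC a b c := smooth_gchr est tD sG uG a b c.
rewrite /riem /griem; congr (_ - _ + _).
- rewrite -(pd_slice i (sC l j k) Dq); apply: eq_pd => // q' Dq'.
  exact: christoffel_slice.
- rewrite -(pd_slice j (sC l i k) Dq); apply: eq_pd => // q' Dq'.
  exact: christoffel_slice.
- by apply: eq_bigr => m _; rewrite !christoffel_slice.
Qed.

Lemma ricci_slice j k q : D (q, t) ->
  ricci Dt Gt j k q = gricci D est G j k (q, t).
Proof. by move=> Dq; apply: eq_bigr => i _; rewrite riem_slice. Qed.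

Lemma nablaRm_slice k I q : D (q, t) ->
  iter k (nabla Dt Gt) (Rm Dt Gt) I q = iter k (gnabla D est G) (gRm D est G) I (q, t).
Proof.
elim: k I q => [|k IH] I q Dq /=.
  case: I => [|a [|b [|c [|d [|? ?]]]]] //=.
  by apply: eq_bigr => m _; rewrite riem_slice.
have sT L := smooth_nablaRm est tD sG uG k L.
case: I => [|i I] //=; rewrite /gnabla; congr (_ - _).
  by rewrite -(pd_slice i (sT I) Dq); apply: eq_pd => // q' Dq'; rewrite -IH.
apply: eq_bigr => p _; apply: eq_bigr => m _.
by rewrite christoffel_slice // IH.
Qed.

End SliceGeometry.

(** * Orthonormal frames and tensor norms *)

Section Frames.
Context {R : realType} {N : nat}.

Definition spd n (G : 'M[R]_n) :=
  G^T = G /\ forall v : 'rV[R]_n, v != 0 -> 0 < (v *m G *m v^T) 0 0.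

Lemma row_sqr_gt0 n (v : 'rV[R]_n) : v != 0 -> 0 < (v *m v^T) 0 0.
Proof.
move=> v0; have [k vk] : exists k, v 0 k != 0.
  apply/existsP; apply: contraNT v0 => /existsPn h; apply/eqP/rowP => k.
  by rewrite mxE; apply/eqP; have := h k; rewrite negbK.
rewrite mxE (bigD1 k) //= mxE -expr2 ltr_wpDr ?exprn_even_gt0 ?vk ?orbT //.
by apply: sumr_ge0 => j _; rewrite mxE -expr2 sqr_ge0.
Qed.

Lemma spd_unit n (G : 'M[R]_n) : spd G -> G \in unitmx.
Proof.
move=> [_ pG]; rewrite -row_free_unit -kermx_eq0; apply/eqP/row_matrixP => i.
rewrite row0; apply/eqP; apply: contraT => /pG.
have /sub_kermxP -> : (row i (kermx G) <= kermx G)%MS by exact: row_sub.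
by rewrite mul0mx mxE ltxx.
Qed.

(** Induction on the size through the Schur complement [C - a^-1 b^T b], which is again positive
    definite. *)
Lemma cholesky n (G : 'M[R]_n) : spd G -> exists2 L : 'M[R]_n, L \in unitmx & G = L *m L^T.
Proof.
move=> sG; suff [L GL] : exists L : 'M[R]_n, G = L *m L^T.
  exists L => //; have := spd_unit sG; rewrite GL unitmx_mul => /andP[]//.
elim: n G sG => [|n IH] G [symG pG].
  by exists 0; apply/matrixP => -[].
rewrite -[n.+1]/(1 + n)%N in G symG pG *.
pose a := G 0 0; pose b := ursubmx G; pose C := drsubmx G.
have aE : ulsubmx G = a%:M.
  by apply/matrixP => i j; rewrite !ord1 !mxE eqxx mulr1n; congr (G _ _); apply/val_inj.
have bE : dlsubmx G = b^T by rewrite /b -[in LHS]symG -trmx_ursub.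
have GE : G = block_mx a%:M b b^T C by rewrite -[LHS]submxK aE bE.
have symC : C^T = C by rewrite /C trmx_drsub symG.
have a0 : 0 < a.
  have := pG (delta_mx 0 0); have -> : (delta_mx 0 0 : 'rV[R]_(1 + n)) != 0.
    by apply/eqP => /rowP/(_ 0); rewrite !mxE !eqxx => /eqP; rewrite oner_eq0.
  by move=> /(_ isT); rewrite -rowE trmx_delta -colE !mxE.
have quad (w : 'rV[R]_n) (s : R) :
    (row_mx s%:M w *m G *m (row_mx s%:M w)^T) 0 0 =
    s ^+ 2 * a + 2 * s * (b *m w^T) 0 0 + (w *m C *m w^T) 0 0.
  rewrite GE mul_row_block tr_row_mx mul_row_col tr_scalar_mx.
  rewrite !mulmxDl -!scalar_mxM !mul_scalar_mx -!scalemxAl mul_mx_scalar.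
  rewrite -mulmxA -[w *m b^T]trmxK trmx_mul trmxK.
  rewrite !mxE !eqxx !mulr1n.
  by ring.
have [|L' CL] := IH (C - a^-1 *: (b^T *m b)).
  split; first by rewrite linearB /= linearZ /= trmx_mul trmxK symC.
  move=> w w0; pose be := (b *m w^T) 0 0.
  (* For fixed [w] this first coordinate minimises the quadratic form of [G]; the minimum is the
     form of the Schur complement at [w]. *)
  have := pG (row_mx (- be / a)%:M w).
  have -> : row_mx (- be / a)%:M w != 0.
    apply: contraNN w0 => /eqP h; apply/eqP.
    by rewrite -(row_mxKr (- be / a)%:M w) h linear0.
  move=> /(_ isT); rewrite quad -/be.
  have -> : (w *m (C - a^-1 *: (b^T *m b)) *m w^T) 0 0 =
      (w *m C *m w^T) 0 0 - a^-1 * (be * be).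
    rewrite mulmxBr mulmxBl -scalemxAr -scalemxAl mxE; congr (_ + _).
    rewrite mxE; congr (- _); rewrite mxE; congr (_ * _).
    have -> : w *m (b^T *m b) *m w^T = (w *m b^T) *m (b *m w^T) by rewrite !mulmxA.
    rewrite [LHS]mxE big_ord1; congr (_ * _).
    by rewrite -[w *m _]trmxK trmx_mul trmxK mxE.
  move=> h.
  suff -> : (w *m C *m w^T) 0 0 - a^-1 * (be * be) =
    (- be / a) ^+ 2 * a + 2 * (- be / a) * be + (w *m C *m w^T) 0 0 by [].
  by field; rewrite gt_eqF.
exists (block_mx (Num.sqrt a)%:M 0 ((Num.sqrt a)^-1 *: b^T) L').
have sa : Num.sqrt a != 0 by rewrite gt_eqF // sqrtr_gt0.
rewrite tr_block_mx mulmx_block trmx0 !mulmx0 !mul0mx !addr0 tr_scalar_mx.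
rewrite -scalar_mxM -expr2 sqr_sqrtr ?(ltW a0) // linearZ /= trmxK.
rewrite mul_scalar_mx scalerA mulfV // scale1r mul_mx_scalar scalerA mulfV // scale1r.
rewrite -scalemxAl -scalemxAr scalerA -invfM -expr2 sqr_sqrtr ?(ltW a0) //.
by rewrite -CL addrC subrK.
Qed.

Lemma sum_tuple_cons (r : nat) (F : r.+1.-tuple 'I_N -> R) :
  \sum_(I : r.+1.-tuple 'I_N) F I =
  \sum_i \sum_(I : r.-tuple 'I_N) F [tuple of i :: I].
Proof.
rewrite pair_big /=.
rewrite (reindex (fun p : 'I_N * r.-tuple 'I_N => [tuple of p.1 :: p.2])) //=.
exists (fun I : r.+1.-tuple 'I_N => (thead I, [tuple of behead I])).
  by move=> [i I] _ /=; congr (_, _); apply/val_inj.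
by move=> I _; rewrite -tuple_eta.
Qed.

(** When [A = P P^T] is the inverse metric, the rows of [P^T] are an orthonormal frame, and the
    contraction with [A] in every slot becomes a plain sum over frame components. *)
Lemma frame_norm (A P : 'M[R]_N) r (T T' : seq 'I_N -> R) : A = P *m P^T ->
  \sum_(I : r.-tuple 'I_N) \sum_(J : r.-tuple 'I_N)
    (\prod_(p < r) A (tnth I p) (tnth J p)) * (T I * T' J) =
  \sum_(K : r.-tuple 'I_N) pull P^T K T * pull P^T K T'.
Proof.
move=> AP; elim: r T T' => [|r IH] T T'.
  have u (F : 0.-tuple 'I_N -> R) : \sum_(I : 0.-tuple 'I_N) F I = F [tuple].
    by rewrite (bigD1 [tuple]) //= big1 ?addr0 // => I /negP[]; apply/eqP; exact: tuple0.
  by rewrite !u big_ord0 mul1r.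
have tn i (I : r.-tuple 'I_N) p : tnth [tuple of i :: I] (lift ord0 p) = tnth I p.
  by rewrite !(tnth_nth i).
rewrite [LHS]sum_tuple_cons [RHS]sum_tuple_cons.
transitivity (\sum_i \sum_j A i j * \sum_(K : r.-tuple 'I_N)
    pull P^T K (fun L => T (i :: L)) * pull P^T K (fun L => T' (j :: L))).
  apply: eq_bigr => i _; under eq_bigr do rewrite sum_tuple_cons.
  rewrite exchange_big /=; apply: eq_bigr => j _; rewrite -IH mulr_sumr.
  apply: eq_bigr => I _; rewrite mulr_sumr; apply: eq_bigr => J _.
  rewrite big_ord_recl -mulrA; congr (_ * (_ * _)).
  by apply: eq_bigr => p _; rewrite !tn.
rewrite [RHS]exchange_big /=.
under eq_bigr do under eq_bigr do rewrite mulr_sumr.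
under eq_bigr do rewrite exchange_big /=.
rewrite exchange_big /=; apply: eq_bigr => K _.
under [RHS]eq_bigr do rewrite mulr_suml.
rewrite [RHS]exchange_big /=; apply: eq_bigr => i _.
under [RHS]eq_bigr do rewrite mulr_sumr.
rewrite [RHS]exchange_big /=; apply: eq_bigr => j _.
rewrite AP mxE mulr_suml; apply: eq_bigr => k _; rewrite !mxE; ring.
Qed.

(** The square of one frame component is one term of the sum of squares given by [frame_norm]. *)
Lemma frame_le (G : 'rV[R]_N -> 'M[R]_N) (P : 'M[R]_N) r (T : tensor) x
    (K : seq 'I_N) : invmx (G x) = P *m P^T -> size K = r ->
  `|pull P^T K (T^~ x)| <= tensor_norm G r T x.
Proof.
move=> GP sK; rewrite /tensor_norm (frame_norm r (T^~ x) (T^~ x) GP).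
pose K' : r.-tuple 'I_N := tcast sK (in_tuple K).
have -> : pull P^T K (T^~ x) = pull P^T K' (T^~ x) by rewrite /K' val_tcast.
rewrite -sqrtr_sqr ler_wsqrtr // (bigD1 K') //= expr2 lerDl.
by apply: sumr_ge0 => L _; rewrite -expr2 sqr_ge0.
Qed.

Lemma pull_scale (s : R) (M : 'M[R]_N) K T :
  pull (s *: M) K T = s ^+ size K * pull M K T.
Proof.
elim: K T => [|k K IH] T /=; first by rewrite expr0 mul1r.
rewrite mulr_sumr; apply: eq_bigr => a _; rewrite mxE IH exprS; ring.
Qed.

Lemma pull_le (M : 'M[R]_N) (m b : R) I T : 0 <= m ->
  (forall i j, `|M i j| <= m) -> (forall L, size L = size I -> `|T L| <= b) ->
  `|pull M I T| <= (N%:R * m) ^+ size I * b.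
Proof.
move=> m0 Mm; elim: I T => [|i I IH] T Tb /=; first by rewrite expr0 mul1r Tb.
apply: le_trans (ler_norm_sum _ _ _) _.
rewrite exprS -!mulrA; set X := m * _.
have -> : N%:R * X = \sum_(a < N) X by rewrite sumr_const card_ord mulr_natl.
apply: ler_sum => a _; rewrite normrM ler_pM //.
by apply: IH => L sL; apply: Tb; rewrite /= sL.
Qed.

Lemma gram_entry_le (A P : 'M[R]_N) i j : A = P *m P^T -> P i j ^+ 2 <= A i i.
Proof.
move=> ->; rewrite mxE (bigD1 j) //= mxE -expr2 lerDl.
by apply: sumr_ge0 => k _; rewrite mxE -expr2 sqr_ge0.
Qed.

End Frames.

(** * Derivative estimates along the Ricci flow *)

Section Classes.
Context {R : realType} {N : nat}.
Notation V := ('rV[R]_N * R)%type.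
Variables (D E : set V).
Hypotheses (uD : upper_st D) (ED : E `<=` D).
Let tD := upper_st_thick uD.
Implicit Types (f g : nat -> V -> R) (Phi : nat -> V -> R).

(** [f] is a sequence of functions. Bounds are asked on [E], for large indices and with a constant
    independent of the index, whereas smoothness and derivatives refer to the larger [D]. *)
Definition bd f := exists C : R, \forall i \near \oo, forall x, E x -> `|f i x| <= C.

Definition bdw Phi f := exists C : R,
  \forall i \near \oo, forall x, E x -> `|f i x| <= C * Phi i x.

Definition smf f := \forall i \near \oo, smooth_on D (f i).

Definition eqf f g := \forall i \near \oo, forall x, D x -> f i x = g i x.

Definition dxf (v : V) f : nat -> V -> R := fun i => deriv_within D v (f i).

(* Derivatives of order < m are bounded and those of order m are O(Phi),
   uniformly on E and for large i. *)
Fixpoint Bc m Phi f : Prop :=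
  smf f /\ if m is m'.+1 then bd f /\ forall k, Bc m' Phi (dxf (est k) f)
           else bdw Phi f.

Lemma eqf_bd f g : eqf f g -> bd f -> bd g.
Proof.
move=> fg [C fC]; exists C; move: fg fC; apply: filter_app2; near=> i => fg fC x Ex.
by rewrite -fg ?fC //; exact: ED.
Unshelve. all: by end_near. Qed.

Lemma eqf_bdw Phi f g : eqf f g -> bdw Phi f -> bdw Phi g.
Proof.
move=> fg [C fC]; exists C; move: fg fC; apply: filter_app2; near=> i => fg fC x Ex.
by rewrite -fg ?fC //; exact: ED.
Unshelve. all: by end_near. Qed.

Lemma eqf_smf f g : eqf f g -> smf f -> smf g.
Proof.
apply: filter_app2; near=> i => fg; exact: eq_smooth.
Unshelve. all: by end_near. Qed.

Lemma eqf_dxf v f g : eqf f g -> eqf (dxf v f) (dxf v g).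
Proof. by apply: filterS => i fg x Dx; exact: eq_deriv_within. Qed.

Lemma eqf_Bc m Phi f g : eqf f g -> Bc m Phi f -> Bc m Phi g.
Proof.
elim: m f g => [|m IH] f g fg /= [sf]; first by split; [exact: eqf_smf fg sf|exact: eqf_bdw fg _].
move=> [bf Bf]; split; first exact: eqf_smf fg sf.
split=> [|k]; first exact: eqf_bd bf.
by apply: IH (Bf k); exact: eqf_dxf.
Qed.

Lemma smf_dxf v f : smf f -> smf (dxf v f).
Proof. by apply: filterS => i; exact: smooth_deriv. Qed.

Lemma smf_cst c : smf (fun _ _ => c).
Proof. by apply: nearW => i; exact: (smooth_cst tD). Qed.

Lemma smf_add f g : smf f -> smf g -> smf (fun i x => f i x + g i x).
Proof.
apply: filter_app2; near=> i => sf sg; exact: (smoothD tD).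
Unshelve. all: by end_near. Qed.

Lemma smf_mul f g : smf f -> smf g -> smf (fun i x => f i x * g i x).
Proof.
apply: filter_app2; near=> i => sf sg; exact: (smoothM tD).
Unshelve. all: by end_near. Qed.

Lemma dxf_cst v c : eqf (fun _ _ => 0) (dxf v (fun _ _ => c)).
Proof. by apply: nearW => i x Dx; rewrite /dxf (deriv_within_cst tD). Qed.

Lemma dxf_add v f g : smf f -> smf g ->
  eqf (fun i x => dxf v f i x + dxf v g i x) (dxf v (fun i x => f i x + g i x)).
Proof.
apply: filter_app2; near=> i => sf sg x Dx.
by rewrite /dxf (deriv_withinD tD) //; exact: smooth_diff.
Unshelve. all: by end_near. Qed.

Lemma dxf_mul v f g : smf f -> smf g ->
  eqf (fun i x => dxf v f i x * g i x + dxf v g i x * f i x)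
      (dxf v (fun i x => f i x * g i x)).
Proof.
apply: filter_app2; near=> i => sf sg x Dx; rewrite /dxf (deriv_withinM tD) //.
- by rewrite [f i x * _]mulrC.
- exact: smooth_diff.
- exact: smooth_diff.
Unshelve. all: by end_near. Qed.

Lemma bd_cst c : bd (fun _ _ => c).
Proof. by exists `|c|; apply: nearW. Qed.

Lemma bd_add f g : bd f -> bd g -> bd (fun i x => f i x + g i x).
Proof.
move=> [C fC] [C' gC]; exists (C + C'); move: fC gC; apply: filter_app2.
near=> i => fC gC x Ex; apply: le_trans (ler_normD _ _) _.
by apply: lerD; [exact: fC|exact: gC].
Unshelve. all: by end_near. Qed.

Lemma bd_mul f g : bd f -> bd g -> bd (fun i x => f i x * g i x).
Proof.
move=> [C fC] [C' gC]; exists (C * C'); move: fC gC; apply: filter_app2.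
near=> i => fC gC x Ex; rewrite normrM.
by apply: ler_pM => //; [exact: fC|exact: gC].
Unshelve. all: by end_near. Qed.

Lemma bdw_add Phi f g : bdw Phi f -> bdw Phi g -> bdw Phi (fun i x => f i x + g i x).
Proof.
move=> [C fC] [C' gC]; exists (C + C'); move: fC gC; apply: filter_app2.
near=> i => fC gC x Ex; apply: le_trans (ler_normD _ _) _.
by rewrite mulrDl; apply: lerD; [exact: fC|exact: gC].
Unshelve. all: by end_near. Qed.

Lemma bdw_mul Phi f g : bdw Phi f -> bd g -> bdw Phi (fun i x => f i x * g i x).
Proof.
move=> [C fC] [C' gC]; exists (C * C'); move: fC gC; apply: filter_app2.
near=> i => fC gC x Ex; rewrite normrM mulrAC.
by apply: ler_pM => //; [exact: fC|exact: gC].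
Unshelve. all: by end_near. Qed.

Lemma BcD m Phi f g : Bc m Phi f -> Bc m Phi g -> Bc m Phi (fun i x => f i x + g i x).
Proof.
elim: m f g => [|m IH] f g /= [sf bf] [sg bg].
  by split; [exact: smf_add|exact: bdw_add].
move: bf bg => [bf Bf] [bg Bg]; split; first exact: smf_add.
split=> [|k]; first exact: bd_add.
apply: eqf_Bc (dxf_add _ sf sg) _; exact: IH.
Qed.

Section Weight.
Variable Phi : nat -> V -> R.
Hypothesis Phi1 : forall i x, 1 <= Phi i x.

Lemma bd_bdw f : bd f -> bdw Phi f.
Proof.
move=> [C fC]; exists `|C|; apply: filterS fC => i fC x Ex.
apply: le_trans (fC x Ex) _; apply: le_trans (ler_norm _) _.
by rewrite -[leLHS]mulr1 ler_wpM2l.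
Qed.

Lemma BcS m f : Bc m.+1 Phi f -> Bc m Phi f.
Proof.
elim: m f => [|m IH] f [sf [bf Bf]] /=; split=> //; first exact: bd_bdw.
by split=> // k; exact/IH/Bf.
Qed.

Lemma Bc_le m n f : (m <= n)%N -> Bc n Phi f -> Bc m Phi f.
Proof.
elim: n => [|n IH]; first by case: m.
by rewrite leq_eqVlt => /orP[/eqP -> //|mn /BcS]; exact: IH.
Qed.

Lemma Bc_cst m c : Bc m Phi (fun _ _ => c).
Proof.
elim: m c => [|m IH] c /=; split; try exact: smf_cst.
  by apply: bd_bdw; exact: bd_cst.
by split=> [|k]; [exact: bd_cst|exact: eqf_Bc (dxf_cst _ _) (IH _)].
Qed.

(** In a derivative of order [m] of a product only one factor can carry all [m] derivatives, so the
    weight enters linearly. At order zero the class gives only [O(Phi)] for both factors, whence the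
    separate bound on [g]. *)
Lemma BcM m f g : Bc m Phi f -> Bc m Phi g -> bd g ->
  Bc m Phi (fun i x => f i x * g i x).
Proof.
elim: m f g => [|m IH] f g.
  move=> /= [sf bf] [sg _] bg; split; first exact: smf_mul.
  exact: bdw_mul.
move=> Bf Bg _; have [sf [bf Bf']] := Bf; have [sg [bg Bg']] := Bg.
split; first exact: smf_mul.
split=> [|k]; first exact: bd_mul.
apply: eqf_Bc (dxf_mul _ sf sg) _; apply: BcD.
  by apply: IH (BcS Bg) bg; exact: Bf'.
by apply: IH (BcS Bf) bf; exact: Bg'.
Qed.

Lemma Bc_sum m (I : Type) (r : seq I) (F : I -> nat -> V -> R) :
  (forall k, Bc m Phi (F k)) -> Bc m Phi (fun i x => \sum_(k <- r) F k i x).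
Proof.
move=> BF; elim: r => [|k r IH].
  apply: (eqf_Bc (f := fun _ _ => 0)); last exact: Bc_cst.
  by apply: nearW => i x _; rewrite big_nil.
apply: (eqf_Bc (f := fun i x => F k i x + \sum_(k <- r) F k i x)); last exact: BcD.
by apply: nearW => i x _; rewrite big_cons.
Qed.

Lemma BcZ m c f : Bc m Phi f -> Bc m Phi (fun i x => c * f i x).
Proof.
move=> Bf; apply: (eqf_Bc (f := fun i x => f i x * c)).
  by apply: nearW => i x _; rewrite mulrC.
by apply: BcM => //; [exact: Bc_cst|exact: bd_cst].
Qed.

Lemma BcN m f : Bc m Phi f -> Bc m Phi (fun i x => - f i x).
Proof.
move=> Bf; apply: (eqf_Bc (f := fun i x => -1 * f i x)); last exact: BcZ.
by apply: nearW => i x _; rewrite mulN1r.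
Qed.

Lemma BcB m f g : Bc m Phi f -> Bc m Phi g -> Bc m Phi (fun i x => f i x - g i x).
Proof. by move=> Bf Bg; apply: BcD => //; exact: BcN. Qed.

Definition dsf (s : seq 'I_N) f : nat -> V -> R :=
  fun i => derivs_within D (map est s) (f i).

Lemma dsf_rcons s k f : dsf (rcons s k) f = dsf s (dxf (est k) f).
Proof. by apply/funext => i; rewrite /dsf map_rcons derivs_within_rcons. Qed.

Lemma Bc_intro m f : smf f -> (forall s, (size s < m)%N -> bd (dsf s f)) ->
  (forall s, size s = m -> bdw Phi (dsf s f)) -> Bc m Phi f.
Proof.
elim: m f => [|m IH] f sf h1 h2 /=; split=> //; first exact: (h2 [::]).
split=> [|k]; first exact: (h1 [::]).
apply: IH => [|s sm|s sm]; first exact: smf_dxf.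
  by rewrite -dsf_rcons; apply: h1; rewrite size_rcons.
by rewrite -dsf_rcons; apply: h2; rewrite size_rcons sm.
Qed.

Lemma Bc_top m f s : Bc m Phi f -> size s = m -> bdw Phi (dsf s f).
Proof.
elim: m f s => [|m IH] f s; first by case: s => // -[].
case/lastP: s => // s k [_ [_ Bf]]; rewrite size_rcons => -[sm].
by rewrite dsf_rcons; exact: IH (Bf k) sm.
Qed.

End Weight.

Definition onef : nat -> V -> R := fun _ _ => 1.

Lemma onef_ge1 i x : 1 <= onef i x. Proof. by []. Qed.

(** Control of [k] time derivatives together with all spatial ones, with weight one. The recursion
    on [k] matches the use of the flow equation, which trades one time derivative for spatial
    ones. *)
Fixpoint tb k f : Prop :=
  (forall n, Bc n onef f) /\ if k is k'.+1 then tb k' (dxf (0, 1) f) else True.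

Lemma tb_Bc k n f : tb k f -> Bc n onef f.
Proof. by case: k => [|k] []. Qed.

Lemma tb_bd k f : tb k f -> bd f.
Proof. by move=> /(tb_Bc 1) []/= _ []. Qed.

Lemma tb_smf k f : tb k f -> smf f.
Proof. by move=> /(tb_Bc 0) []. Qed.

Lemma eqf_tb k f g : eqf f g -> tb k f -> tb k g.
Proof.
elim: k f g => [|k IH] f g fg /= [Bf tf]; split=> //; try by move=> n; exact: eqf_Bc (Bf n).
by apply: IH tf; exact: eqf_dxf.
Qed.

Lemma tbS k f : tb k.+1 f -> tb k f.
Proof.
by elim: k f => [|k IH] f [Bf tf] //=; split=> //; apply: IH.
Qed.

Lemma tb_cst k c : tb k (fun _ _ => c).
Proof.
elim: k c => [|k IH] c /=; split=> //; try by move=> n; exact: (Bc_cst onef_ge1).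
exact: eqf_tb (dxf_cst _ _) (IH _).
Qed.

Lemma tbD k f g : tb k f -> tb k g -> tb k (fun i x => f i x + g i x).
Proof.
elim: k f g => [|k IH] f g; first by move=> [Bf _] [Bg _]; split=> // n; exact: BcD.
move=> tf tg; have [Bf tf'] := tf; have [Bg tg'] := tg; split=> [n|]; first exact: BcD.
apply: eqf_tb (dxf_add _ (tb_smf tf) (tb_smf tg)) _; exact: IH.
Qed.

Lemma tbM k f g : tb k f -> tb k g -> tb k (fun i x => f i x * g i x).
Proof.
elim: k f g => [|k IH] f g.
  by move=> tf tg; split=> // n; apply: (BcM onef_ge1); [exact: tb_Bc tf|exact: tb_Bc tg|exact: tb_bd tg].
move=> tf tg; have [Bf tf'] := tf; have [Bg tg'] := tg; split=> [n|].
  by apply: (BcM onef_ge1) => //; exact: tb_bd tg.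
apply: eqf_tb (dxf_mul _ (tb_smf tf) (tb_smf tg)) _.
by apply: tbD; apply: IH => //; exact: tbS.
Qed.

Lemma tb_sum k (I : Type) (r : seq I) (F : I -> nat -> V -> R) :
  (forall j, tb k (F j)) -> tb k (fun i x => \sum_(j <- r) F j i x).
Proof.
move=> BF; elim: r => [|j r IH].
  apply: (eqf_tb (f := fun _ _ => 0)); last exact: tb_cst.
  by apply: nearW => i x _; rewrite big_nil.
apply: (eqf_tb (f := fun i x => F j i x + \sum_(j <- r) F j i x)); last exact: tbD.
by apply: nearW => i x _; rewrite big_cons.
Qed.

Lemma tbZ k c f : tb k f -> tb k (fun i x => c * f i x).
Proof. by move=> tf; apply: tbM => //; exact: tb_cst. Qed.

Lemma tbB k f g : tb k f -> tb k g -> tb k (fun i x => f i x - g i x).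
Proof.
move=> tf tg; apply: (eqf_tb (f := fun i x => f i x + -1 * g i x)).
  by apply: nearW => i x _; rewrite mulN1r.
by apply: tbD => //; exact: tbZ.
Qed.

Lemma time_space_comm f k : smf f ->
  eqf (dxf (est k) (dxf (0, 1) f)) (dxf (0, 1) (dxf (est k) f)).
Proof.
apply: filterS => i sf x Dx.
exact: (@corner_schwarz _ _ (coords_st N) D (f i) x None (Some k) (upper_st_corner uD)).
Qed.

Lemma tb_dx k j f : tb k f -> tb k (dxf (est j) f).
Proof.
elim: k f => [|k IH] f tf; have [Bf tf'] := tf; split=> //.
- by move=> n; have [_ [_ ]] := Bf n.+1; exact.
- by move=> n; have [_ [_ ]] := Bf n.+1; exact.
- by apply: eqf_tb (time_space_comm j (tb_smf tf)) _; exact: IH.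
Qed.

Lemma time_dsf_comm f s : smf f -> eqf (dsf s (dxf (0, 1) f)) (dxf (0, 1) (dsf s f)).
Proof.
elim/last_ind: s f => [|s k IH] f sf; first by apply: nearW.
rewrite !dsf_rcons; have := IH _ (smf_dxf (est k) sf).
have : eqf (dsf s (dxf (est k) (dxf (0, 1) f))) (dsf s (dxf (0, 1) (dxf (est k) f))).
  by have := time_space_comm k sf; apply: filterS => i h x Dx; exact: eq_derivs_within.
by apply: filter_app2; near=> i => h1 h2 x Dx; rewrite h1 // h2.
Unshelve. all: by end_near. Qed.

End Classes.

(** * Ricci curvature in an orthonormal frame *)

Section RicciFrame.
Context {R : realType} {V : normedModType R} {N : nat}.
Variables (D : set V) (e : 'I_N -> V) (G : V -> 'M[R]_N) (x : V) (P : 'M[R]_N).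
Hypotheses (uGx : G x \in unitmx) (AP : invmx (G x) = P *m P^T).
(** Expresses the coordinate vectors in the frame given by the rows of [P^T]. *)
Let L := (invmx P)^T.
Let A := invmx (G x).

Lemma frame_unit : P \in unitmx.
Proof. by have := uGx; rewrite -unitmx_inv AP unitmx_mul => /andP[]. Qed.

Lemma frame_dual : L *m P^T = 1%:M.
Proof. by rewrite -trmx_mul mulmxV ?frame_unit // trmx1. Qed.

Lemma frame_inv_mul : A *m L = P.
Proof. by rewrite /A AP -mulmxA (mulmx1C frame_dual) mulmx1. Qed.

Lemma frame_gram : G x = L *m L^T.
Proof.
have PL : P^T *m L = 1%:M := mulmx1C frame_dual.
rewrite -[RHS]mul1mx -(mulmxV uGx) AP -!mulmxA [P^T *m _]mulmxA PL mul1mx.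
by rewrite trmxK mulmxV ?frame_unit // mulmx1.
Qed.

Definition frame_comp (T : gtensor) (K : seq 'I_N) : R := pull P^T K (T^~ x).

Lemma frame_compK (T : gtensor) I : T I x = pull L I (frame_comp T).
Proof. by rewrite [RHS]pull_comp frame_dual pull1. Qed.

Definition frame_ricci : 'M[R]_N :=
  \matrix_(c, d) \sum_a frame_comp (gRm D e G) [:: a; c; d; a].

(** In an orthonormal frame the trace is a plain sum, so [frame_ricci] is bounded by the frame
    components of the curvature with a constant that does not involve the metric. *)
Lemma ricci_frame :
  \matrix_(j, k) gricci D e G j k x = L *m frame_ricci *m L^T.
Proof.
apply/matrixP => j k; rewrite sandwich mxE.
pose F := frame_comp (gRm D e G).
pose Y : 'M[R]_N := \matrix_(a, f) \sum_c L j c * \sum_d L k d * F [:: a; c; d; f].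
have rE i l : gRm D e G [:: i; j; k; l] x = (L *m Y *m L^T) i l.
  rewrite frame_compK sandwich /=; apply: eq_bigr => a _; congr (_ * _).
  under eq_bigr do under eq_bigr do rewrite mulr_sumr.
  under eq_bigr do rewrite exchange_big mulr_sumr /=.
  rewrite exchange_big /=; apply: eq_bigr => f _; rewrite [Y _ _]mxE mulr_sumr.
  apply: eq_bigr => c _; rewrite !mulr_sumr; apply: eq_bigr => d _.
  by rewrite -/(F _); ring.
transitivity (\tr (L *m Y *m L^T *m A)).
  rewrite gricciE /mxtrace; apply: eq_bigr => i _.
  rewrite -(mulmxK uGx (griemmx D e G i j x)) mxE [RHS]mxE; apply: eq_bigr => l _.
  by rewrite -gRmE rE.
rewrite -!mulmxA mxtrace_mulC -!mulmxA frame_inv_mul.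
have -> : L^T *m P = 1%:M by rewrite -[P]trmxK -trmx_mul -trmx1 -(mulmx1C frame_dual).
rewrite mulmx1 /mxtrace.
transitivity (\sum_a \sum_c \sum_d L j c * (L k d * F [:: a; c; d; a])).
  by apply: eq_bigr => a _; rewrite [Y _ _]mxE; apply: eq_bigr => c _; rewrite mulr_sumr.
rewrite exchange_big /=; apply: eq_bigr => c _; rewrite exchange_big mulr_sumr /=.
by apply: eq_bigr => d _; rewrite [frame_ricci _ _]mxE !mulr_sumr.
Qed.

End RicciFrame.

Section MatrixBounds.
Context {R : realType} {N : nat}.

Lemma sandwich_le (L rho : 'M[R]_N) (tau M : R) j k :
  (forall a b, L a b ^+ 2 <= tau) -> (forall a b, `|rho a b| <= M) ->
  `|(L *m rho *m L^T) j k| <= N%:R * (N%:R * (tau * M)).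
Proof.
move=> Lt rM; rewrite sandwich.
have cN (X : R) : N%:R * X = \sum_(a < N) X by rewrite sumr_const card_ord mulr_natl.
apply: le_trans (ler_norm_sum _ _ _) _; rewrite [leRHS]cN; apply: ler_sum => a _.
rewrite normrM; apply: le_trans (ler_wpM2l (normr_ge0 _) (ler_norm_sum _ _ _)) _.
rewrite mulr_sumr cN; apply: ler_sum => b _; rewrite normrM mulrA.
apply: ler_pM => //.
have h1 := Lt j a; have h2 := Lt k b; move: h1 h2.
rewrite -(real_normK (num_real (L j a))) -(real_normK (num_real (L k b))).
by have := sqr_ge0 (`|L j a| - `|L k b|); nra.
Qed.

Lemma gram_diag_ge0 (G L : 'M[R]_N) j : G = L *m L^T -> 0 <= G j j.
Proof. by move=> ->; rewrite mxE; apply: sumr_ge0 => k _; rewrite mxE -expr2 sqr_ge0. Qed.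

Lemma gram_sqr_le_tr (G L : 'M[R]_N) j k : G = L *m L^T -> L j k ^+ 2 <= \tr G.
Proof.
move=> GL; apply: le_trans (gram_entry_le j k GL) _.
rewrite /mxtrace (bigD1 j) //= lerDl; apply: sumr_ge0 => i _.
exact: gram_diag_ge0 GL.
Qed.

Lemma gram_le_tr (G L : 'M[R]_N) j k : G = L *m L^T -> `|G j k| <= N%:R * (N%:R * (\tr G * 1)).
Proof.
move=> GL; rewrite {1}GL -{1}[L]mulmx1; apply: sandwich_le => a b.
  exact: gram_sqr_le_tr.
by rewrite mxE; case: eqP; rewrite ?normr1 ?normr0.
Qed.

End MatrixBounds.

(** * Bounds on all derivatives of a sequence of flows with bounded curvature *)

Section FlowBounds.
Context {R : realType} {N : nat}.
Notation V := ('rV[R]_N * R)%type.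
Variables (D E : set V) (T0 : R) (h : nat -> V -> 'M[R]_N).
Hypotheses (uD : upper_st D) (ED : E `<=` D) (T00 : 0 <= T0).
Hypothesis Etime : forall q t, E (q, t) -> 0 <= t <= T0 /\
  forall t', 0 <= t' <= t -> E (q, t').
Hypothesis hs : \forall i \near \oo, smoothmx D (h i).
Hypothesis hspd : \forall i \near \oo, forall x, D x -> spd (h i x).
Hypothesis hflow : \forall i \near \oo, forall x k l, D x ->
  deriv_within D (0, 1) (fun y => h i y k l) x = - 2 * gricci D est (h i) k l x.
(** The bound is on components in an orthonormal frame at each point: unlike coordinate components,
    these presuppose no bound on the metric. *)
Hypothesis hcurv : forall k, exists C : R, \forall i \near \oo, forall x, E x ->
  exists2 P : 'M[R]_N, invmx (h i x) = P *m P^T & forall K, size K = (4 + k)%N ->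
    `|pull P^T K ((iter k (gnabla D est (h i)) (gRm D est (h i)))^~ x)| <= C.
Hypothesis hinit : forall s : seq 'I_N, exists C : R, \forall i \near \oo,
  forall q k l, E (q, 0) ->
  `|derivs_within D (map est s) (fun y => h i y k l) (q, 0)| <= C.
Hypothesis hinit_inv : exists C : R, \forall i \near \oo,
  forall q, E (q, 0) -> \tr (invmx (h i (q, 0))) <= C.

Let tD := upper_st_thick uD.
Local Notation bd := (bd E).
Local Notation bdw := (bdw E).
Local Notation Bc := (Bc D E).
Local Notation tb := (tb D E).
Local Notation smf := (smf D).
Local Notation eqf := (eqf D).

(** Gronwall's inequality on the vertical segment from [(q, 0)] to [(q, t)], which stays in [E] by
    [Etime]. Nonnegativity of [f] allows [t * K] to be replaced by [T0 * |K|], which no longer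
    depends on the point. *)
Lemma family_gronwall (f : nat -> V -> R) : smf f ->
  (\forall i \near \oo, forall x, E x -> 0 <= f i x) ->
  (exists K : R, \forall i \near \oo, forall x, E x ->
     deriv_within D (0, 1) (f i) x <= K * f i x) ->
  (exists C : R, \forall i \near \oo, forall q, E (q, 0) -> f i (q, 0) <= C) ->
  exists C : R, \forall i \near \oo, forall x, E x -> f i x <= C.
Proof.
move=> sf f0 [K fK] [C fC]; exists (`|C| * expR (T0 * `|K|)).
have : \forall i \near \oo, smooth_on D (f i) /\ (forall x, E x -> 0 <= f i x).
  by move: sf f0; apply: filter_app2; near=> i.
move: fK fC; apply: filter_app3; near=> i => fK fC [sf' f0'] [q t] Eqt.
have [/andP[t0 tT] Et] := Etime Eqt.
have pE y : (q, 0) + y *: (0, t) = (q, y * t) :> V.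
  by congr (_, _); rewrite /= ?scaler0 ?addr0 ?add0r.
have Ey y : 0 <= y <= 1 -> E ((q, 0) + y *: (0, t) : V).
  move=> /andP[y0 y1]; rewrite pE; apply: Et; rewrite mulr_ge0 //=.
  by rewrite -[leRHS]mul1r ler_wpM2r.
have := @segment_gronwall _ _ _ D (f i) (q, 0) (0, t) (T0 * `|K|) tD (smooth_diff sf').
rewrite (_ : (q, 0) + (0, t) = (q, t)); last by congr (_, _); rewrite /= ?addr0 ?add0r.
move=> /(_ (fun y y01 => ED (Ey y y01))) H; apply: le_trans (H _) _.
  move=> y y01; have Eyy := Ey y y01.
  rewrite (_ : (0, t) = t *: (0, 1) :> V); last first.
    by congr (_, _); rewrite /= ?scaler0 // /GRing.scale /= mulr1.
  rewrite (deriv_within_scale _ _ tD) //; [|exact: smooth_diff|]; last first.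
    by have := ED Eyy; congr (D (_ + _ *: (_, _))); rewrite /= ?scaler0 // /GRing.scale /= mulr1.
  have -> : t *: (0, 1) = (0, t) :> V.
    by congr (_, _); rewrite /= ?scaler0 // /GRing.scale /= mulr1.
  have := fK _ Eyy; have := f0' _ Eyy; set X := f i _; set Y := deriv_within _ _ _ _ => X0 YX.
  apply: le_trans (ler_wpM2l t0 YX) _; rewrite mulrA ler_wpM2r //.
  by have := ler_norm K; have := normr_ge0 K; nra.
rewrite ler_wpM2r ?expR_ge0 //; apply: le_trans (ler_norm C); apply: fC.
by apply: Et; rewrite lexx.
Unshelve. all: by end_near. Qed.

Definition hf k l : nat -> V -> R := fun n x => h n x k l.
Definition Af k l : nat -> V -> R := fun n x => invmx (h n x) k l.
Definition rf j k : nat -> V -> R := fun n => gricci D est (h n) j k.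
Definition cf k i j : nat -> V -> R := fun n => gchr D est (h n) k i j.
Definition Tf k I : nat -> V -> R :=
  fun n => iter k (gnabla D est (h n)) (gRm D est (h n)) I.

Lemma near_unit : \forall n \near \oo, forall x, D x -> h n x \in unitmx.
Proof. by apply: filterS hspd => n hp x Dx; exact/spd_unit/hp. Qed.

Lemma smf_h k l : smf (hf k l).
Proof. by apply: filterS hs => n sh; exact: sh. Qed.

Lemma near_smooth_inv : \forall n \near \oo, smoothmx D (fun x => invmx (h n x)).
Proof.
move: hs near_unit; apply: filter_app2; near=> n => sh un; exact: (smooth_invmx tD).
Unshelve. all: by end_near. Qed.

Lemma smf_A k l : smf (Af k l).
Proof. by apply: filterS near_smooth_inv => n sA; exact: sA. Qed.

Lemma smf_T k I : smf (Tf k I).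
Proof.
move: hs near_unit; apply: filter_app2; near=> n => sh un.
exact: (smooth_nablaRm est tD).
Unshelve. all: by end_near. Qed.

(** The squared entries of the coframe are at most the trace of [h], those of the frame at most the
    trace of [h^-1]. Both bounds are thus linear in a trace, the form that Gronwall's inequality
    asks for. *)
Lemma near_frame_ricci : exists2 C : R, 0 <= C & \forall n \near \oo, forall x, E x ->
  exists P : 'M[R]_N, [/\ invmx (h n x) = P *m P^T,
    forall j k, `|((invmx P)^T *m frame_ricci D est (h n) x P *m (invmx P)) j k|
      <= C * \tr (h n x) &
    forall j k, `|(P *m frame_ricci D est (h n) x P *m P^T) j k|
      <= C * \tr (invmx (h n x))].
Proof.
have [C0 hC] := hcurv 0; pose C := `|C0|.
exists (N%:R * (N%:R * (N%:R * C))); first by rewrite /C !mulr_ge0.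
move: hC near_unit; apply: filter_app2; near=> n => hC un x Ex.
have [P AP PC] := hC x Ex; have ux := un x (ED Ex).
exists P; have rM a b : `|frame_ricci D est (h n) x P a b| <= N%:R * C.
  rewrite mxE; apply: le_trans (ler_norm_sum _ _ _) _.
  rewrite mulr_natl -[X in _ *+ X](card_ord N) -sumr_const; apply: ler_sum => c _.
  by apply: le_trans (PC [:: c; a; b; c] erefl) _; exact: ler_norm.
split=> // j k.
  have := sandwich_le j k (fun a b => gram_sqr_le_tr a b (frame_gram ux AP)) rM.
  by rewrite trmxK => H; lra.
have := sandwich_le j k (fun a b => gram_sqr_le_tr a b AP) rM.
by move=> H; lra.
Unshelve. all: by end_near. Qed.

Lemma near_flow_mx : \forall n \near \oo, forall x, D x ->
  dmx D (0, 1) (h n) x = - 2 *: \matrix_(j, k) gricci D est (h n) j k x.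
Proof.
by apply: filterS hflow => n hfl x Dx; apply/matrixP => k l; rewrite !mxE hfl.
Qed.

Lemma tr_le (M : 'M[R]_N) (C : R) : (forall k, M k k <= C) -> \tr M <= N%:R * C.
Proof.
move=> MC; rewrite mulr_natl -[X in _ *+ X](card_ord N) -sumr_const.
exact: ler_sum.
Qed.

(** The trace stands in for the largest eigenvalue: it is linear in the metric and dominates all
    entries of a positive definite matrix. Its time derivative is minus twice the coordinate trace
    of Ricci. *)
Lemma tr_h_le : exists C : R, \forall n \near \oo, forall x, E x -> \tr (h n x) <= C.
Proof.
have [C C0 hC] := near_frame_ricci; apply: family_gronwall.
- apply: filterS hs => n sh; apply: (smooth_sum tD) => k; exact: sh.
- move: hC near_unit; apply: filter_app2; near=> n => hC un x Ex.
  have [P [AP _ _]] := hC x Ex; apply: sumr_ge0 => k _.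
  exact: gram_diag_ge0 (frame_gram (un x (ED Ex)) AP).
- exists (N%:R * (2 * C)).
  have : \forall n \near \oo, smoothmx D (h n) /\ forall x, D x -> h n x \in unitmx.
    by move: hs near_unit; apply: filter_app2; near=> n.
  move: hC near_flow_mx; apply: filter_app3; near=> n => hC fl [sh un] x Ex.
  have Dx := ED Ex; have [P [AP PC _]] := hC x Ex.
  have -> : deriv_within D (0, 1) (fun y => \tr (h n y)) x = \tr (dmx D (0, 1) (h n) x).
    rewrite /mxtrace (deriv_within_sum tD) // => [|k]; last exact: smooth_diff.
    by apply: eq_bigr => k _; rewrite mxE.
  rewrite -mulrA; apply: tr_le => k; rewrite fl // (ricci_frame _ _ (un x Dx) AP).
  by rewrite mxE; have := PC k k; rewrite trmxK ler_norml => /andP[? ?]; lra.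
- have [C1 h1] := hinit [::]; exists (N%:R * C1); apply: filterS h1 => n h1 q Eq.
  by apply: tr_le => k; apply: le_trans (ler_norm _) _; exact: h1.
Unshelve. all: by end_near. Qed.

(** Together with [tr_h_le] this is the uniform equivalence of the metrics. The time derivative of
    [h^-1] is [2 h^-1 Ric h^-1], which in the frame is [2 P rho P^T] with [rho] the frame components
    of Ricci. *)
Lemma tr_A_le : exists C : R, \forall n \near \oo, forall x, E x -> \tr (invmx (h n x)) <= C.
Proof.
have [C C0 hC] := near_frame_ricci; apply: family_gronwall => //.
- apply: filterS near_smooth_inv => n sh; apply: (smooth_sum tD) => k; exact: sh.
- move: hC near_unit; apply: filter_app2; near=> n => hC un x Ex.
  have [P [AP _ _]] := hC x Ex; apply: sumr_ge0 => k _.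
  exact: gram_diag_ge0 AP.
- exists (N%:R * (2 * C)).
  have : \forall n \near \oo, [/\ smoothmx D (h n), smoothmx D (fun x => invmx (h n x)) &
      forall x, D x -> h n x \in unitmx].
    by move: hs near_smooth_inv near_unit; apply: filter_app3; near=> n.
  move: hC near_flow_mx; apply: filter_app3; near=> n => hC fl [sh sA un] x Ex.
  have Dx := ED Ex; have [P [AP _ PC]] := hC x Ex.
  have -> : deriv_within D (0, 1) (fun y => \tr (invmx (h n y))) x =
      \tr (dmx D (0, 1) (fun y => invmx (h n y)) x).
    rewrite /mxtrace (deriv_within_sum tD) // => [|k]; last exact: smooth_diff.
    by apply: eq_bigr => k _; rewrite mxE.
  rewrite -mulrA; apply: tr_le => k; rewrite (dmx_invmx tD) // fl //.
  rewrite (ricci_frame _ _ (un x Dx) AP) -scalemxAr -scalemxAl scaleNr opprK trmxK.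
  have LA : invmx P *m invmx (h n x) = P^T.
    by rewrite AP mulmxA mulVmx ?mul1mx //; exact: frame_unit (un x Dx) AP.
  have -> : invmx (h n x) *m ((invmx P)^T *m frame_ricci D est (h n) x P *m invmx P)
      *m invmx (h n x) = P *m frame_ricci D est (h n) x P *m P^T.
    by rewrite -!mulmxA LA !mulmxA (frame_inv_mul (un x Dx) AP).
  rewrite mxE.
  by have := PC k k; rewrite ler_norml => /andP[? ?]; lra.
Unshelve. all: by end_near. Qed.

Lemma near_gram : exists2 C : R, 0 <= C & \forall n \near \oo, forall x, E x ->
  forall P, invmx (h n x) = P *m P^T -> (forall j k, P j k ^+ 2 <= C) /\
    forall j k, (invmx P)^T j k ^+ 2 <= C.
Proof.
have [C1 h1] := tr_h_le; have [C2 h2] := tr_A_le.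
exists (`|C1| + `|C2|); first exact: addr_ge0.
move: h1 h2 near_unit; apply: filter_app3; near=> n => h1 h2 un x Ex P AP.
split=> j k.
  apply: le_trans (gram_sqr_le_tr j k AP) _; apply: le_trans (h2 x Ex) _.
  by rewrite ler_wpDl ?ler_norm.
apply: le_trans (gram_sqr_le_tr j k (frame_gram (un x (ED Ex)) AP)) _.
by apply: le_trans (h1 x Ex) _; rewrite ler_wpDr ?ler_norm.
Unshelve. all: by end_near. Qed.

Lemma bd_h k l : bd (hf k l).
Proof.
have [C1 h1] := tr_h_le; have [C0 hC] := hcurv 0; exists (N%:R * (N%:R * (C1 * 1))).
move: h1 hC near_unit; apply: filter_app3; near=> n => h1 hC un x Ex.
have [P AP _] := hC x Ex.
apply: le_trans (gram_le_tr k l (frame_gram (un x (ED Ex)) AP)) _.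
by rewrite !ler_wpM2l // ler_wpM2r // h1.
Unshelve. all: by end_near. Qed.

Lemma bd_A k l : bd (Af k l).
Proof.
have [C1 h1] := tr_A_le; have [C0 hC] := hcurv 0; exists (N%:R * (N%:R * (C1 * 1))).
move: h1 hC; apply: filter_app2; near=> n => h1 hC x Ex.
have [P AP _] := hC x Ex; apply: le_trans (gram_le_tr k l AP) _.
by rewrite !ler_wpM2l // ler_wpM2r // h1.
Unshelve. all: by end_near. Qed.

Lemma bd_T k I : size I = (4 + k)%N -> bd (Tf k I).
Proof.
move=> sI; have [C0 hC] := hcurv k; have [C1 C10 h1] := near_gram.
exists ((N%:R * (1 + C1)) ^+ size I * C0).
move: h1 hC near_unit; apply: filter_app3; near=> n => h1 hC un x Ex.
have [P AP PC] := hC x Ex; have [_ LC] := h1 x Ex P AP.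
rewrite /Tf (frame_compK (un x (ED Ex)) AP); apply: pull_le.
- by rewrite addr_ge0.
- move=> i j; have := LC i j; set y := (_^T) i j.
  by rewrite -real_normK ?num_real //; have := normr_ge0 y; nra.
- by move=> L sL; apply: PC; rewrite sL.
Unshelve. all: by end_near. Qed.

Section WeightedStep.
Variables (Phi : nat -> V -> R) (m : nat).
Hypothesis Phi1 : forall i x, 1 <= Phi i x.

(** A derivative of [h^-1] is [- h^-1 (dh) h^-1]: one derivative falls on [h], and the induction
    applies to the other two factors. *)
Lemma Bc_A n : (forall k l, Bc n Phi (hf k l)) -> forall k l, Bc n Phi (Af k l).
Proof.
elim: n => [|n IH] Bh k l.
  by split; [exact: smf_A|exact: (bd_bdw Phi1 (bd_A k l))].
split; first exact: smf_A.
split=> [|j]; first exact: bd_A.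
have BA k' l' : Bc n Phi (Af k' l').
  by apply: IH => *; exact: (BcS Phi1 (Bh _ _)).
apply: (eqf_Bc ED (f := fun i x => - \sum_b ((\sum_a dxf D (est j) (hf a b) i x *
   Af k a i x) * Af b l i x))).
  move: hs near_unit; apply: filter_app2; near=> i => sh un x Dx.
  have := congr1 (fun M : 'M[R]_N => M k l) (dmx_invmx tD (est j) sh un Dx).
  rewrite mxE [in RHS]mxE => E1; rewrite [RHS]E1; congr (- _); rewrite mxE; apply: eq_bigr => b _.
  rewrite mxE; congr (_ * _); apply: eq_bigr => a _.
  by rewrite [dmx _ _ _ _ _ _]mxE mulrC.
apply: (BcN uD ED Phi1); apply: (Bc_sum uD ED Phi1) => b.
apply: (BcM uD ED Phi1); [|exact: BA|exact: bd_A].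
apply: (Bc_sum uD ED Phi1) => a.
apply: (BcM uD ED Phi1); [|exact: BA|exact: bd_A].
by have [_ [_ ]] := Bh a b; exact.
Unshelve. all: by end_near. Qed.

Hypothesis Bh : forall k l, Bc m.+1 Phi (hf k l).

Lemma Bc_chr k i j : Bc m Phi (cf k i j).
Proof.
have BA k' l' := BcS Phi1 (Bc_A Bh k' l').
have Bd a k' l' : Bc m Phi (dxf D (est a) (hf k' l')).
  by have [_ [_ ]] := Bh k' l'; exact.
apply: (BcZ uD ED Phi1); apply: (Bc_sum uD ED Phi1) => l.
apply: (eqf_Bc ED (f := fun n x => (dxf D (est i) (hf j l) n x +
   dxf D (est j) (hf i l) n x - dxf D (est l) (hf i j) n x) * Af k l n x)).
  by apply: nearW => n x Dx; rewrite mulrC.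
apply: (BcM uD ED Phi1); [|exact: BA|exact: bd_A].
by apply: (BcB uD ED Phi1) => //; exact: (BcD uD ED).
Qed.

(** A coordinate derivative of [nabla^k Rm] is [nabla^(k+1) Rm], bounded by hypothesis, plus
    products of Christoffel symbols with [nabla^k Rm]. Thus [n <= m + 1] derivatives need at most
    [m] derivatives of the Christoffel symbols, that is [m + 1] of the metric. *)
Lemma Bc_T n k I : (n <= m.+1)%N -> size I = (4 + k)%N -> Bc n Phi (Tf k I).
Proof.
elim: n k I => [|n IH] k I nm sI.
  by split; [exact: smf_T|exact: (bd_bdw Phi1 (bd_T sI))].
split; first exact: smf_T.
split=> [|i]; first exact: bd_T.
apply: (eqf_Bc ED (f := fun t x => Tf k.+1 (i :: I) t x + \sum_(p < size I) \sum_j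
   cf j i (nth i I p) t x * Tf k (set_nth i I p j) t x)).
  by apply: nearW => t x Dx; rewrite /Tf iterS /gnabla subrK.
apply: (BcD uD ED).
  by apply: IH; [exact: ltnW|rewrite /= sI addnS].
apply: (Bc_sum uD ED Phi1) => p; apply: (Bc_sum uD ED Phi1) => j.
have sJ : size (set_nth i I p j) = (4 + k)%N.
  by rewrite size_set_nth (maxn_idPr _).
apply: (BcM uD ED Phi1); [|by apply: IH => //; exact: ltnW|exact: bd_T].
by apply: (Bc_le Phi1) (Bc_chr _ _ _).
Qed.

(** No derivative is lost: Ricci is a contraction of the bounded tensor [Rm] with [h^-1], so its
    order [m + 1] is controlled by the order [m + 1] of [h]. This closes the Gronwall estimate. *)
Lemma Bc_ricci j k : Bc m.+1 Phi (rf j k).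
Proof.
apply: (eqf_Bc ED (f := fun n x => \sum_i \sum_l Tf 0 [:: i; j; k; l] n x * Af l i n x)).
  apply: filterS near_unit => n un x Dx; rewrite /rf gricciE; apply: eq_bigr => i _.
  rewrite -(mulmxK (un x Dx) (griemmx _ _ _ _ _ _)) mxE; apply: eq_bigr => l _.
  by rewrite -gRmE.
apply: (Bc_sum uD ED Phi1) => i; apply: (Bc_sum uD ED Phi1) => l.
by apply: (BcM uD ED Phi1); [exact: Bc_T|exact: Bc_A|exact: bd_A].
Qed.

End WeightedStep.

Lemma bdw_all (I : finType) (Phi : nat -> V -> R) (F : I -> nat -> V -> R) :
  (forall i x, 0 <= Phi i x) -> (forall j, bdw Phi (F j)) ->
  exists2 C : R, 0 <= C & \forall n \near \oo, forall j x, E x -> `|F j n x| <= C * Phi n x.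
Proof.
move=> Phi0 bF; pose C j := sval (cid (bF j)); exists (\sum_j `|C j|).
  exact: sumr_ge0.
have : \forall n \near \oo, forall j, forall x, E x -> `|F j n x| <= C j * Phi n x.
  apply: filter_forall => j; exact: svalP (cid (bF j)).
apply: filterS => n H j x Ex; apply: le_trans (H j x Ex) _.
rewrite ler_wpM2r //; apply: le_trans (ler_norm _) _.
by rewrite (bigD1 j) //= lerDl sumr_ge0.
Qed.

(** At each order Gronwall's inequality is applied to [u], built from the squares of all derivatives
    of that order of all entries. With weight [Phi = sqrt u] the corresponding derivatives of Ricci
    are [O(Phi)], so the time derivative of [u] is [O(u)]. *)
Lemma space_derivs_bd m s k l : (size s <= m)%N -> bd (dsf D s (hf k l)).
Proof.
elim: m s k l => [|m IH] s k l; first by case: s => // _; exact: bd_h.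
rewrite leq_eqVlt => /orP[/eqP sm|]; last exact: IH.
pose J := (m.+1.-tuple 'I_N * ('I_N * 'I_N))%type.
pose y (j : J) := dsf D j.1 (hf j.2.1 j.2.2).
(* The summand 1 gives [Phi >= 1], so that the bounded contributions of lower order are [O(Phi)]
   too. *)
pose u n x := 1 + \sum_(j : J) y j n x * y j n x.
have sumc (c : R) : \sum_(j : J) c = #|{: J}|%:R * c by rewrite sumr_const mulr_natl.
have yy0 j n x : 0 <= y j n x * y j n x by rewrite -expr2 sqr_ge0.
have u1 n x : 1 <= u n x by rewrite lerDl sumr_ge0.
have u0 n x : 0 <= u n x := le_trans ler01 (u1 n x).
pose Phi n x := Num.sqrt (u n x).
have Phi1 n x : 1 <= Phi n x by rewrite -sqrtr1 ler_wsqrtr.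
have Phi0 n x : 0 <= Phi n x by exact: sqrtr_ge0.
have PhiE n x : Phi n x * Phi n x = u n x by rewrite -expr2 sqr_sqrtr.
have yPhi j n x : `|y j n x| <= Phi n x.
  rewrite -sqrtr_sqr ler_wsqrtr // expr2 /u (bigD1 j) //= addrCA lerDl.
  by rewrite addr_ge0 // sumr_ge0.
have Bh k' l' : Bc m.+1 Phi (hf k' l').
  apply: Bc_intro => [|s' s'm|s' s'm]; [exact: smf_h|exact: IH|].
  exists 1; apply: nearW => n x Ex; rewrite mul1r.
  have s'E : size s' == m.+1 by apply/eqP.
  exact: (yPhi (Tuple s'E, (k', l'))).
have [C C0 hC] : exists2 C : R, 0 <= C & \forall n \near \oo, forall (j : J) x, E x ->
    `|dsf D j.1 (rf j.2.1 j.2.2) n x| <= C * Phi n x.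
  apply: bdw_all => // j; apply: (Bc_top (m := m.+1)); first exact: Bc_ricci.
  exact: size_tuple.
have sy j : smf (y j).
  by apply: filterS (smf_h j.2.1 j.2.2) => n; exact: smooth_derivs.
have dy : \forall n \near \oo, forall (j : J) x, D x ->
    deriv_within D (0, 1) (y j n) x = -2 * dsf D j.1 (rf j.2.1 j.2.2) n x.
  apply: filter_forall => j.
  have := time_dsf_comm uD j.1 (smf_h j.2.1 j.2.2).
  have : \forall n \near \oo, smoothmx D (h n) /\ forall x, D x -> h n x \in unitmx.
    by move: hs near_unit; apply: filter_app2; near=> n.
  move: hflow; apply: filter_app3; near=> n => fl [sh un] cm x Dx.
  rewrite -[LHS]cm // /dsf -(derivs_withinZ tD) //; last exact: (smooth_gricci est tD).
  by apply: eq_derivs_within => // z Dz; exact: fl.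
have [M hM] : exists M : R, \forall n \near \oo, forall x, E x -> u n x <= M.
  apply: family_gronwall.
  - have : \forall n \near \oo, forall j : J, smooth_on D (y j n) by apply: filter_forall.
    apply: filterS => n sy'; apply: (smoothD tD); first exact: (smooth_cst tD).
    by apply: (smooth_sum tD) => j; exact: (smoothM tD).
  - by apply: nearW => n x _; exact: u0.
  - exists (#|{: J}|%:R * (4 * C)).
    have : \forall n \near \oo, forall j : J, smooth_on D (y j n) by apply: filter_forall.
    move: hC dy; apply: filter_app3; near=> n => hC dy sy' x Ex; have Dx := ED Ex.
    have -> : deriv_within D (0, 1) (u n) x =
       \sum_(j : J) 2 * (y j n x * deriv_within D (0, 1) (y j n) x).
      have dyy j : diff_on D (fun z => y j n z * y j n z).
        by apply/smooth_diff/(smoothM tD).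
      rewrite (deriv_withinD tD) //; last first.
      - by apply: smooth_diff; apply: (smooth_sum tD) => j; exact: (smoothM tD).
      - exact: (diff_on_cst (coords_st N)).
      rewrite (deriv_within_cst tD) // add0r (deriv_within_sum tD) //.
      apply: eq_bigr => j _; rewrite (deriv_withinM tD) //; try exact: smooth_diff.
      by ring.
    rewrite -mulrA -sumc; apply: ler_sum => j _.
    rewrite dy // -PhiE.
    have h1 := yPhi j n x; have h2 := hC j x Ex.
    have h3 := ler_pM (normr_ge0 _) (normr_ge0 _) h1 h2.
    rewrite -normrM in h3.
    have h4 : - (y j n x * dsf D j.1 (rf j.2.1 j.2.2) n x) <= Phi n x * (C * Phi n x).
      by apply: le_trans (ler_norm _) _; rewrite normrN.
    lra.
  - have [M hM] : exists2 M : R, 0 <= M & \forall n \near \oo, forall (j : J) x,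
        (E x /\ x.2 = 0) -> `|y j n x| <= M.
      have c j := cid (hinit j.1).
      pose C' (j : J) := sval (cid (hinit j.1)); exists (\sum_j `|C' j|); first exact: sumr_ge0.
      have : \forall n \near \oo, forall j : J, forall q k l, E (q, 0) ->
        `|derivs_within D (map est j.1) (fun y => h n y k l) (q, 0)| <= C' j.
        by apply: filter_forall => j; exact: svalP (cid (hinit j.1)).
      apply: filterS => n H j [q t] [/= Eq t0]; rewrite t0 in Eq *.
      apply: le_trans (H j q j.2.1 j.2.2 Eq) _; apply: le_trans (ler_norm _) _.
      by rewrite (bigD1 j) //= lerDl sumr_ge0.
    move=> M0; exists (1 + #|{: J}|%:R * (M * M)).
    apply: filterS M0 => n H q Eq; rewrite lerD2l -sumc.
    apply: ler_sum => j _; have := H j (q, 0) (conj Eq erefl) => h1.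
    apply: le_trans (ler_norm _) _; rewrite normrM.
    exact: ler_pM.
exists (1 + M); apply: filterS hM => n H x Ex.
have sE : size s == m.+1 by apply/eqP.
have := yPhi (Tuple sE, (k, l)) n x; rewrite -[y _ n x]/(dsf D s (hf k l) n x) => h1.
have := H x Ex; rewrite -PhiE; have := Phi1 n x; nra.
Unshelve. all: by end_near. Qed.

Lemma Bc_h n k l : Bc n (@onef R N) (hf k l).
Proof.
apply: Bc_intro => [|s sn|s sn]; first exact: smf_h.
  exact: (@space_derivs_bd n _ _ _ (ltnW sn)).
have [C hC] := @space_derivs_bd n s k l (eq_leq sn); exists C.
by apply: filterS hC => i hC x Ex; rewrite /onef mulr1 hC.
Qed.

Lemma tb_A j : (forall k l, tb j (hf k l)) -> forall k l, tb j (Af k l).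
Proof.
elim: j => [|j IH] th k l.
  by split=> // n; apply: (Bc_A (@onef_ge1 R N)) => k' l'; exact: tb_Bc (th k' l').
have tA k' l' : tb j (Af k' l') by apply: IH => *; exact/tbS.
split.
  by move=> n; apply: (Bc_A (@onef_ge1 R N)) => k' l'; exact: tb_Bc (th k' l').
apply: (eqf_tb ED (f := fun i x => -1 * \sum_b ((\sum_a dxf D (0, 1) (hf a b) i x *
   Af k a i x) * Af b l i x))).
  move: hs near_unit; apply: filter_app2; near=> i => sh un x Dx.
  have := congr1 (fun M : 'M[R]_N => M k l) (dmx_invmx tD (0, 1) sh un Dx).
  rewrite mxE [in RHS]mxE mulN1r => E1; rewrite [RHS]E1; congr (- _); rewrite mxE; apply: eq_bigr => b _.
  rewrite mxE; congr (_ * _); apply: eq_bigr => a _.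
  by rewrite [dmx _ _ _ _ _ _]mxE mulrC.
apply: (tbZ uD ED); apply: (tb_sum uD ED) => b; apply: (tbM uD ED) => //.
apply: (tb_sum uD ED) => a; apply: (tbM uD ED) => //.
by have [_ ] := th a b.
Unshelve. all: by end_near. Qed.

(** All spatial derivatives being bounded already, Ricci may be expanded here with its two
    derivatives of the metric. *)
Lemma tb_ricci m : (forall k l, tb m (hf k l)) -> forall k l, tb m (rf k l).
Proof.
move=> th; have tA := tb_A th.
have tc k i j : tb m (cf k i j).
  have t0 l : tb m (fun n x => dxf D (est i) (hf j l) n x + dxf D (est j) (hf i l) n x
      - dxf D (est l) (hf i j) n x).
    by apply: (tbB uD ED); first apply: (tbD uD ED); apply: (tb_dx uD ED); exact: th.
  apply: (tbZ uD ED); apply: (tb_sum uD ED) => l.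
  exact: (tbM uD ED (tA k l) (t0 l)).
move=> j k; apply: (tb_sum uD ED) => i.
have t1 : tb m (fun n x => dxf D (est i) (cf i j k) n x - dxf D (est j) (cf i i k) n x).
  by apply: (tbB uD ED); apply: (tb_dx uD ED); exact: tc.
have t2 : tb m (fun n x => \sum_l (cf i i l n x * cf l j k n x - cf i j l n x * cf l i k n x)).
  apply: (tb_sum uD ED) => l.
  by apply: (tbB uD ED); apply: (tbM uD ED); exact: tc.
exact: (tbD uD ED t1 t2).
Qed.

Lemma tb_h m k l : tb m (hf k l).
Proof.
elim: m k l => [|m IH] k l; first by split=> // n; exact: Bc_h.
split=> [n|]; first exact: Bc_h.
apply: (eqf_tb ED (f := fun n x => -2 * rf k l n x)).
  by apply: filterS hflow => n fl x Dx; rewrite /dxf /hf fl.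
by apply: (tbZ uD ED); exact: tb_ricci.
Qed.

(** Membership in every [tb m] is kept by spatial derivatives and, at the cost of one in [m], by the
    time derivative; so the directions may come in any order. *)
Theorem flow_derivs_bd (s : seq (cI (coords_st N))) k l :
  bd (fun n => derivs_within D (map (@ce _ _ (coords_st N)) s) (hf k l n)).
Proof.
suff H : forall f, (forall m, tb m f) -> bd (fun n => derivs_within D (map (@ce _ _ (coords_st N)) s) (f n)).
  by apply: H => m; exact: tb_h.
elim/last_ind: s => [|s j IH] f tf; first exact: tb_bd (tf 0).
rewrite (_ : (fun n => _) = fun n => derivs_within D (map (@ce _ _ (coords_st N)) s)
   (dxf D (ce j) f n)); last first.
  by apply/funext => n; rewrite map_rcons derivs_within_rcons.
apply: IH => m; case: j => [j|] /=; first exact: (tb_dx uD ED).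
by have [_ ] := tf m.+1.
Qed.

End FlowBounds.

(** * Smooth limits *)

Section PathBounds.
Context {R : realType} {V : normedModType R} (B : coords V) (D E : set V).
Hypotheses (tD : thick B D) (ED : E `<=` D).

Definition segment_in (A : set V) (a b : V) :=
  forall y : R, 0 <= y <= 1 -> A (a + y *: (b - a)).

(** Replaces convexity, which fails for regions under the graph of [eps * r^2]. The paths are kept
    within distance [|q - p|] of [p] for the sake of second-order estimates. *)
Definition quasiconvex := forall p q, E p -> E q -> exists x1 x2,
  let A := [set y | E y /\ `|y - p| <= `|q - p|] in
  [/\ segment_in A p x1, segment_in A x1 x2 & segment_in A x2 q].

Lemma segment_lip f (a b p q : V) (c : R) : diff_on D f -> 0 <= c ->
  segment_in [set y | E y /\ `|y - p| <= `|q - p|] a b ->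
  (forall k y, E y -> `|y - p| <= `|q - p| ->
    `|deriv_within D (ce (c := B) k) f y| <= c) ->
  `|f b - f a| <= 2 * #|cI B|%:R * c * `|q - p|.
Proof.
move=> df c0 sab dc; have aba : a + (b - a) = b by rewrite addrC subrK.
have [y y01] := segment_MVT tD df (fun y y01 => ED (sab y y01).1).
rewrite aba => ->; have [Ey py] := sab y y01.
rewrite (deriv_within_lform tD _ df (ED Ey)).
have ab : `|b - a| <= 2 * `|q - p|.
  have [|_ h0] := sab 0; first by rewrite lexx ler01.
  have [|_ h1] := sab 1; first by rewrite lexx ler01.
  move: h0 h1; rewrite scale0r addr0 scale1r aba => h0 h1.
  rewrite (_ : b - a = (b - p) - (a - p)); last by rewrite opprB addrA subrK.
  by apply: le_trans (ler_normB _ _) _; lra.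
apply: le_trans (ler_norm_sum _ _ _) _.
have -> : 2 * #|cI B|%:R * c * `|q - p| = \sum_(k : cI B) (2 * `|q - p|) * c.
  by rewrite sumr_const -[RHS]mulr_natl; ring.
apply: ler_sum => k _; rewrite normrM ler_pM //; last exact: dc.
by apply: le_trans (cc_le _ _) ab.
Qed.

(** Three segments, each of length at most [2 * |q - p|], and one term per coordinate. *)
Definition path_cst : R := 6 * #|cI B|%:R.

Lemma path_lip f (p q : V) (c : R) : quasiconvex -> diff_on D f -> 0 <= c ->
  E p -> E q -> (forall k y, E y -> `|y - p| <= `|q - p| ->
    `|deriv_within D (ce (c := B) k) f y| <= c) ->
  `|f q - f p| <= path_cst * c * `|q - p|.
Proof.
move=> qE df c0 Ep Eq dc; have [x1 [x2 /= [s1 s2 s3]]] := qE p q Ep Eq.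
have h1 := segment_lip df c0 s1 dc; have h2 := segment_lip df c0 s2 dc.
have h3 := segment_lip df c0 s3 dc.
have -> : f q - f p = (f q - f x2) + (f x2 - f x1) + (f x1 - f p) by ring.
apply: le_trans (ler_normD _ _) _; apply: le_trans (lerD (ler_normD _ _) (lexx _)) _.
by rewrite /path_cst; lra.
Qed.

(** [path_lip] is applied twice: to the first derivatives of [f], which change by [O(|q - p|)] along
    the path since it stays that close to [p], and then to [f] minus its linear part at [p]. *)
Lemma path_taylor f (C : R) (p q : V) : quasiconvex -> smooth_on D f -> 0 <= C ->
  E p -> E q -> (forall k l y, E y -> `|deriv_within D (ce (c := B) l)
     (deriv_within D (ce (c := B) k) f) y| <= C) ->
  `|f q - f p - \sum_(k : cI B) deriv_within D (ce k) f p * cc k (q - p)|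
    <= path_cst * (path_cst * C) * `|q - p| * `|q - p|.
Proof.
move=> qE sf C0 Ep Eq fC; have df := smooth_diff sf.
have K0 : 0 <= path_cst by rewrite mulr_ge0.
pose g y := f y - \sum_(k : cI B) deriv_within D (ce k) f p * cc k y.
have dl : diff_on D (fun y => \sum_(k : cI B) deriv_within D (ce k) f p * cc k y).
  apply/smooth_diff/(smooth_sum tD) => k; apply: (smoothM tD).
    exact: (smooth_cst tD).
  exact: (smooth_cc tD).
have dg : diff_on D g.
  apply: smooth_diff; apply: (smoothB tD) => //; apply: (smooth_sum tD) => k.
  by apply: (smoothM tD); [exact: (smooth_cst tD)|exact: (smooth_cc tD)].
have -> : f q - f p - \sum_(k : cI B) deriv_within D (ce k) f p * cc k (q - p) = g q - g p.
  rewrite /g; under eq_bigr do rewrite ccB mulrBr; rewrite sumrB; ring.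
have -> : path_cst * (path_cst * C) * `|q - p| = path_cst * (path_cst * C * `|q - p|) by ring.
apply: path_lip => //; first by rewrite !mulr_ge0.
move=> k y Ey ypq; have Dy := ED Ey.
rewrite (deriv_withinB tD) //.
have -> : deriv_within D (ce k) (fun y => \sum_(k : cI B) deriv_within D (ce k) f p * cc k y) y
   = deriv_within D (ce k) f p.
  rewrite (deriv_within_sum tD) // => [|l]; last first.
    apply/smooth_diff/(smoothM tD); first exact: (smooth_cst tD).
    exact: (smooth_cc tD).
  rewrite (bigD1 k) //= (deriv_withinZ tD) //; last exact/smooth_diff/(smooth_cc tD).
  rewrite (deriv_within_cc tD) // cc_ce eqxx mulr1 big1 ?addr0 // => l lk.
  rewrite (deriv_withinZ tD) //; last exact/smooth_diff/(smooth_cc tD).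
  by rewrite (deriv_within_cc tD) // cc_ce (negPf lk) mulr0.
apply: le_trans (path_lip qE _ C0 Ep Ey (fun l z Ez _ => fC k l z Ez)) _.
  exact/smooth_diff/smooth_deriv.
by rewrite ler_wpM2l // mulr_ge0.
Qed.

End PathBounds.

(** * Reduction to derivatives along basis vectors *)

Section BasisDerivs.
Context {R : realType} {V : normedModType R} (B : coords V) (D : set V).
Hypothesis (tD : thick B D).
Local Notation bs s := (map (@ce _ _ B) s).

(** The finite linear combinations of iterated basis derivatives of [f] form a class closed under
    differentiation in any direction. *)
Lemma smooth_basis f :
  (forall s : seq (cI B), diff_on D (derivs_within D (bs s) f)) -> smooth_on D f.
Proof.
move=> ds; pose P g := exists r : seq (R * seq (cI B)), forall q, D q ->
  g q = \sum_(x <- r) x.1 * derivs_within D (bs x.2) f q.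
apply: (@smooth_coind _ _ D P); last first.
  by exists [:: (1, [::])] => q Dq; rewrite big_seq1 mul1r.
have dZ (x : R * seq (cI B)) : diff_on D (fun q => x.1 * derivs_within D (bs x.2) f q).
  by apply: (diff_onM tD) => //; exact: (diff_on_cst B).
have dsum (r : seq (R * seq (cI B))) :
    diff_on D (fun q => \sum_(x <- r) x.1 * derivs_within D (bs x.2) f q).
  elim: r => [|x r IH]; first by under eq_fun do rewrite big_nil; exact: (diff_on_cst B).
  by under eq_fun do rewrite big_cons; apply: (diff_onD tD).
move=> g [r gr]; split=> [|v].
  by apply: eq_diff_on (dsum r) => q Dq; rewrite gr.
exists (deriv_within D v g) => //.
exists [seq (x.1 * cc k v, k :: x.2) | x <- r, k <- enum (cI B)] => q Dq.
rewrite (eq_deriv_within v gr Dq) (deriv_within_sum tD) //.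
rewrite big_allpairs_dep /=; apply: eq_bigr => x _.
rewrite (deriv_withinZ tD) // (deriv_within_lform tD v (ds x.2) Dq) mulr_sumr.
by rewrite -big_enum /=; apply: eq_bigr => k _; rewrite mulrA.
Qed.

Lemma derivs_within_lsum (I : Type) (r : seq I) (c : I -> R) (F : I -> V -> R) s q :
  (forall k, smooth_on D (F k)) -> D q ->
  derivs_within D s (fun y => \sum_(k <- r) c k * F k y) q =
  \sum_(k <- r) c k * derivs_within D s (F k) q.
Proof.
move=> sF; elim: s q => //= v s IH q Dq.
rewrite (@eq_deriv_within _ _ D _ (fun y => \sum_(k <- r) c k * derivs_within D s (F k) y)) //.
rewrite (deriv_within_sum tD) // => [|k].
  by apply: eq_bigr => k _; rewrite (deriv_withinZ tD) //; exact/smooth_diff/smooth_derivs.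
apply: (diff_onM tD); first exact: (diff_on_cst B).
exact/smooth_diff/smooth_derivs.
Qed.

Lemma smooth_cvg_basis (f : nat -> V -> R) (f0 : V -> R) (K : set V) :
  K `<=` D -> (\forall n \near \oo, smooth_on D (f n)) -> smooth_on D f0 ->
  (forall (s : seq (cI B)) (e : R), 0 < e -> \forall n \near \oo, forall p, K p ->
     `|derivs_within D (bs s) (f n) p - derivs_within D (bs s) f0 p| < e) ->
  forall (s : seq V) (e : R), 0 < e -> \forall n \near \oo, forall p, K p ->
     `|derivs_within D s (f n) p - derivs_within D s f0 p| < e.
Proof.
move=> KD sf sf0 cv s; elim/last_ind: s f f0 sf sf0 cv => [|s v IH] f f0 sf sf0 cv.
  exact: (cv [::]).
suff H : forall e : R, 0 < e -> \forall n \near \oo, forall p, K p ->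
    `|derivs_within D s (deriv_within D v (f n)) p
    - derivs_within D s (deriv_within D v f0) p| < e.
  move=> e e0; have := H e e0; apply: filterS => n h p Kp.
  by rewrite !derivs_within_rcons; exact: h.
apply: (IH (fun n => deriv_within D v (f n))).
- by apply: filterS sf => n; exact: smooth_deriv.
- exact: smooth_deriv.
move=> {IH} z e1 e10.
have M0 : 0 < \sum_(k : cI B) `|cc k v| + 1 by rewrite ltr_wpDl ?sumr_ge0.
have e'0 := divr_gt0 e10 M0.
have : \forall n \near \oo, forall k : cI B, forall p, K p ->
    `|derivs_within D (bs (rcons z k)) (f n) p - derivs_within D (bs (rcons z k)) f0 p|
      < e1 / (\sum_(k : cI B) `|cc k v| + 1).
  by apply: filter_forall => k; exact: cv.
move: sf; apply: filter_app2; near=> n => sf H p Kp; have Dp := KD p Kp.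
have E g : smooth_on D g -> derivs_within D (bs z) (deriv_within D v g) p =
    \sum_(k : cI B) cc k v * derivs_within D (bs (rcons z k)) g p.
  move=> sg; rewrite (@eq_derivs_within _ _ D _ (fun y => \sum_(k : cI B) cc k v *
     deriv_within D (ce k) g y)) // => [|y Dy].
    rewrite derivs_within_lsum //; last by move=> k; exact: smooth_deriv.
    by apply: eq_bigr => k _; rewrite map_rcons derivs_within_rcons.
  exact: (deriv_within_lform tD v (smooth_diff sg) Dy).
rewrite !E // -sumrB; apply: le_lt_trans (ler_norm_sum _ _ _) _.
apply: (@le_lt_trans _ _ (\sum_(k : cI B) `|cc k v| * (e1 / (\sum_(k : cI B) `|cc k v| + 1)))).
  by apply: ler_sum => k _; rewrite -mulrBr normrM ler_wpM2l // ltW // H.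
rewrite -mulr_suml mulrA ltr_pdivrMr // mulrC ltr_pM2l //.
by rewrite ltrDl.
Unshelve. all: by end_near. Qed.

End BasisDerivs.

(** * Limits of sequences with locally bounded derivatives *)

Section SmoothLimit.
Context {R : realType} {V : normedModType R} (B : coords V) (D : set V).
Hypothesis cD : corner B D.
Let tD := corner_thick cD.
Local Notation bs s := (map (@ce _ _ B) s).
Variable f : nat -> V -> R.

(** [E] is a neighbourhood of [p] relative to [D]; quasiconvexity turns the bounds into Taylor
    estimates whose constants do not depend on the index. *)
Definition locally_bounded_derivs := forall p, D p -> exists E : set V,
  [/\ E `<=` D, E p, quasiconvex E, \forall q \near p, D q -> E q &
   forall s : seq (cI B), exists C : R, \forall n \near \oo, forall x, E x ->
     `|derivs_within D (bs s) (f n) x| <= C].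

Hypotheses (sf : \forall n \near \oo, smooth_on D (f n))
  (loc : locally_bounded_derivs)
  (cv : forall p, D p -> cvgn (fun n => f n p)).

Let der s n := derivs_within D (bs s) (f n).

Definition limder s p : R := limn (fun n => der s n p).

Lemma local_taylor p s : D p -> exists (E : set V) (C : R),
  [/\ E `<=` D, E p, 0 <= C, \forall q \near p, D q -> E q &
   \forall n \near \oo, forall q q', E q -> E q' ->
    `|der s n q' - der s n q| <= C * `|q' - q| /\
    `|der s n q' - der s n q - \sum_(k : cI B) der (k :: s) n q * cc k (q' - q)|
      <= C * `|q' - q| * `|q' - q|].
Proof.
move=> Dp; have [E [ED Ep qE nE bE]] := loc Dp.
have ubound (I : finType) (z : I -> seq (cI B)) : exists2 C : R, 0 <= C &
    \forall n \near \oo, forall j x, E x -> `|der (z j) n x| <= C.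
  pose C j := sval (cid (bE (z j))); exists (\sum_j `|C j|); first exact: sumr_ge0.
  have : \forall n \near \oo, forall j x, E x -> `|der (z j) n x| <= C j.
    by apply: filter_forall => j; exact: svalP (cid (bE (z j))).
  apply: filterS => n H j x Ex; apply: le_trans (H j x Ex) _.
  by apply: le_trans (ler_norm _) _; rewrite (bigD1 j) //= lerDl sumr_ge0.
have [C1 C10 h1] := ubound (cI B) (fun k => k :: s).
have [C2 C20 h2] := ubound (cI B * cI B)%type (fun k => [:: k.2, k.1 & s]).
have K0 : 0 <= path_cst (R := R) B by rewrite mulr_ge0.
exists E, (path_cst B * C1 + path_cst B * (path_cst B * C2)).
split=> //; first by rewrite addr_ge0 // !mulr_ge0.
move: h1 h2 sf; apply: filter_app3; near=> n => h1 h2 sfn q q' Eq Eq'.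
have sd := smooth_derivs (bs s) sfn.
split.
  apply: le_trans (path_lip tD ED qE (smooth_diff sd) C10 Eq Eq' _) _ => [k y Ey _|].
    exact: (h1 k y Ey).
  by rewrite ler_wpM2r // lerDl !mulr_ge0.
apply: le_trans (path_taylor tD ED qE sd C20 Eq Eq' _) _ => [k l y Ey|].
  exact: (h2 (k, l) y Ey).
by rewrite !ler_wpM2r // lerDr !mulr_ge0.
Unshelve. all: by end_near. Qed.

(** A difference quotient of step [x] approximates the next derivative with error [O(x)], uniformly
    in the index, and for fixed [x] it converges. Hence the sequence of derivatives is Cauchy. *)
Lemma der_cvg s p : D p -> cvgn (fun n => der s n p).
Proof.
elim: s p => [|k s IH] p Dp; first exact: cv.
have [sg [d [d0 sg1 hD]]] := cD Dp.
have Dw x : 0 <= x <= d -> D (p + (x * sg k) *: ce k).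
  move=> xd; have := hD k k x 0 xd; rewrite lexx ltW // => /(_ isT).
  by rewrite mul0r scale0r addr0.
have [E [C [ED Ep C0 nE hE]]] := local_taylor s Dp.
pose c := `|ce (c := B) k| + 1; have c0 : 0 < c by rewrite ltr_wpDl.
have sg0 : sg k != 0 by rewrite -normr_gt0 sg1.
apply: cauchy_cvg; apply: cauchy_exP => e e0.
(* The step stays in the corner and in [E], and its Taylor error is at most a quarter of [e * x];
   another quarter is spent at each end of the quotient. *)
have [x [x0 xd Ex xe]] : exists x : R, [/\ 0 < x, x <= d,
    E (p + (x * sg k) *: ce k) & C * x * (c * c) <= e / 4].
  have /nbhs_normP[r /= r0 hr] := nE.
  have c1 : 0 < (C + 1) * (c * c) by rewrite !mulr_gt0 // ltr_wpDl.
  exists (Num.min d (Num.min (r / 2 / c) (e / 4 / ((C + 1) * (c * c))))).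
  set x := Num.min _ _.
  have x0 : 0 < x by rewrite !lt_min d0 !divr_gt0.
  have xd : x <= d by rewrite ge_min lexx.
  have xr : x <= r / 2 / c by rewrite !ge_min lexx orbT.
  have xe : x <= e / 4 / ((C + 1) * (c * c)) by rewrite !ge_min lexx !orbT.
  split=> //.
    apply: hr; last by apply: Dw; rewrite ltW.
    rewrite /= opprD addrA subrr add0r normrN normrZ normrM sg1 mulr1 (gtr0_norm x0).
    move: xr; rewrite ler_pdivlMr // /c mulrDr mulr1; lra.
  move: xe; rewrite ler_pdivlMr //; have := mulr_gt0 x0 (mulr_gt0 c0 c0); lra.
set p' := p + (x * sg k) *: ce k in Ex.
have cp := IH p Dp; have cp' := IH p' (ED _ Ex).
exists ((limder s p' - limder s p) / (x * sg k)).
have xs0 : x * sg k != 0 by rewrite mulf_neq0 // gt_eqF.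
have ex0 : 0 < e * x / 4 by rewrite !mulr_gt0.
have h1 : \forall n \near \oo, `|limder s p' - der s n p'| <= e * x / 4.
  exact: (@cvgr_dist_le _ _ _ _ _ (fun n => der s n p') _ cp').
have h2 : \forall n \near \oo, `|limder s p - der s n p| <= e * x / 4.
  exact: (@cvgr_dist_le _ _ _ _ _ (fun n => der s n p) _ cp).
move: h1 h2 hE; apply: filter_app3; near=> n => h1 h2 hE.
have [_ h3] := hE p p' Ep Ex.
rewrite -ball_normE /=.
have pp : p' - p = (x * sg k) *: ce k by rewrite /p' addrC addKr.
move: h3; rewrite pp.
have -> : \sum_(j : cI B) der (j :: s) n p * cc j ((x * sg k) *: ce k) = der (k :: s) n p * (x * sg k).
  rewrite (bigD1 k) //= ccZ cc_ce eqxx mulr1 big1 ?addr0 // => j jk.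
  by rewrite ccZ cc_ce (negPf jk) !mulr0.
rewrite normrZ normrM sg1 mulr1 (gtr0_norm x0) => h3.
have h4 : C * (x * `|ce k|) * (x * `|ce k|) <= x * (e / 4).
  have cc : `|ce k| * `|ce k| <= c * c by rewrite ler_pM // /c lerDl.
  have -> : C * (x * `|ce k|) * (x * `|ce k|) = x * (C * x * (`|ce k| * `|ce k|)) by ring.
  rewrite ler_wpM2l ?(ltW x0) //; apply: le_trans xe; rewrite ler_wpM2l //.
  by rewrite mulr_ge0 // ltW.
have {h3} := le_trans h3 h4; set u := der (k :: s) n p; set L := limder s p'; set M := limder s p.
move=> h3; have h5 : `|(L - M - u * (x * sg k))| < e * x.
  move: h1 h2 h3; rewrite -/L -/M !ler_norml ltr_norml.
  by move=> /andP[? ?] /andP[? ?] /andP[? ?]; apply/andP; split; lra.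
have -> : (L - M) / (x * sg k) - u = (L - M - u * (x * sg k)) / (x * sg k).
  by field; rewrite ?sg0 ?(gt_eqF x0).
by rewrite normrM normfV normrM sg1 mulr1 (gtr0_norm x0) ltr_pdivrMr.
Unshelve. all: by end_near. Qed.

Lemma cvg_rsum (I : Type) (r : seq I) (u : I -> nat -> R) (l : I -> R) :
  (forall k, u k @ \oo --> l k) ->
  (fun n => \sum_(k <- r) u k n) @ \oo --> \sum_(k <- r) l k.
Proof.
move=> ul; elim: r => [|k r IH].
  by under eq_fun do rewrite big_nil; rewrite big_nil; exact: cvg_cst.
by under eq_fun do rewrite big_cons; rewrite big_cons; exact: cvgD.
Qed.

Lemma limder_le (u : nat -> R) (C : R) : cvgn u -> (\forall n \near \oo, `|u n| <= C) ->
  `|limn u| <= C.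
Proof.
move=> cu uC; rewrite -lim_norm //; apply: limr_le; first exact: is_cvg_norm.
exact: uC.
Qed.

(** The Taylor estimate has constants independent of the index, so it passes to the limit; there it
    says that the limits of the derivatives are the gradient of the limit. *)
Lemma limder_grad s p : D p -> has_grad (B := B) D (limder s) p (fun k => limder (k :: s) p).
Proof.
move=> Dp; have [E [C [ED Ep C0 nE hE]]] := local_taylor s Dp.
move=> e e0; rewrite near_withinE.
have C1 : 0 < C + 1 by rewrite ltr_wpDl.
have : \forall q \near p, `|q - p| <= e / (C + 1).
  by apply: near_ball_norm; rewrite divr_gt0.
move: nE; apply: filter_app2; near=> q => Eq qe Dq.
have {}Eq := Eq Dq.
apply: (@le_trans _ _ (C * `|q - p| * `|q - p|)); last first.
  rewrite ler_wpM2r //; move: qe; rewrite ler_pdivlMr //.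
  by have := normr_ge0 (q - p); lra.
have cq := der_cvg (s := s) Dq; have cp := der_cvg (s := s) Dp.
have cs : (fun n => \sum_(k : cI B) der (k :: s) n p * cc k (q - p)) @ \oo -->
    (\sum_(k : cI B) limder (k :: s) p * cc k (q - p)).
  by apply: cvg_rsum => k; apply: cvgMr_tmp; exact: der_cvg.
have cu : (fun n => der s n q - der s n p - \sum_(k : cI B) der (k :: s) n p * cc k (q - p)) @ \oo
   --> (limder s q - limder s p - \sum_(k : cI B) limder (k :: s) p * cc k (q - p)).
  by apply: cvgB => //; apply: cvgB.
rewrite /lform -(cvg_lim _ cu) //; apply: limder_le; first exact: cvgP cu.
by apply: filterS hE => n hE; have [] := hE p q Ep Eq.
Unshelve. all: by end_near. Qed.

Lemma limder_derivs s p : D p -> derivs_within D (bs s) (limder [::]) p = limder s p.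
Proof.
elim: s p => //= k s IH p Dp; rewrite (eq_deriv_within _ IH Dp).
by rewrite (deriv_within_ce k tD Dp (limder_grad s Dp)).
Qed.

Lemma limder_smooth : smooth_on D (limder [::]).
Proof.
apply: (smooth_basis tD) => s p Dp; apply/(ex_gradP B).
exists (fun k => limder (k :: s) p).
apply: (has_grad_congr (D := D)) (limder_grad s Dp).
  by apply: nearW => q Dq; rewrite limder_derivs.
by rewrite limder_derivs.
Qed.

(** Convergence at one point and a common Lipschitz constant give uniform closeness near that point;
    compactness of [K] covers the rest. *)
Lemma limder_uniform s (K : set V) (e : R) : compact K -> K `<=` D -> 0 < e ->
  \forall n \near \oo, forall p, K p -> `|der s n p - derivs_within D (bs s) (limder [::]) p| < e.
Proof.
move=> cK KD e0; have /compact_near_coveringP/near_covering_withinP cK' := cK.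
apply: (cK' _ \oo (fun n p => `|der s n p - derivs_within D (bs s) (limder [::]) p| < e)).
move=> p Kp; have Dp := KD p Kp.
have [E [C [ED Ep C0 nE hE]]] := local_taylor s Dp.
pose d := e / (4 * (C + 1)).
have C1 : 0 < 4 * (C + 1) by rewrite mulr_gt0 // ltr_wpDl.
have d0 : 0 < d by rewrite divr_gt0.
have Cd : C * d <= e / 4.
  rewrite /d; have -> : e / 4 = (C + 1) * (e / (4 * (C + 1))).
    by field; rewrite gt_eqF // ltr_wpDl.
  by rewrite ler_wpM2r ?(ltW d0) // lerDl.
have hp : \forall n \near \oo, `|limder s p - der s n p| <= e / 4.
  apply: (@cvgr_dist_le _ _ _ _ _ (fun n => der s n p)); last by rewrite divr_gt0.
  exact: der_cvg.
have hU : \forall q \near p, `|q - p| <= d /\ (D q -> E q).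
  by move: (near_ball_norm p d0) nE; apply: filter_app2; near=> q.
exists ([set q | `|q - p| <= d /\ (D q -> E q)],
        [set n | `|limder s p - der s n p| <= e / 4 /\
   (forall q q', E q -> E q' -> `|der s n q' - der s n q| <= C * `|q' - q|)]).
  split=> //=; move: hp hE; apply: filter_app2; near=> n => h1 h2; split=> // q q' Eq Eq'.
  by have [] := h2 q q' Eq Eq'.
move=> [q n] /= [[qd /= DE] [h1 h2]] Kq; have Dq := KD q Kq; have Eq := DE Dq.
rewrite limder_derivs //.
have h3 := le_trans (h2 p q Ep Eq) (ler_wpM2l C0 qd).
have h4 : `|limder s q - limder s p| <= C * d.
  have cq := der_cvg (s := s) Dq; have cp := der_cvg (s := s) Dp.
  have cu : (fun m => der s m q - der s m p) @ \oo --> limder s q - limder s p.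
    by apply: cvgB.
  rewrite -(cvg_lim _ cu) //; apply: limder_le; first exact: cvgP cu.
  apply: filterS hE => m hE; have [h _] := hE p q Ep Eq; apply: le_trans h _.
  exact: ler_wpM2l.
move: h1 h3 h4 Cd; rewrite !ler_norml ltr_norml.
by move=> /andP[? ?] /andP[? ?] /andP[? ?] ?; apply/andP; split; lra.
Unshelve. all: by end_near. Qed.

Theorem smooth_limit : [/\ smooth_on D (limder [::]),
  forall s p, D p -> der s n p @[n --> \oo] --> derivs_within D (bs s) (limder [::]) p &
  smooth_cvg_on \oo D f (limder [::])].
Proof.
split; first exact: limder_smooth.
  by move=> s p Dp; rewrite limder_derivs //; exact: der_cvg.
move=> K s e cK KD e0; apply: (smooth_cvg_basis tD KD sf limder_smooth) e0 => {}s {}e e0.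
exact: limder_uniform.
Qed.

End SmoothLimit.

(** An ultrafilter finer than [\oo] gives all the bounded sequences limits at once. The indices are
    then chosen increasing, the [k]-th bringing the first [k + 1] sequences within [1 / (k + 1)] of
    their limits; no nested subsequences occur. *)
Lemma diagonal_extraction (R : realType) (u : nat -> nat -> R) :
  (forall l, exists C : R, \forall i \near \oo, `|u l i| <= C) ->
  exists2 s : nat -> nat, {homo s : i j / (i < j)%N} &
    forall l, cvgn (fun i => u l (s i)).
Proof.
move=> ub; have [G [uG ooG]] := ultraFilterLemma (eventually_filter : ProperFilter \oo).
have lim l : exists a : R, u l @ G --> a.
  have [C hC] := ub l.
  have cC : compact `[- C, C]%classic by exact: segment_compact.
  have GA : (u l @ G) `[- C, C]%classic.
    by apply: (@filterS _ G _ _ _ _ (ooG _ hC)) => i; rewrite /= in_itv /= ler_norml.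
  have [a [_ cl]] := cC (u l @ G) _ GA; exists a => A nA.
  have [//|GnA] := in_ultra_setVsetC (u l @^-1` A) uG.
  by have [y [ny Ay]] := cl (~` A) A GnA nA.
have {}lim l := cid (lim l); pose a l := sval (lim l).
have aP l : u l @ G --> a l := svalP (lim l).
have next k m : exists i, (m < i)%N /\
    forall l : 'I_k.+1, `|a l - u l i| < (k.+1%:R)^-1.
  have H : \forall i \near G, (m < i)%N /\ forall l : 'I_k.+1, `|a l - u l i| < (k.+1%:R)^-1.
    have h1 : \forall i \near G, (m < i)%N by apply: ooG; exact: nbhs_infty_gt.
    have h2 : \forall i \near G, forall l : 'I_k.+1, `|a l - u l i| < (k.+1%:R)^-1.
      apply: filter_forall => l; apply: (@cvgr_dist_lt _ _ _ _ _ (u l) _ (aP l)).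
      by rewrite invr_gt0.
    by move: h1 h2; apply: filter_app2; apply: nearW.
  exact: filter_ex H.
pose nx k m := sval (cid (next k m)); have nxP k m := svalP (cid (next k m)).
pose s := fix s k := if k is k'.+1 then nx k (s k') else nx 0%N 0%N.
exists s.
  by apply: homo_ltn => // [x y z|k]; [exact: ltn_trans|exact: (nxP k.+1 (s k)).1].
move=> l; apply/cvg_ex; exists (a l); apply/cvgrPdist_lt => e e0.
have sP k : (l <= k)%N -> `|a l - u l (s k)| < (k.+1%:R)^-1.
  move=> lk; have lk' : (l < k.+1)%N by rewrite ltnS.
  by case: k lk lk' => [|k] lk lk'; [exact: (nxP 0%N 0%N).2 (Ordinal lk')|
    exact: (nxP k.+1 (s k)).2 (Ordinal lk')].
near=> k; apply: lt_trans (sP k _) _.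
  by near: k; exact: nbhs_infty_ge.
by near: k; exact: near_infty_natSinv_lt (PosNum e0).
Unshelve. all: by end_near. Qed.

(** * Charts, pullbacks and the cone *)

Section Shape.
Context {R : realType} {N : nat}.
Implicit Types (U : set 'rV[R]_N) (beta : 'rV[R]_N -> R).

Definition under_graph U beta : set ('rV[R]_N * R) :=
  [set p | U p.1 /\ 0 <= p.2 <= beta p.1].

(** At [t = 0] there is room forwards because [beta] is positive; at later times there is room
    backwards, and increasing the coordinates only raises the graph. *)
Lemma under_graph_upper U beta : open U -> (forall q, U q -> 0 < beta q) ->
  (forall q q', U q -> U q' -> (forall k, q 0 k <= q' 0 k) -> beta q <= beta q') ->
  upper_st (under_graph U beta).
Proof.
move=> oU b0 bm q t [/= Uq /andP[t0 tb]].
have [d d0 hd] := open_upper_rV oU Uq; have bq := b0 q Uq.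
have [->|tn] := eqVneq t 0.
  exists (Num.min d (beta q)), 1; rewrite lt_min d0 bq normr1; split=> // q' t'.
  rewrite !subr0 le_min => /andP[qd _] qk; rewrite le_min => /andP[_ tb'].
  rewrite mul1r => t0'; have Uq' := hd q' qd qk; split=> //=.
  rewrite t0' /=; apply: le_trans (bm _ _ Uq Uq' qk).
  by move: tb'; rewrite ger0_norm.
have {}t0 : 0 < t by rewrite lt_neqAle eq_sym tn.
exists (Num.min d t), (-1); rewrite lt_min d0 t0 normrN1; split=> // q' t'.
rewrite le_min => /andP[qd _] qk; rewrite le_min => /andP[_ tt].
rewrite mulN1r oppr_ge0 subr_le0 => t't; have Uq' := hd q' qd qk; split=> //=.
move: tt; rewrite ler_norml => /andP[h _]; apply/andP; split; first by lra.
by apply: le_trans t't (le_trans tb (bm _ _ Uq Uq' qk)).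
Qed.

Lemma halfspace_upper U : open U -> upper_st [set p : 'rV[R]_N * R | U p.1 /\ 0 <= p.2].
Proof.
move=> oU q t [/= Uq t0]; have [d d0 hd] := open_upper_rV oU Uq.
exists d, 1; rewrite normr1; split=> // q' t' qd qk _; rewrite mul1r subr_ge0 => tt.
by split=> /=; [exact: hd|exact: le_trans tt].
Qed.

Definition box (q0 : 'rV[R]_N) (d : R) beta : set ('rV[R]_N * R) :=
  [set p | `|p.1 - q0| <= d /\ 0 <= p.2 <= beta p.1].

(** The path goes down in time to the smaller of [t] and [t'], across in space, and up again. The
    hypothesis, quasiconcavity of [beta], keeps the horizontal piece under the graph. *)
Lemma box_quasiconvex q0 d beta :
  (forall q q' y, `|q - q0| <= d -> `|q' - q0| <= d -> 0 <= y <= 1 ->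
    Num.min (beta q) (beta q') <= beta (q + y *: (q' - q))) ->
  quasiconvex (box q0 d beta).
Proof.
move=> bq [q t] [q' t'] [/= qd /andP[t0 tb]] [/= qd' /andP[t0' tb']].
pose m := Num.min t t'.
have mt : m <= t by rewrite ge_min lexx.
have mt' : m <= t' by rewrite ge_min lexx orbT.
have m0 : 0 <= m by rewrite le_min t0.
have tm : t - m <= `|t' - t|.
  by rewrite /m; case: (leP t t') => h; [rewrite subrr|rewrite distrC ler_norm].
have tm' : t' - m <= `|t' - t|.
  by rewrite /m; case: (leP t t') => h; [rewrite ler_norm|rewrite subrr].
have nE : `|(q', t') - (q, t)| = Num.max `|q' - q| `|t' - t| by rewrite prod_normE.
exists (q, m), (q', m); rewrite nE; split=> y /andP[y0 y1] /=.
- have -> : (q, t) + y *: ((q, m) - (q, t)) = (q, t + y * (m - t)).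
    by congr (_, _); rewrite /= subrr scaler0 addr0.
  have ty : 0 <= y * (t - m) <= t - m.
    by rewrite mulr_ge0 ?subr_ge0 //= -[leRHS]mul1r ler_wpM2r // subr_ge0.
  split; first by split=> //=; apply/andP; split; move/andP: ty => [? ?]; lra.
  rewrite prod_normE /= subrr normr0 ge_max le_max normr_ge0 /= le_max; apply/orP; right.
  rewrite addrAC subrr add0r -opprB mulrN normrN ger0_norm; last by case/andP: ty.
  by case/andP: ty => _ h; apply: le_trans h tm.
- have -> : (q, m) + y *: ((q', m) - (q, m)) = (q + y *: (q' - q), m).
    by congr (_, _); rewrite /= subrr scaler0 addr0.
  split.
    split=> /=.
      have -> : q + y *: (q' - q) - q0 = (1 - y) *: (q - q0) + y *: (q' - q0).
        by apply/rowP => k; rewrite !mxE; ring.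
      apply: le_trans (ler_normD _ _) _; rewrite !normrZ (ger0_norm y0).
      rewrite ger0_norm ?subr_ge0 //.
      have : (1 - y) * `|q - q0| <= (1 - y) * d by rewrite ler_wpM2l ?subr_ge0.
      have : y * `|q' - q0| <= y * d by rewrite ler_wpM2l.
      lra.
    rewrite m0 /=; apply: le_trans (bq q q' y qd qd' _); last by rewrite y0.
    by rewrite le_min (le_trans mt tb) (le_trans mt' tb').
  rewrite prod_normE /= ge_max !le_max; apply/andP; split; apply/orP.
    by left; rewrite addrAC subrr add0r normrZ (ger0_norm y0) -[leRHS]mul1r ler_wpM2r.
  by right; rewrite distrC ger0_norm ?subr_ge0.
- have -> : (q', m) + y *: ((q', t') - (q', m)) = (q', m + y * (t' - m)).
    by congr (_, _); rewrite /= subrr scaler0 addr0.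
  have ty : 0 <= y * (t' - m) <= t' - m.
    by rewrite mulr_ge0 ?subr_ge0 //= -[leRHS]mul1r ler_wpM2r // subr_ge0.
  split; first by split=> //=; apply/andP; split; move/andP: ty => [? ?]; lra.
  rewrite prod_normE /= ge_max !le_max lexx /=; apply/orP; right.
  move: ty; rewrite /m; case: (leP t t') => tt.
    by move=> /andP[h1 h2]; rewrite addrAC subrr add0r ger0_norm // (le_trans h2) // ler_norm.
  by rewrite subrr mulr0 addr0.
Qed.

End Shape.

(** * Jacobians, charts and restriction of maps *)

Section Jacobian.
Context {R : realType}.

(** [jac] without charts. Rows are indexed by source directions, so Jacobians of a composition
    multiply from left to right. *)
Definition Jm a b (D : set 'rV[R]_a) (f : 'rV[R]_a -> 'rV[R]_b) (q : 'rV[R]_a) :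
    'M[R]_(a, b) :=
  \matrix_(k, l) deriv_within D (delta_mx 0 k) (fun q' => f q' 0 l) q.

Lemma Jm_local a b (D1 D2 O : set 'rV[R]_a) (f g : 'rV[R]_a -> 'rV[R]_b) q :
  open O -> O q -> D1 q -> (forall q', O q' -> (D1 q' <-> D2 q')) ->
  (forall q', O q' -> D1 q' -> f q' = g q') -> Jm D1 f q = Jm D2 g q.
Proof.
move=> oO Oq Dq DD fg; apply/matrixP => k l; rewrite !mxE.
by apply: (derivs_within_congr [:: _] oO DD) => // q' Oq' D1q'; rewrite fg.
Qed.

Lemma Jm_comp a b c (D1 D3 : set 'rV[R]_a) (D2 : set 'rV[R]_b)
    (f1 : 'rV[R]_a -> 'rV[R]_b) (f2 : 'rV[R]_b -> 'rV[R]_c) (f3 : 'rV[R]_a -> 'rV[R]_c) q :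
  open D1 -> open D2 -> open D3 -> D1 q -> D3 q ->
  (forall l, smooth_on D1 (fun q => f1 q 0 l)) ->
  (forall l, smooth_on D2 (fun q => f2 q 0 l)) ->
  (forall q', D1 q' -> D3 q' -> D2 (f1 q') /\ f3 q' = f2 (f1 q')) ->
  Jm D3 f3 q = Jm D1 f1 q *m Jm D2 f2 (f1 q).
Proof.
move=> o1 o2 o3 D1q D3q s1 s2 hf; have o13 := openI o1 o3.
have t13 := upper_rV_thick (open_upper_rV o13).
have t2 := upper_rV_thick (open_upper_rV o2).
have t1 := upper_rV_thick (open_upper_rV o1).
have -> : Jm D3 f3 q = Jm (D1 `&` D3) (fun q => f2 (f1 q)) q.
  apply: (Jm_local o1) => // [q' D1q'|q' D1q' D3q']; first by split=> [|[]].
  exact: (hf q' D1q' D3q').2.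
have d1 l : diff_on (D1 `&` D3) (fun q => f1 q 0 l).
  by apply/smooth_diff/(smooth_restrict t1 t13) => // x [].
apply/matrixP => k l; rewrite !mxE.
rewrite (deriv_within_comp t13 t2 _ (fun x D => (hf x D.1 D.2).1) d1 (smooth_diff (s2 l))) //.
apply: eq_bigr => m _; rewrite !mxE; congr (_ * _).
by apply: (deriv_within_restrict t1 t13 _ _ (smooth_diff (s1 m))) => // x [].
Qed.

End Jacobian.

Section GoodCharts.
Context {R : realType} {n : nat} {X : topologicalType} (A : atlas R n X).

Definition cimg (i : idx A) : set 'rV[R]_n := cmap i @` cdom i.

Definition good_chart (i : idx A) :=
  [/\ open (cdom i), open (cimg i),
      forall x, cdom i x -> cinv i (cmap i x) = x,
      {within cdom i, continuous (cmap i)}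
    & {within cimg i, continuous (cinv i)}].

Section OneChart.
Variable i : idx A.
Hypothesis gi : good_chart i.

Lemma cimg_dom q : cimg i q -> cdom i (cinv i q).
Proof. by case: gi => _ _ K _ _ [x Dx <-]; rewrite K. Qed.

Lemma cimgK q : cimg i q -> cmap i (cinv i q) = q.
Proof. by case: gi => _ _ K _ _ [x Dx <-]; rewrite K. Qed.

Lemma cdomK x : cdom i x -> cinv i (cmap i x) = x.
Proof. by case: gi => _ _ K _ _; exact: K. Qed.

Lemma chart_imageE (O : set X) :
  cmap i @` (O `&` cdom i) = cimg i `&` cinv i @^-1` O.
Proof.
apply/seteqP; split=> [_ [x [Ox Dx] <-]|q [iq Oq]].
  by split; [exists x|rewrite /= cdomK].
by exists (cinv i q); [split=> //; exact: cimg_dom|exact: cimgK].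
Qed.

Lemma cinv_near q (O : set X) : cimg i q -> nbhs (cinv i q) O ->
  \forall q' \near q, cimg i q' /\ O (cinv i q').
Proof.
case: gi => _ oi _ _; rewrite continuous_open_subspace // => ci iq nO.
have h1 : \forall q' \near q, cimg i q' by exact: open_nbhs_nbhs.
have h2 : \forall q' \near q, O (cinv i q') by apply: (ci q) => //; rewrite inE.
by move: h1 h2; apply: filter_app2; near=> q'.
Unshelve. all: by end_near. Qed.

Lemma chart_image_open (O : set X) : open O -> open (cmap i @` (O `&` cdom i)).
Proof.
move=> oO; rewrite chart_imageE openE => q [iq Oq].
have nO : nbhs (cinv i q) O by apply: open_nbhs_nbhs; split.
exact: (cinv_near iq nO).
Qed.

Lemma cmap_near x (d : R) : cdom i x -> 0 < d ->
  \forall x' \near x, cdom i x' /\ `|cmap i x' - cmap i x| < d.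
Proof.
case: gi => od _ _; rewrite continuous_open_subspace // => ci _ Dx d0.
have h1 : \forall x' \near x, cdom i x' by exact: open_nbhs_nbhs.
have h2 : \forall x' \near x, `|cmap i x' - cmap i x| < d.
  have /cvgrPdist_lt/(_ d d0) := ci x (mem_set Dx).
  by apply: filterS => x'; rewrite distrC.
by move: h1 h2; apply: filter_app2; near=> x'.
Unshelve. all: by end_near. Qed.

End OneChart.
End GoodCharts.

Section MapCharts.
Context {R : realType} {m n : nat} {M N : topologicalType}.
Variables (A : atlas R m M) (B : atlas R n N).
Hypotheses (gA : forall i : idx A, good_chart i) (gB : forall j : idx B, good_chart j).
Implicit Types (S : set M) (phi : M -> N).

Lemma rep_dom_open S phi i j : open S -> {within S, continuous phi} ->
  open (rep_dom (A := A) (B := B) S phi i j).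
Proof.
move=> oS cphi; have [oj _ _ _ _] := gB j.
rewrite /rep_dom -setIA [cdom i `&` _]setIC setIA; apply: chart_image_open => //.
move: cphi; rewrite continuous_open_subspace // => cphi.
rewrite openE => x [Sx jx]; have h1 : \forall y \near x, S y by exact: open_nbhs_nbhs.
have h2 : \forall y \near x, cdom j (phi y).
  by apply: (cphi x (mem_set Sx)); exact: open_nbhs_nbhs.
by rewrite /interior /=; move: h1 h2; apply: filter_app2; near=> y.
Unshelve. all: by end_near. Qed.

Lemma rep_dom_sub S phi i j q : rep_dom (A := A) (B := B) S phi i j q ->
  [/\ cimg i q, S (cinv i q), cdom i (cinv i q) & cdom j (phi (cinv i q))].
Proof. by move=> [x [[Sx ix] jx] <-]; rewrite (cdomK (gA i) ix); split=> //; exists x. Qed.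

Lemma rep_domP S phi i j q : cimg i q -> S (cinv i q) -> cdom j (phi (cinv i q)) ->
  rep_dom (A := A) (B := B) S phi i j q.
Proof.
move=> iq Sq jq; exists (cinv i q); last exact: cimgK.
by split=> //; split=> //; exact: cimg_dom.
Qed.

(** The asymptotic cone is given on closed annuli, the conclusion on open ones, and the limit is
    built on the whole cone minus its vertex. At points of an open [S] the Jacobians relative to
    these sets are the same. *)
Lemma jac_sub S S' phi i j q : open S -> S `<=` S' -> cimg i q -> S (cinv i q) ->
  cdom j (phi (cinv i q)) ->
  jac (A := A) (B := B) S phi i j q = jac S' phi i j q.
Proof.
move=> oS SS' iq Sq jq.
apply: (Jm_local (chart_image_open (gA i) oS)) => //.
- by exists (cinv i q); [split=> //; exact: cimg_dom|exact: cimgK].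
- exact: rep_domP.
- move=> _ [x [Sx ix] <-]; split=> /rep_dom_sub[? ? ? ?]; apply: rep_domP => //.
    exact: SS'.
  by rewrite (cdomK (gA i)).
Qed.

Lemma pullback_sub S S' phi (g : metric B) i q : open S -> S `<=` S' -> cimg i q ->
  S (cinv i q) -> pullback (A := A) S phi g i q = pullback S' phi g i q.
Proof.
move=> oS SS' iq Sq; congr (xget 0 _); apply/seteqP.
by split=> Q [j jq QE]; exists j => //=; rewrite ?(jac_sub oS SS') // -?(jac_sub oS SS').
Qed.

Lemma smooth_map_sub S S' phi : open S -> S `<=` S' ->
  smooth_map A B S' phi -> smooth_map A B S phi.
Proof.
move=> oS SS' [cphi sphi]; split; first exact: continuous_subspaceW SS' cphi.
move=> i j l; have oO := chart_image_open (gA i) oS.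
have E : rep_dom (A := A) (B := B) S phi i j =
    rep_dom S' phi i j `&` cmap i @` (S `&` cdom i).
  apply/seteqP; split=> q.
    move=> /rep_dom_sub[iq Sq dq jq]; split; first by apply: rep_domP => //; exact: SS'.
    by exists (cinv i q) => //; exact: cimgK.
  move=> [/rep_dom_sub[iq _ dq jq] [x [Sx ix] xq]]; apply: rep_domP => //.
  by rewrite -xq (cdomK (gA i)).
rewrite E => s p [Dp Op]; have [L [cL hL]] := sphi i j l s p Dp.
exists L; split=> // e e0; have := hL e e0; rewrite !near_withinE.
have H q : rep_dom (A := A) (B := B) S' phi i j q -> (cmap i @` (S `&` cdom i)) q ->
  derivs_within (rep_dom (A := A) (B := B) S' phi i j `&` cmap i @` (S `&` cdom i)) s
    (fun q => rep phi i j q 0 l) q =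
  derivs_within (rep_dom S' phi i j) s (fun q => rep phi i j q 0 l) q.
  by move=> Dq Oq; apply: (derivs_within_congr s oO) => // q' Oq'; split=> [[]|].
by apply: filterS => q hq [Dq Oq]; rewrite !H //; exact: hq.
Qed.

Lemma embedding_sub S S' phi : open S -> S `<=` S' ->
  smooth_embedding A B S' phi -> smooth_embedding A B S phi.
Proof.
move=> oS SS' [sp rf inj ho]; split.
- exact: smooth_map_sub sp.
- move=> i j x Sx ix jx; rewrite (jac_sub oS SS') ?(cdomK (gA i)) //.
    by apply: rf => //; exact: SS'.
  by exists x.
- by move=> x y /SS' Sx /SS' Sy; exact: inj.
- move=> U oU; have [Q oQ OE] := ho (U `&` S) (openI oU oS); exists Q => //.
  have US : U `&` S `&` S' = U `&` S.
    by apply/seteqP; split=> [x []|x [Ux Sx]] //; split=> //; exact: SS'.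
  rewrite US in OE; rewrite OE; apply/seteqP; split=> y [Qy].
    move=> Sy; split=> //.
    have : (phi @` (U `&` S)) y by rewrite OE; split.
    by move=> [x [Ux Sx] <-]; exists x.
  move=> [x Sx xy]; split=> //; rewrite -xy; exists x => //; exact: SS'.
Qed.

End MapCharts.

(** * Locality of curvature *)

Section GeoLocal.
Context {R : realType} {V : normedModType R} {N : nat}.
Variables (D1 D2 O : set V) (e : 'I_N -> V) (G1 G2 : V -> 'M[R]_N).
Hypotheses (oO : open O) (DD : forall x, O x -> (D1 x <-> D2 x)).
Hypothesis GG : forall x, O x -> D1 x -> G1 x = G2 x.

Lemma gpd_local i f g x : (forall y, O y -> D1 y -> f y = g y) -> O x -> D1 x ->
  gpd D1 e i f x = gpd D2 e i g x.
Proof. by move=> fg Ox Dx; exact: (derivs_within_congr [:: _] oO DD). Qed.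

Lemma gchr_local k i j x : O x -> D1 x -> gchr D1 e G1 k i j x = gchr D2 e G2 k i j x.
Proof.
move=> Ox Dx; rewrite /gchr GG //; congr (_ * _); apply: eq_bigr => l _; congr (_ * _).
by congr (_ + _ - _); apply: gpd_local => // y Oy Dy; rewrite GG.
Qed.

Lemma griem_local l i j k x : O x -> D1 x ->
  griem D1 e G1 l i j k x = griem D2 e G2 l i j k x.
Proof.
move=> Ox Dx; congr (_ - _ + _).
- by apply: gpd_local => // y Oy Dy; rewrite gchr_local.
- by apply: gpd_local => // y Oy Dy; rewrite gchr_local.
- by apply: eq_bigr => m _; rewrite !gchr_local.
Qed.

Lemma gricci_local j k x : O x -> D1 x -> gricci D1 e G1 j k x = gricci D2 e G2 j k x.
Proof. by move=> Ox Dx; apply: eq_bigr => i _; rewrite griem_local. Qed.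

Lemma nablaRm_local k I x : O x -> D1 x ->
  iter k (gnabla D1 e G1) (gRm D1 e G1) I x = iter k (gnabla D2 e G2) (gRm D2 e G2) I x.
Proof.
elim: k I x => [|k IH] I x Ox Dx.
  case: I => [|a [|b [|c [|d [|? ?]]]]] //=.
  by apply: eq_bigr => m _; rewrite griem_local // GG.
rewrite !iterS; case: I => [|i I] //; rewrite /gnabla; congr (_ - _).
  by apply: gpd_local => // y Oy Dy; rewrite IH.
by apply: eq_bigr => p _; apply: eq_bigr => m _; rewrite gchr_local // IH.
Qed.

End GeoLocal.

Lemma spd_congr (R : realType) (N : nat) (G J : 'M[R]_N) (c : R) : 0 < c ->
  J \in unitmx -> spd G -> spd (c *: (J *m G *m J^T)).
Proof.
move=> c0 uJ [sG pG]; split; first by rewrite linearZ /= !trmx_mul trmxK sG mulmxA.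
move=> v v0; rewrite -scalemxAr -scalemxAl mxE mulr_gt0 //.
have -> : v *m (J *m G *m J^T) *m v^T = (v *m J) *m G *m (v *m J)^T.
  by rewrite trmx_mul !mulmxA.
apply: pG; apply: contraNN v0 => /eqP h.
by rewrite -(mulmxK uJ v) h mul0mx.
Qed.

(** * Parabolically rescaled pullback in one pair of charts *)

Section LocalPull.
Context {R : realType} {N : nat}.
Notation V := ('rV[R]_N * R)%type.
Variables (D : set V) (O U : set 'rV[R]_N) (f : 'rV[R]_N -> 'rV[R]_N).
Variables (G H : V -> 'M[R]_N) (sg : R).
Let D' : set V := [set p | U p.1 /\ 0 <= p.2].
Let J (x : V) := Jm O f x.1.
(** Parabolic rescaling: the metric is multiplied by [sg^2] and time by the same factor, so time [t]
    of [H] is time [sg^-2 * t] of [G]. *)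
Let psi (x : V) : V := (f x.1, sg ^- 2 * x.2).
Hypotheses (uD : upper_st D) (oO : open O) (oU : open U) (sg0 : 0 < sg).
Hypotheses (DO : forall x, D x -> O x.1 /\ 0 <= x.2).
Hypotheses (fU : forall q, O q -> U (f q)).
Hypothesis (sf : forall l, smooth_on O (fun q => f q 0 l)).
Hypothesis (uJ : forall q, O q -> Jm O f q \in unitmx).
Hypotheses (sG : smoothmx D' G) (pG : forall x, D' x -> spd (G x)).
Hypothesis flowG : forall x k l, D' x ->
  deriv_within D' (0, 1) (fun y => G y k l) x = - 2 * gricci D' est G k l x.
Hypothesis HE : forall x, D x -> H x = sg ^+ 2 *: (J x *m G (psi x) *m (J x)^T).

Let tD := upper_st_thick uD.
Let uD' : upper_st D' := halfspace_upper oU.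
Let tD' := upper_st_thick uD'.
Let tO := upper_rV_thick (open_upper_rV oO).
Let sgn0 : sg != 0. Proof. by rewrite gt_eqF. Qed.
Let DD' x : D x -> D' (psi x).
Proof.
move=> Dx; have [Ox x0] := DO Dx; split=> /=; first exact: fU.
by rewrite mulr_ge0 // invr_ge0 exprn_ge0 // ltW.
Qed.

Let fst_smooth (k : cI (coords_rV N)) : smooth_on D (fun x => cc k x.1).
Proof. exact: (smooth_cc tD (Some k)). Qed.

Lemma smooth_fst g : smooth_on O g -> smooth_on D (fun x => g x.1).
Proof.
move=> sg'; apply: (smooth_comp tD tO (psi := fst)) sg' => // x Dx.
exact: (DO Dx).1.
Qed.

Lemma deriv_fst g v s x : smooth_on O g -> D x ->
  deriv_within D (v, s) (fun x => g x.1) x = deriv_within O v g x.1.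
Proof.
move=> sg' Dx; have Ox := (DO Dx).1.
rewrite (deriv_within_comp tD tO (psi := fst) _ _ _ (smooth_diff sg') Dx) //.
- rewrite (deriv_within_lform tO v (smooth_diff sg') Ox); apply: eq_bigr => k _.
  by congr (_ * _); exact: (deriv_within_cc tD (Some k) (v, s) Dx).
- by move=> y Dy; exact: (DO Dy).1.
- by move=> k; apply: smooth_diff; exact: fst_smooth.
Qed.

Let sJ : smoothmx D J.
Proof.
move=> i j; rewrite /J /Jm; under eq_fun do rewrite mxE.
apply: (smooth_fst (g := fun q => deriv_within O (delta_mx 0 i) (fun q' => f q' 0 j) q)).
exact: smooth_deriv.
Qed.

Let psi_smooth (k : cI (coords_st N)) : smooth_on D (fun x => cc k (psi x)).
Proof.
case: k => [k|] /=; first exact: (smooth_fst (sf k)).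
by apply: (smoothM tD); [exact: (smooth_cst tD)|exact: (smooth_cc tD None)].
Qed.

Let spsi g : smooth_on D' g -> smooth_on D (fun y => g (psi y)).
Proof. by move=> sg'; apply: (smooth_comp tD tD') sg'. Qed.

Let dpsi_some v s k x : D x ->
  deriv_within D (v, s) (fun x => cc (Some k : cI (coords_st N)) (psi x)) x =
  deriv_within O v (fun q => f q 0 k) x.1.
Proof. by move=> Dx; exact: (deriv_fst _ _ (sf k) Dx). Qed.

Let dpsi_none v s x : D x ->
  deriv_within D (v, s) (fun x => cc (None : cI (coords_st N)) (psi x)) x = sg ^- 2 * s.
Proof.
move=> Dx; rewrite (deriv_withinZ tD) //; last exact/smooth_diff/(smooth_cc tD None).
by rewrite (deriv_within_cc tD None (v, s) Dx).
Qed.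

Let sum_opt (F : option 'I_N -> R) : \sum_(k : option 'I_N) F k = F None + \sum_k F (Some k).
Proof.
rewrite (bigD1 None) //= (@reindex_omap _ _ _ _ _ Some id) /=; last by case.
by congr (_ + _); apply: eq_bigl => k; rewrite eqxx.
Qed.

Let chain g i x : smooth_on D' g -> D x ->
  gpd D est i (fun y => g (psi y)) x = \sum_a J x i a * gpd D' est a g (psi x).
Proof.
move=> sg' Dx; rewrite /gpd (deriv_within_comp tD tD' _ DD' _ (smooth_diff sg') Dx); last first.
  by move=> k; exact: smooth_diff.
rewrite sum_opt dpsi_none // mulr0 mul0r add0r; apply: eq_bigr => a _.
by rewrite dpsi_some // mxE.
Qed.

Let schw g i j x : smooth_on D g -> D x ->
  gpd D est i (gpd D est j g) x = gpd D est j (gpd D est i g) x.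
Proof.
move=> sg' Dx.
exact: (@corner_schwarz _ _ (coords_st N) D g x (Some j) (Some i) (upper_st_corner uD)).
Qed.

Let symJ i j a x : D x ->
  gpd D est i (fun y => J y j a) x = gpd D est j (fun y => J y i a) x.
Proof.
move=> Dx; have E k l : gpd D est k (fun y => J y l a) x =
    deriv_within O (delta_mx 0 k) (deriv_within O (delta_mx 0 l) (fun q => f q 0 a)) x.1.
  rewrite /gpd (@eq_deriv_within _ _ D _ (fun y => deriv_within O (delta_mx 0 l)
     (fun q => f q 0 a) y.1)) //; last by move=> y _; rewrite mxE.
  by apply: deriv_fst => //; exact: smooth_deriv.
rewrite !E; exact: (@corner_schwarz _ _ (coords_rV N) O _ _ j i
  (upper_rV_corner (open_upper_rV oO)) (sf a) (DO Dx).1).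
Qed.

Let uJD x : D x -> J x \in unitmx. Proof. by move=> Dx; exact/uJ/(DO Dx).1. Qed.
Let symG x : D' x -> (G x)^T = G x. Proof. by move=> /pG[]. Qed.
Let uG x : D' x -> G x \in unitmx. Proof. by move=> /pG/spd_unit. Qed.
Let c0 : sg ^+ 2 != 0. Proof. by rewrite expf_neq0. Qed.

Lemma pull_smooth : smoothmx D H.
Proof. exact: (natural_smooth tD spsi sJ sG HE). Qed.

Lemma pull_spd x : D x -> spd (H x).
Proof.
move=> Dx; rewrite HE //; apply: spd_congr; [by rewrite exprn_gt0|exact: uJD|].
exact/pG/DD'.
Qed.

(** The Jacobian does not depend on time, the factor [sg^2] of the metric cancels the [sg^-2] from
    the change of time, and Ricci is natural and scale invariant. *)
Lemma pull_flow x k l : D x ->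
  deriv_within D (0, 1) (fun y => H y k l) x = - 2 * gricci D est H k l x.
Proof.
move=> Dx; rewrite (natural_ricci tD tD' c0 DD' chain schw spsi sJ uJD symJ sG symG uG HE) //.
have sGp : smoothmx D (fun y => G (psi y)) by move=> a b; exact: spsi (sG a b).
have dJ : dmx D (0, 1) J x = 0.
  apply/matrixP => a b; rewrite !mxE.
  rewrite (@eq_deriv_within _ _ D _ (fun y => deriv_within O (delta_mx 0 a)
     (fun q => f q 0 b) y.1)) //; last by move=> y _; rewrite mxE.
  rewrite deriv_fst //; last exact: smooth_deriv.
  rewrite (deriv_within_lform tO) //; [|exact/smooth_diff/smooth_deriv|exact: (DO Dx).1].
  by rewrite big1 // => c _; rewrite /= mxE mul0r.
have dG : dmx D (0, 1) (fun y => G (psi y)) x =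
    sg ^- 2 *: (- 2 *: \matrix_(b, d) gricci D' est G b d (psi x)).
  apply/matrixP => a b; rewrite !mxE.
  rewrite (deriv_within_comp tD tD' (psi := psi) _ DD' _ (smooth_diff (sG a b)) Dx); last first.
    by move=> k'; exact: smooth_diff.
  rewrite sum_opt dpsi_none // mulr1 big1 ?addr0.
    by congr (_ * _); exact: flowG (DD' Dx).
  move=> k' _; rewrite dpsi_some //.
  rewrite (deriv_within_lform tO) //; [|exact/smooth_diff/sf|exact: (DO Dx).1].
  by rewrite big1 ?mul0r // => c _; rewrite /= mxE mul0r.
have -> : deriv_within D (0, 1) (fun y => H y k l) x = dmx D (0, 1) H x k l by rewrite mxE.
rewrite (eq_dmx _ HE Dx) (dmxZ tD) //; last first.
  apply: (smooth_mulmx tD); last exact: smooth_trmx.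
  exact: (smooth_mulmx tD).
rewrite (dmxM tD) //; [|exact: (smooth_mulmx tD)|exact: smooth_trmx].
rewrite (dmxM tD) // dmx_tr dJ dG trmx0 mul0mx mulmx0 add0r addr0.
rewrite -!scalemxAr -!scalemxAl !scalerA mulfV // mul1r mxE.
by [].
Qed.

(** The frame is transported by the inverse Jacobian and divided by [sg]. The [4 + k] slots
    contribute [sg^-(4 + k)] and the lowered index of [Rm] contributes [sg^2]. *)
Lemma pull_frames x (P' : 'M[R]_N) : D x -> invmx (G (psi x)) = P' *m P'^T ->
  exists2 P : 'M[R]_N, invmx (H x) = P *m P^T & forall k K, size K = (4 + k)%N ->
    pull P^T K ((iter k (gnabla D est H) (gRm D est H))^~ x) =
    sg ^- (2 + k) *
    pull P'^T K ((iter k (gnabla D' est G) (gRm D' est G))^~ (psi x)).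
Proof.
move=> Dx GP; have ux := uJD Dx; have D'x := DD' Dx.
exists (sg^-1 *: ((invmx (J x))^T *m P')).
  rewrite linearZ /= -scalemxAr -scalemxAl scalerA -invfM -expr2 trmx_mul trmxK.
  have uH := natural_unit c0 DD' uJD uG HE Dx.
  have HM : H x *m (sg ^- 2 *: ((invmx (J x))^T *m P' *m (P'^T *m invmx (J x)))) = 1%:M.
    rewrite HE // -scalemxAl -scalemxAr scalerA mulfV // scale1r.
    have -> : (invmx (J x))^T *m P' *m (P'^T *m invmx (J x)) =
      (invmx (J x))^T *m invmx (G (psi x)) *m invmx (J x) by rewrite GP !mulmxA.
    rewrite !mulmxA -[X in X *m invmx (G _)]mulmxA -trmx_mul mulVmx // trmx1 mulmx1.
    by rewrite mulmxK ?uG // mulmxV.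
  by rewrite -[RHS]mul1mx -(mulVmx uH) -mulmxA HM mulmx1.
move=> k K sK.
rewrite (@eq_pull R N _ K _ (fun L => sg ^+ 2 * pull (J x) L
   (fun L => iter k (gnabla D' est G) (gRm D' est G) L (psi x)))); last first.
  move=> L _.
  exact: (natural_nablaRm tD tD' c0 DD' chain schw spsi sJ uJD symJ sG symG uG HE).
rewrite pullZ pull_comp linearZ /= -scalemxAl pull_scale trmx_mul trmxK -mulmxA mulVmx //.
rewrite mulmx1 mulrA sK; congr (_ * _).
by rewrite -[(4 + k)%N]/(2 + (2 + k))%N exprD mulrA -exprMn mulfV // expr1n mul1r exprVn.
Qed.

End LocalPull.

(** * Change of charts for pullbacks *)

Section PullbackCharts.
Context {R : realType} {N : nat} {M X : topologicalType}.
Variables (A : atlas R N M) (B : atlas R N X).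
Hypotheses (gA : forall i : idx A, good_chart i) (gB : forall j : idx B, good_chart j).
Variables (S : set M) (phi : M -> X).
Hypotheses (oS : open S) (sphi : smooth_map A B S phi).

Lemma jac_target (i : idx A) (j j' : idx B) q : smooth_map B B setT id -> cimg i q -> S (cinv i q) ->
  cdom j (phi (cinv i q)) -> cdom j' (phi (cinv i q)) ->
  jac (A := A) S phi i j' q =
  jac S phi i j q *m jac (A := B) setT id j j' (cmap j (phi (cinv i q))).
Proof.
move=> [ctB tB] iq Sq jq j'q; have [cphi sp] := sphi.
apply: (@Jm_comp _ _ _ _ (rep_dom S phi i j) _ (rep_dom setT id j j') (rep phi i j)).
- exact: rep_dom_open.
- by apply: rep_dom_open => //; exact: openT.
- exact: rep_dom_open.
- exact: rep_domP.
- exact: rep_domP.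
- exact: sp.
- exact: tB.
move=> q' /(rep_dom_sub gA)[iq' Sq' dq' jq'] /(rep_dom_sub gA)[_ _ _ j'q'].
split; last by rewrite /rep /= (cdomK (gB j)).
by apply: (rep_domP gB) => //=; rewrite ?(cdomK (gB j)) //; exists (phi (cinv i q')).
Qed.

Lemma pullbackE (g : metric B) (i : idx A) (j : idx B) q : smooth_map B B setT id ->
  cimg i q -> S (cinv i q) -> metric_at g (phi (cinv i q)) -> cdom j (phi (cinv i q)) ->
  pullback (A := A) S phi g i q =
  jac S phi i j q *m g j (rep phi i j q) *m (jac S phi i j q)^T.
Proof.
move=> tB iq Sq mg jq; rewrite /pullback; case: xgetP => [Q _ [j0 j0q /= ->]|nP]; last first.
  by exfalso; apply: (nP (jac S phi i j q *m g j (rep phi i j q) *m (jac S phi i j q)^T)); exists j.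
have [_ _ /(_ j0 j0q) /= gE] := mg j jq.
rewrite [g j _]gE (jac_target tB iq Sq jq j0q) !trmx_mul !mulmxA; congr (_ *m _).
Qed.

Lemma jac_source (i i' : idx A) (j : idx B) q : smooth_map A A setT id -> cimg i q -> S (cinv i q) ->
  cdom i' (cinv i q) -> cdom j (phi (cinv i q)) ->
  jac (A := A) S phi i j q =
  jac (A := A) setT id i i' q *m jac S phi i' j (cmap i' (cinv i q)).
Proof.
move=> [ctA tA] iq Sq i'q jq; have [cphi sp] := sphi.
apply: (@Jm_comp _ _ _ _ (rep_dom setT id i i') _ (rep_dom S phi i' j) (rep id i i')).
- by apply: rep_dom_open => //; exact: openT.
- exact: rep_dom_open.
- exact: rep_dom_open.
- exact: rep_domP.
- exact: rep_domP.
- exact: tA.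
- exact: sp.
move=> q' /(rep_dom_sub gA)[iq' _ dq' i'q'] /(rep_dom_sub gA)[_ Sq' _ jq'].
split; last by rewrite /rep /= (cdomK (gA i')).
by apply: (rep_domP gA) => //=; rewrite ?(cdomK (gA i')) //; exists (cinv i q').
Qed.

Lemma pullback_source (g : metric B) (i i' : idx A) q : smooth_map A A setT id ->
  smooth_map B B setT id -> (forall x : X, exists j : idx B, cdom j x) ->
  cimg i q -> S (cinv i q) -> metric_at g (phi (cinv i q)) -> cdom i' (cinv i q) ->
  let J := jac (A := A) setT id i i' q in
  pullback S phi g i q = J *m pullback S phi g i' (cmap i' (cinv i q)) *m J^T.
Proof.
move=> tA tB cB iq Sq mg i'q J; have [j jq] := cB (phi (cinv i q)).
have K := cdomK (gA i') i'q.
rewrite (pullbackE tB iq Sq mg jq) (pullbackE (j := j) tB) ?K //; last first.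
  by exists (cinv i q).
rewrite /rep K (jac_source tA iq Sq i'q jq) !trmx_mul !mulmxA.
by [].
Qed.

End PullbackCharts.

Lemma upper_st_open (R : realType) (N : nat) (D : set ('rV[R]_N * R)) (O : set 'rV[R]_N) :
  upper_st D -> open O -> upper_st (D `&` [set p | O p.1]).
Proof.
move=> uD oO q t [Dq /= Oq]; have [d [s [d0 s1 hd]]] := uD q t Dq.
have [d' d'0 hd'] := open_upper_rV oO Oq.
exists (Num.min d d'), s; rewrite lt_min d0 d'0; split=> // q' t'.
rewrite le_min => /andP[qd qd'] qk; rewrite le_min => /andP[td _] st.
by split; [exact: hd|exact: hd'].
Qed.

(** * The rescaled pullback of a flow by an embedding *)

Section PullbackFlow.
Context {R : realType} {N : nat} {M X : topologicalType}.
Variables (A : atlas R N M) (B : atlas R N X).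
Hypotheses (gA : forall i : idx A, good_chart i) (gB : forall j : idx B, good_chart j).
Hypotheses (tB : smooth_map B B setT id) (cB : forall x : X, exists j : idx B, cdom j x).
Variables (g : R -> metric B).
Hypothesis flow : ricci_flow [set p : X * R | 0 <= p.2] g.
Variables (S : set M) (phi : M -> X).
Hypotheses (oS : open S) (emb : smooth_embedding A B S phi).
Variables (i : idx A) (D : set ('rV[R]_N * R)) (sg : R).
Hypotheses (uD : upper_st D) (sg0 : 0 < sg).
Hypothesis DU : forall x, D x -> [/\ cimg i x.1, S (cinv i x.1) & 0 <= x.2].

(** With [sg = r^-1] this is the blow-down of the statement: the pullback of [gX] at time [r^2 * t],
    divided by [r^2]. *)
Definition pflow (x : 'rV[R]_N * R) : 'M[R]_N :=
  sg ^+ 2 *: pullback S phi (g (sg ^- 2 * x.2)) i x.1.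

Let tgt (j : idx B) : set ('rV[R]_N * R) := [set p | cimg j p.1 /\ 0 <= p.2].
Let Gj (j : idx B) (p : 'rV[R]_N * R) : 'M[R]_N := g p.2 j p.1.

Let spacetimeE (j : idx B) :
  spacetime_chart (A := B) [set p : X * R | 0 <= p.2] j = tgt j.
Proof.
apply/seteqP; split=> [_ [[x t] [/= t0 jx] <-]|[q t] [/= [x jx xq] t0]].
  by split=> //=; exists x.
by exists (x, t) => //=; rewrite xq.
Qed.

Let sliceE (j : idx B) t : 0 <= t -> [set q | tgt j (q, t)] = cimg j.
Proof. by move=> t0; apply/seteqP; split=> q; [case|split]. Qed.

Let utgt j : upper_st (tgt j).
Proof. by apply: halfspace_upper; case: (gB j). Qed.

Let sGj j : smoothmx (tgt j) (Gj j).
Proof. by move=> k l; rewrite -spacetimeE; have [_ h _] := flow; exact: h. Qed.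

Let pGj j p : tgt j p -> spd (Gj j p).
Proof.
case: p => q t [/= [x jx <-] t0]; have [h _ _] := flow.
by have [? ? _] := h x t t0 j jx.
Qed.

Let flowGj j p k l : tgt j p ->
  deriv_within (tgt j) (0, 1) (fun y => Gj j y k l) p = - 2 * gricci (tgt j) est (Gj j) k l p.
Proof.
case: p => q t Dp; have [_ _ h] := flow; have := h j q t k l.
rewrite spacetimeE => /(_ Dp) ->; congr (_ * _).
have uG x : tgt j x -> Gj j x \in unitmx by move=> Dx; exact/spd_unit/pGj.
exact: (ricci_slice (@utgt j) (@sGj j) uG k l Dp).
Qed.

Let metric_g x t : 0 <= t -> metric_at (g t) x.
Proof. by move=> t0; have [h _ _] := flow; exact: h. Qed.

Let cphi : {within S, continuous phi}. Proof. by case: emb => -[]. Qed.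

Section Local.
Variable (j : idx B).
Let O := rep_dom (A := A) (B := B) S phi i j.
Let DO := D `&` [set p | O p.1].

Let oO : open O. Proof. exact: rep_dom_open. Qed.
Let uDO : upper_st DO. Proof. exact: upper_st_open. Qed.
Let DOO x : DO x -> O x.1 /\ 0 <= x.2.
Proof. by move=> [Dx Ox]; split=> //; have [] := DU Dx. Qed.
Let fU q : O q -> cimg j (rep phi i j q).
Proof. by move=> /(rep_dom_sub gA)[_ _ _ jq]; exists (phi (cinv i q)). Qed.
Let sfO l : smooth_on O (fun q => rep phi i j q 0 l).
Proof. by case: emb => -[_ h] _ _ _; exact: h. Qed.
Let uJO q : O q -> Jm O (rep phi i j) q \in unitmx.
Proof.
move=> /(rep_dom_sub gA)[iq Sq dq jq]; rewrite -row_free_unit.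
by have [_ h _ _] := emb; have := h i j _ Sq dq jq; rewrite (cimgK (gA i)).
Qed.
Let HEO x : DO x -> pflow x = sg ^+ 2 *: (Jm O (rep phi i j) x.1 *m
  Gj j (rep phi i j x.1, sg ^- 2 * x.2) *m (Jm O (rep phi i j) x.1)^T).
Proof.
move=> [Dx /(rep_dom_sub gA)[iq Sq dq jq]]; have [_ _ x0] := DU Dx.
rewrite /pflow (pullbackE gA gB oS _ tB iq Sq _ jq) //; first by case: emb.
by apply: metric_g; rewrite mulr_ge0 // invr_ge0 exprn_ge0 // ltW.
Qed.

Lemma pflow_smooth_loc : smoothmx DO pflow.
Proof. by have [_ oj _ _ _] := gB j; exact: (pull_smooth uDO oO oj sg0 DOO fU sfO (@sGj j) HEO). Qed.

Lemma pflow_spd_loc x : DO x -> spd (pflow x).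
Proof. exact: (pull_spd sg0 DOO fU uJO (@pGj j) HEO). Qed.

Let oW : open [set p : 'rV[R]_N * R | O p.1].
Proof. by apply: open_comp => // p _; exact: cvg_fst. Qed.

Let DW x : [set p : 'rV[R]_N * R | O p.1] x -> (DO x <-> D x).
Proof. by move=> Ox; split=> [[]|]. Qed.

Lemma pflow_flow_loc x k l : DO x ->
  deriv_within D (0, 1) (fun y => pflow y k l) x = - 2 * gricci D est pflow k l x.
Proof.
move=> DOx; have [Dx Ox] := DOx; have [_ oj _ _ _] := gB j.
have := pull_flow uDO oO oj sg0 DOO fU sfO uJO (@sGj j) (@pGj j) (@flowGj j) HEO k l DOx.
rewrite (gricci_local est oW DW (G2 := pflow)) // => <-.
by apply: (derivs_within_congr [:: _] oW) => // y Oy; split=> [|[]].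
Qed.

(** A Cholesky factor of the target metric provides an orthonormal frame, in which the norm bounds
    every component; the frame and the bound are then carried back by [pull_frames]. *)
Lemma pflow_frames_loc x k (C : R) : DO x ->
  nablaRm_le (g (sg ^- 2 * x.2)) k (phi (cinv i x.1)) C ->
  exists2 P : 'M[R]_N, invmx (pflow x) = P *m P^T & forall K, size K = (4 + k)%N ->
    `|pull P^T K ((iter k (gnabla D est pflow) (gRm D est pflow))^~ x)| <= sg ^- (2 + k) * C.
Proof.
move=> DOx nC; have [Dx Ox] := DOx; have [_ oj _ _ _] := gB j; have [_ _ x0] := DU Dx.
have [_ _ _ jq] := rep_dom_sub gA Ox.
pose y := (rep phi i j x.1, sg ^- 2 * x.2) : 'rV[R]_N * R.
have t0 : 0 <= sg ^- 2 * x.2 by rewrite mulr_ge0 // invr_ge0 exprn_ge0 // ltW.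
have Dy : tgt j y by split=> //=; exact: fU.
have [L uL GL] := cholesky (pGj Dy).
have GP : invmx (Gj j y) = (invmx L)^T *m ((invmx L)^T)^T.
  rewrite trmxK; have uG := spd_unit (pGj Dy).
  have : Gj j y *m ((invmx L)^T *m invmx L) = 1%:M.
    by rewrite GL -mulmxA [L^T *m _]mulmxA -trmx_mul mulVmx // trmx1 mul1mx mulmxV.
  by move=> h; rewrite -[RHS]mul1mx -(mulVmx uG) -mulmxA h mulmx1.
have [P HP PE] := pull_frames uDO oO oj sg0 DOO fU sfO uJO (@sGj j) (@pGj j) HEO DOx GP.
exists P => // K sK.
have -> : pull P^T K ((iter k (gnabla D est pflow) (gRm D est pflow))^~ x) =
    pull P^T K ((iter k (gnabla DO est pflow) (gRm DO est pflow))^~ x).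
  by apply: eq_pull => L' _; rewrite (nablaRm_local est oW DW (G2 := pflow)).
rewrite PE // normrM ger0_norm; last by rewrite invr_ge0 exprn_ge0 // ltW.
rewrite ler_wpM2l ?invr_ge0 ?exprn_ge0 ?(ltW sg0) //.
have := nC j jq; rewrite /nablaRm_norm -/(rep phi i j x.1) => le_C; apply: le_trans le_C.
rewrite -/(cimg j) -(sliceE j t0).
apply: le_trans (frame_le (G := fun q => Gj j (q, sg ^- 2 * x.2)) _ GP sK).
rewrite le_eqVlt; apply/orP; left; apply/eqP; congr (`| _ |); apply: eq_pull => I _.
rewrite (nablaRm_slice (@utgt j) (@sGj j)) ?(sliceE j t0) //; last first.
  by move=> z Dz; exact/spd_unit/pGj.
Qed.

End Local.

Let loc x : D x -> exists j : idx B, rep_dom (A := A) S phi i j x.1.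
Proof.
move=> Dx; have [iq Sq _] := DU Dx; have [j jq] := cB (phi (cinv i x.1)).
by exists j; exact: rep_domP.
Qed.

Lemma pflow_smooth : smoothmx D pflow.
Proof.
move=> k l; apply: smooth_local => x Dx; have [j Ox] := loc Dx.
exists [set p : 'rV[R]_N * R | rep_dom (A := A) S phi i j p.1]; split=> //; last first.
  exact: (@pflow_smooth_loc j k l).
by apply: open_comp => [p _|]; [exact: cvg_fst|exact: rep_dom_open].
Qed.

Lemma pflow_spd x : D x -> spd (pflow x).
Proof. by move=> Dx; have [j Ox] := loc Dx; exact: (pflow_spd_loc (conj Dx Ox)). Qed.

Lemma pflow_flow x k l : D x ->
  deriv_within D (0, 1) (fun y => pflow y k l) x = - 2 * gricci D est pflow k l x.
Proof. by move=> Dx; have [j Ox] := loc Dx; exact: (pflow_flow_loc k l (conj Dx Ox)). Qed.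

Lemma pflow_frames x k (C : R) : D x ->
  nablaRm_le (g (sg ^- 2 * x.2)) k (phi (cinv i x.1)) C ->
  exists2 P : 'M[R]_N, invmx (pflow x) = P *m P^T & forall K, size K = (4 + k)%N ->
    `|pull P^T K ((iter k (gnabla D est pflow) (gRm D est pflow))^~ x)| <= sg ^- (2 + k) * C.
Proof. by move=> Dx; have [j Ox] := loc Dx; exact: (pflow_frames_loc (conj Dx Ox)). Qed.

End PullbackFlow.

Lemma lip1_continuous (R : realType) (V W : normedModType R) (f : V -> W) :
  (forall q q', `|f q' - f q| <= `|q' - q|) -> continuous f.
Proof.
move=> lf q A /nbhs_normP[e /= e0 hA]; apply/nbhs_normP; exists e => //= q' h.
by apply: hA => /=; apply: le_lt_trans (lf _ _) h.
Qed.

(** * The cone and its charts *)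

Section ConeAtlas.
Context {R : realType} {n : nat} {Y : topologicalType} (AY : atlas R n Y).
Hypothesis gY' : forall i : idx AY, good_chart i.
Local Notation CA := (cone_atlas AY).
Local Notation rv := 'rV[R]_(1 + n).

Definition crad (q : rv) : R := q 0 (lshift n ord0).

Lemma cone_cmapE (c : idx CA) (p : R * Y) :
  cmap c p = row_mx (p.1%:M : 'rV[R]_1) (cmap (c : idx AY) p.2) :> rv.
Proof. by []. Qed.

Lemma cone_cinvE (c : idx CA) (q : rv) :
  cinv c q = (crad q, cinv (c : idx AY) (rsubmx q)).
Proof. by rewrite /= /crad mxE. Qed.

Lemma rad_cmap (c : idx CA) p : crad (cmap c p) = p.1.
Proof. by rewrite /crad cone_cmapE row_mxEl mxE eqxx. Qed.

Lemma rsub_cmap (c : idx CA) p : rsubmx (cmap c p : rv) = cmap (c : idx AY) p.2.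
Proof. by rewrite cone_cmapE row_mxKr. Qed.

Lemma row_rad (q : rv) : row_mx ((crad q)%:M : 'rV[R]_1) (rsubmx q) = q.
Proof.
rewrite -[RHS]hsubmxK; congr row_mx; apply/matrixP => i j.
by rewrite !ord1 !mxE eqxx mulr1n.
Qed.

Lemma cone_cimgE (c : idx CA) :
  cimg c = [set q : rv | 0 < crad q /\ cimg (c : idx AY) (rsubmx q)].
Proof.
apply/seteqP; split=> [_ [p [p0 cp] <-]|q [q0 [y cy yq]]].
  by split; [rewrite rad_cmap|rewrite rsub_cmap; exists p.2].
by exists (crad q, y) => //; rewrite cone_cmapE /= yq row_rad.
Qed.

Lemma rsub_dist (q q' : rv) : `|rsubmx q' - rsubmx q| <= `|q' - q|.
Proof.
apply: row_norm_le => // k; have := row_entry_le (q' - q) (rshift 1 k).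
by rewrite !mxE.
Qed.

Lemma rad_dist (q q' : rv) : `|crad q' - crad q| <= `|q' - q|.
Proof. by have := row_entry_le (q' - q) (lshift n ord0); rewrite !mxE. Qed.

Lemma rad_continuous : continuous crad.
Proof. exact: (@lip1_continuous R 'rV[R]_(1 + n) R^o crad rad_dist). Qed.

Lemma rsub_continuous : continuous (rsubmx : rv -> 'rV[R]_n).
Proof. exact: (@lip1_continuous R 'rV[R]_(1 + n) 'rV[R]_n rsubmx rsub_dist). Qed.

Lemma cone_good (c : idx CA) : good_chart c.
Proof.
have [od oi K cm ci] := gY' c.
have ocd : open (cdom (c : idx CA)).
  apply: (@openI _ [set p : R * Y | 0 < p.1] [set p : R * Y | cdom (c : idx AY) p.2]).
    by apply: (@open_comp _ _ (fst : R * Y -> R) [set x | 0 < x]) => [p _|];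
      [exact: cvg_fst|exact: open_gt].
  by apply: (@open_comp _ _ (snd : R * Y -> Y)) => [p _|//]; exact: cvg_snd.
have oci : open (cimg (c : idx CA)).
  rewrite cone_cimgE.
  apply: (@openI _ [set q : rv | 0 < crad q] [set q : rv | cimg (c : idx AY) (rsubmx q)]).
    by apply: (@open_comp _ _ crad [set x | 0 < x]) => [p _|];
      [exact: rad_continuous|exact: open_gt].
  by apply: (@open_comp _ _ (rsubmx : rv -> 'rV[R]_n)) => [p _|//]; exact: rsub_continuous.
split=> //.
- by move=> p [p0 cp]; rewrite cone_cinvE rad_cmap rsub_cmap K //; case: p p0 cp.
- rewrite continuous_open_subspace // => p; rewrite inE => -[p0 cp].
  move=> A /(@nbhs_normP R 'rV[R]_(1 + n))[e /= e0 hA].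
  have h1 : \forall p' \near p, `|p'.1 - p.1| < e.
    have h : \forall r \near p.1, `|r - p.1| < e.
      by apply: filterS (@nbhsx_ballx _ R^o p.1 e e0) => r; rewrite -ball_normE /= distrC.
    exact: (@cvg_fst _ _ (nbhs p.1) (nbhs p.2) _ _ h).
  have h2 : \forall p' \near p, `|cmap (c : idx AY) p'.2 - cmap (c : idx AY) p.2| < e.
    have h : \forall y \near p.2, `|cmap (c : idx AY) y - cmap (c : idx AY) p.2| < e.
      by apply: filterS (cmap_near (gY' c) cp e0) => y [].
    exact: (@cvg_snd _ _ (nbhs p.1) (nbhs p.2) _ _ h).
  rewrite /nbhs /=; move: h1 h2; apply: filter_app2; near=> p' => h1 h2.
  apply: hA; rewrite /= distrC; apply: (@le_lt_trans _ _ (Num.max `|p'.1 - p.1|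
    `|cmap (c : idx AY) p'.2 - cmap (c : idx AY) p.2|)); last by rewrite gt_max h1.
  apply: (@row_norm_le R (1 + n)) => [|k]; first by rewrite le_max normr_ge0.
  rewrite le_max opp_row_mx add_row_mx; case: (split_ordP k) => l ->.
    by rewrite row_mxEl !mxE ord1 eqxx !mulr1n lexx.
  by rewrite row_mxEr row_entry_le orbT.
- rewrite continuous_open_subspace // => q; rewrite inE cone_cimgE => -[q0 cq].
  have ciq : cinv (c : idx AY) q' @[q' --> rsubmx (q : rv)] --> cinv (c : idx AY) (rsubmx (q : rv)).
    by move: ci; rewrite continuous_open_subspace // => ci; apply: ci; rewrite inE.
  have E : cinv c = (fun q' : rv => (crad q', cinv (c : idx AY) (rsubmx q'))) :> (rv -> R * Y).
    by apply/funext => q'; exact: cone_cinvE.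
  rewrite E.
  have h2 := cvg_comp _ _ (@rsub_continuous q) ciq.
  exact: (cvg_pair (@rad_continuous q) h2).
Unshelve. all: by end_near. Qed.

Lemma smooth_rsub (D : set rv) (D' : set 'rV[R]_n) (f : 'rV[R]_n -> R) :
  open D -> open D' -> (forall q, D q -> D' (rsubmx q)) -> smooth_on D' f ->
  smooth_on D (fun q => f (rsubmx q)).
Proof.
move=> oD oD' DD' sf; have tD := upper_rV_thick (open_upper_rV oD).
apply: (smooth_comp tD (upper_rV_thick (open_upper_rV oD')) DD') sf => k /=.
by under eq_fun do rewrite mxE; exact: (smooth_cc tD (rshift 1 k)).
Qed.

Lemma smooth_rad (D : set rv) : open D -> smooth_on D crad.
Proof.
by move=> oD; exact: (smooth_cc (upper_rV_thick (open_upper_rV oD)) (lshift n ord0)).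
Qed.

(** A change of charts on the cone keeps the radius and acts on the remaining coordinates as on
    [Y]. *)
Lemma cone_trans : smooth_map AY AY setT id -> smooth_map CA CA setT id.
Proof.
move=> [cid' tY]; have cidC : {within setT, continuous (id : R * Y -> R * Y)}.
  by apply: continuous_subspaceT => x; exact: cvg_id.
split=> // c c' l.
have oD : open (rep_dom (A := CA) (B := CA) setT id c c').
  by apply: (rep_dom_open cone_good cone_good) => //; exact: openT.
have oD' : open (rep_dom (A := AY) (B := AY) setT id c c').
  by apply: (rep_dom_open gY' gY') => //; exact: openT.
case: (split_ordP (l : 'I_(1 + n))) => k ->.
  apply: (@eq_smooth _ _ _ crad); last exact: smooth_rad.
  move=> q _; rewrite /rep cone_cmapE [RHS](row_mxEl ((cinv c q).1%:M : 'rV[R]_1)).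
  by rewrite cone_cinvE !ord1 mxE eqxx.
apply: (@eq_smooth _ _ _ (fun q : rv => rep (A := AY) (B := AY) id c c' (rsubmx q) 0 k)).
  move=> q _; rewrite /rep cone_cmapE [RHS](row_mxEr ((cinv c q).1%:M : 'rV[R]_1)).
  by rewrite cone_cinvE.
apply: (smooth_rsub oD oD') (tY c c' k) => q.
move=> /(rep_dom_sub cone_good)[]; rewrite cone_cimgE => -[_ cq] _ _.
by rewrite cone_cinvE => -[_ c'q]; exact: rep_domP.
Qed.

Variable gY : metric AY.
Hypothesis mY : riemannian_metric gY.

Lemma cone_metric_smooth (c : idx CA) : smoothmx (cimg c) (cone_metric gY c).
Proof.
have [_ oc _ _ _] := cone_good c; have tc := upper_rV_thick (open_upper_rV oc).
have [_ oi _ _ _] := gY' c.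
move=> k l; case: (split_ordP (k : 'I_(1 + n))) => a ->;
  case: (split_ordP (l : 'I_(1 + n))) => b ->.
- apply: (@eq_smooth _ _ _ (fun=> (1%:M : 'M[R]_1) a b)); last exact: (smooth_cst tc).
  move=> q _; rewrite /cone_metric [RHS](block_mxEul (1%:M : 'M[R]_1)).
  by [].
- apply: (@eq_smooth _ _ _ (fun=> 0)); last exact: (smooth_cst tc).
  move=> q _; rewrite /cone_metric [RHS](block_mxEur (1%:M : 'M[R]_1)).
  by rewrite mxE.
- apply: (@eq_smooth _ _ _ (fun=> 0)); last exact: (smooth_cst tc).
  move=> q _; rewrite /cone_metric [RHS](block_mxEdl (1%:M : 'M[R]_1)).
  by rewrite mxE.
apply: (@eq_smooth _ _ _ (fun q : rv => crad q * crad q * gY c (rsubmx q) a b)).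
  move=> q _; rewrite /cone_metric [RHS](block_mxEdr (1%:M : 'M[R]_1)).
  by rewrite mxE expr2 !mxE.
apply: (smoothM tc); first by apply: (smoothM tc); exact: smooth_rad.
apply: (smooth_rsub oc oi) (mY.2 c a b) => q.
by rewrite cone_cimgE => -[].
Qed.

Lemma cone_metric_spd (c : idx CA) q : cimg c q -> spd (cone_metric gY c q).
Proof.
rewrite cone_cimgE => -[q0 [y cy yq]]; have [symY pY _] := mY.1 y c cy.
rewrite yq in symY pY.
have ls : (lsubmx (q : rv)) 0 0 = crad q by rewrite mxE.
suff : @spd R (1 + n) (block_mx (1%:M : 'M[R]_1) 0 0 (crad q ^+ 2 *: gY c (rsubmx (q : rv)))).
  by rewrite -ls; exact.
split; first by rewrite tr_block_mx trmx1 !trmx0 linearZ /= symY.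
move=> v v0; rewrite -[v]hsubmxK; set a := lsubmx _; set w := rsubmx _.
rewrite mul_row_block mulmx1 !mulmx0 addr0 add0r tr_row_mx mul_row_col mxE.
rewrite -scalemxAr -scalemxAl.
have a0 : 0 <= (a *m a^T) 0 0 by rewrite mxE; apply: sumr_ge0 => k _; rewrite [a^T _ _]mxE -expr2 sqr_ge0.
have [w0|w0] := eqVneq w 0.
  rewrite w0 mul0mx mul0mx scaler0 [X in _ + X]mxE addr0; apply: row_sqr_gt0.
  apply: contraNN v0 => /eqP a00; rewrite -[v]hsubmxK -/a -/w a00 w0.
  by rewrite row_mx0.
by rewrite ltr_wpDl // mxE mulr_gt0 ?exprn_gt0 // pY.
Qed.

End ConeAtlas.

(** * Blow-down limits *)

Lemma diff_continuous_at (R : realType) (V : normedModType R) (B : coords V)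
    (U : set V) (f : V -> R) q :
  thick B U -> open U -> diff_on U f -> U q -> {for q, continuous f}.
Proof.
move=> tU oU df Uq; apply/cvgrPdist_le => e e0.
have := lip_within_near e0 (has_grad_lip (diff_grad tU df Uq)); rewrite near_withinE.
have : \forall q' \near q, U q' by exact: open_nbhs_nbhs.
by apply: filter_app2; near=> q' => Uq' /(_ Uq'); rewrite distrC.
Unshelve. all: by end_near. Qed.

(** * Compact sets and lower bounds for positive definite matrices *)

Section CompactBounds.
Context {R : realType}.

Lemma compact_smooth_bound N (U K : set 'rV[R]_N) (f : 'rV[R]_N -> R) :
  open U -> diff_on U f -> compact K -> K `<=` U ->
  exists2 M : R, 0 <= M & forall q, K q -> `|f q| <= M.
Proof.
move=> oU df cK KU; have tU := upper_rV_thick (open_upper_rV oU).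
have /compact_bounded[M [_ hM]] : compact (f @` K).
  apply: continuous_compact => //.
  apply: continuous_in_subspaceT => q /set_mem Kq.
  by apply: (diff_continuous_at tU oU df); exact: KU.
exists (`|M| + 1); first by rewrite addr_ge0.
move=> q Kq; apply: (hM (`|M| + 1)); last by exists q.
by rewrite (le_lt_trans (ler_norm M)) // ltrDl.
Qed.

Lemma cball_compact N (q0 : 'rV[R]_N) (d : R) : 0 <= d -> compact [set q | `|q - q0| <= d].
Proof.
move=> d0; rewrite (_ : [set q | _] = [set v : 'rV[R]_N | forall i,
    `[q0 0 i - d, q0 0 i + d]%classic (v ord0 i)]).
  by apply: (@rV_compact R N (fun i => `[q0 0 i - d, q0 0 i + d]%classic)) => i; exact: segment_compact.
apply/seteqP; split=> v /= h.
  move=> i; rewrite in_itv /=; have := le_trans (row_entry_le (v - q0) i) h.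
  by rewrite !mxE ler_norml => /andP[? ?]; apply/andP; split; lra.
apply: row_norm_le => // i; have := h i; rewrite in_itv /= !mxE ler_norml.
by move=> /andP[? ?]; apply/andP; split; lra.
Qed.

Lemma derivs_within_slice N (D : set ('rV[R]_N * R)) (f : 'rV[R]_N * R -> R) (s : seq 'I_N) t q :
  upper_st D -> smooth_on D f -> D (q, t) ->
  derivs_within D (map est s) f (q, t) =
  derivs_within [set q | D (q, t)] (map (fun i => delta_mx 0 i) s) (fun q => f (q, t)) q.
Proof.
move=> uD sf; elim: s q => //= i s IH q Dq.
rewrite -(deriv_within_slice uD (f := derivs_within D (map est s) f)) //; last first.
  exact/smooth_diff/smooth_derivs.
by apply: eq_deriv_within => // q' Dq'; exact: IH.
Qed.

Lemma sqr_sum_le N (a : 'I_N -> R) (z : R) : 0 <= z -> (forall k, a k ^+ 2 <= z) ->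
  (\sum_k a k) ^+ 2 <= N%:R ^+ 2 * z.
Proof.
move=> z0 az; have h k : `|a k| <= Num.sqrt z by rewrite -sqrtr_sqr ler_wsqrtr.
have : `|\sum_k a k| <= N%:R * Num.sqrt z.
  apply: le_trans (ler_norm_sum _ _ _) _.
  by rewrite mulr_natl -[X in _ *+ X](card_ord N) -sumr_const ler_sum.
rewrite -(ler_pXn2r (n := 2)) ?nnegrE ?mulr_ge0 ?sqrtr_ge0 //.
by rewrite exprMn sqr_sqrtr // real_normK ?num_real.
Qed.

Lemma row_entry_sqr_le N (w : 'rV[R]_N) k : w 0 k ^+ 2 <= (w *m w^T) 0 0.
Proof.
rewrite [leRHS]mxE (bigD1 k) //= [_^T _ _]mxE -expr2 lerDl.
by apply: sumr_ge0 => j _; rewrite [_^T _ _]mxE -expr2 sqr_ge0.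
Qed.

Lemma row_sqr_ge0 N (w : 'rV[R]_N) : 0 <= (w *m w^T) 0 0.
Proof. by rewrite mxE; apply: sumr_ge0 => j _; rewrite [_^T _ _]mxE -expr2 sqr_ge0. Qed.

(** With [C = L L^T] and [w = v L], the form of [C] at [v] is [|w|^2], and the squared entries of
    [L^-1] are at most the trace of [C^-1]. Squaring a sum of [N] terms costs [N^2], summing over
    the coordinates another [N]. *)
Lemma spd_lower N (C : 'M[R]_N) (v : 'rV[R]_N) : spd C ->
  (v *m v^T) 0 0 <= N%:R ^+ 3 * \tr (invmx C) * (v *m C *m v^T) 0 0.
Proof.
move=> sC; have [L uL CL] := cholesky sC.
have iC : invmx C = (invmx L)^T *m ((invmx L)^T)^T.
  rewrite trmxK; have uC := spd_unit sC; have : C *m ((invmx L)^T *m invmx L) = 1%:M.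
    by rewrite CL -mulmxA [L^T *m _]mulmxA -trmx_mul mulVmx // trmx1 mul1mx mulmxV.
  by move=> h; rewrite -[RHS]mul1mx -(mulVmx uC) -mulmxA h mulmx1.
pose w := v *m L; have -> : (v *m C *m v^T) 0 0 = (w *m w^T) 0 0.
  by rewrite CL /w trmx_mul !mulmxA.
have vE : v = w *m invmx L by rewrite /w mulmxK.
set T := \tr (invmx C); set W := (w *m w^T) 0 0.
have W0 : 0 <= W := row_sqr_ge0 w.
have PT k j : invmx L k j ^+ 2 <= T.
  by have := gram_sqr_le_tr j k iC; rewrite [_^T _ _]mxE.
have T0 : 0 <= T by rewrite /T /mxtrace; apply: sumr_ge0 => k _; exact: gram_diag_ge0 iC.
have vj j : v 0 j ^+ 2 <= N%:R ^+ 2 * (W * T).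
  rewrite {1}vE mxE; apply: sqr_sum_le; first exact: mulr_ge0.
  by move=> k; rewrite exprMn ler_pM ?sqr_ge0 // row_entry_sqr_le.
rewrite [leLHS]mxE.
have -> : N%:R ^+ 3 * T * W = N%:R * (N%:R ^+ 2 * (W * T)) by ring.
rewrite mulr_natl -[X in _ *+ X](card_ord N) -sumr_const; apply: ler_sum => j _.
by rewrite [_^T _ _]mxE -expr2 vj.
Qed.

(* A metric close to C is bounded below by a multiple of C, which bounds its
   inverse. *)
Lemma tr_inv_close N (C H : 'M[R]_N) (M : R) : 0 < M -> spd C -> spd H ->
  N%:R ^+ 3 * \tr (invmx C) <= M ->
  (forall k l, `|H k l - C k l| <= (2 * M * (N%:R ^+ 2 + 1))^-1) ->
  \tr (invmx H) <= N%:R * (2 * M).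
Proof.
move=> M0 sC sH CM HC; set eta := (2 * M * _)^-1 in HC.
have n1 : 0 < N%:R ^+ 2 + 1 :> R by rewrite ltr_wpDl // exprn_ge0.
(* The perturbation of the quadratic form is at most [N^2 * eta * |v|^2], hence at most half of the
   lower bound [|v|^2 / M]. *)
have etaE : N%:R ^+ 2 * eta <= (2 * M)^-1.
  rewrite /eta invfM mulrCA ger_pMr ?invr_gt0 ?mulr_gt0 //.
  by rewrite ler_pdivrMr // mul1r lerDl.
have eta0 : 0 <= eta by rewrite invr_ge0 !mulr_ge0 // ltW.
have low (v : 'rV[R]_N) : (v *m v^T) 0 0 <= 2 * M * (v *m H *m v^T) 0 0.
  have vv := row_sqr_ge0 v; set Q := (v *m v^T) 0 0 in vv *.
  have h1 : Q <= M * (v *m C *m v^T) 0 0.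
    apply: le_trans (spd_lower v sC) _; rewrite ler_wpM2r //.
    have [->|v0] := eqVneq v 0; first by rewrite !mul0mx mxE.
    exact/ltW/sC.2.
  have h2 : `|(v *m (H - C) *m v^T) 0 0| <= N%:R ^+ 2 * eta * Q.
    have -> : (v *m (H - C) *m v^T) 0 0 = \sum_k \sum_l v 0 k * (v 0 l * (H - C) k l).
      rewrite mxE; under eq_bigr do rewrite mxE mulr_suml.
      rewrite exchange_big /=; apply: eq_bigr => k _; apply: eq_bigr => l _.
      by rewrite [v^T _ _]mxE; ring.
    have cN (x : R) : N%:R * x = \sum_(a < N) x by rewrite sumr_const card_ord mulr_natl.
    rewrite expr2 -!mulrA.
    apply: le_trans (ler_norm_sum _ _ _) _; rewrite [leRHS]cN; apply: ler_sum => k _.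
    apply: le_trans (ler_norm_sum _ _ _) _; rewrite [leRHS]cN; apply: ler_sum => l _.
    rewrite mulrA normrM [leRHS]mulrC ler_pM //; last by rewrite !mxE HC.
    rewrite normrM; have a1 := row_entry_sqr_le v k; have a2 := row_entry_sqr_le v l.
    rewrite -/Q -real_normK ?num_real // in a1; rewrite -/Q -real_normK ?num_real // in a2.
    by have := sqr_ge0 (`|v 0 k| - `|v 0 l|); nra.
  have h3 : N%:R ^+ 2 * eta * Q <= (2 * M)^-1 * Q by rewrite ler_wpM2r.
  have h4 : (v *m (H - C) *m v^T) 0 0 = (v *m H *m v^T) 0 0 - (v *m C *m v^T) 0 0.
    by rewrite mulmxBr mulmxBl !mxE.
  rewrite h4 in h2; have := le_trans h2 h3; rewrite ler_norml => /andP[h5 _].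
  have h6 : M * ((2 * M)^-1 * Q) = Q / 2 by field; rewrite gt_eqF.
  move: (ler_wpM2l (ltW M0) h5); rewrite mulrN h6.
  move: ((v *m H *m v^T) 0 0) ((v *m C *m v^T) 0 0) h1 => a b h1; rewrite mulrBr; lra.
rewrite mulr_natl -[X in _ *+ X](card_ord N) -sumr_const; apply: ler_sum => k _.
pose A := invmx H; have uH := spd_unit sH.
have symA : A^T = A by rewrite /A trmx_inv sH.1.
(* The [k]-th row of [A = H^-1] as test vector gives [A k k ^ 2 <= 2 * M * A k k]. *)
have := low (delta_mx 0 k *m A).
rewrite trmx_mul symA trmx_delta.
have -> : delta_mx 0 k *m A *m H *m (A *m delta_mx k 0) = delta_mx 0 k *m A *m delta_mx k 0 :> 'M[R]_1.
  by rewrite mulmxKV // mulmxA.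
have -> : (delta_mx 0 k *m A *m delta_mx k 0 : 'M[R]_1) 0 0 = A k k.
  by rewrite -rowE -colE !mxE.
move=> h.
have h2 : A k k ^+ 2 <= (delta_mx 0 k *m A *m (A *m delta_mx k 0) : 'M[R]_1) 0 0.
  have := row_entry_sqr_le (delta_mx 0 k *m A) k.
  by rewrite trmx_mul symA trmx_delta -{1}rowE [row _ _ _ _]mxE.
rewrite -/A; have h3 := le_trans h2 h; have [a0|a0] := leP (A k k) 0.
  by rewrite (le_trans a0) // mulr_ge0 // ltW.
by move: h3; rewrite expr2 ler_pM2r.
Qed.

End CompactBounds.

Lemma cvg_near_eq (R : realType) (u v : nat -> R) (l : R) :
  (\forall i \near \oo, u i = v i) -> v i @[i --> \oo] --> l -> u i @[i --> \oo] --> l.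
Proof.
move=> uv; apply: cvg_trans; apply: near_eq_cvg.
by apply: filterS uv => i ->.
Qed.

Lemma cvgn_unique (R : realType) (u : nat -> R) (a b : R) :
  u i @[i --> \oo] --> a -> u i @[i --> \oo] --> b -> a = b.
Proof. by move=> ua ub; rewrite -(cvg_lim (@Rhausdorff R) ua) (cvg_lim (@Rhausdorff R) ub). Qed.

(** * Pointwise C^1 convergence and the Ricci tensor *)

Section C1Convergence.
Context {R : realType} {V : normedModType R} (B : coords V) (D : set V).
Hypothesis tD : thick B D.
Context {J : Type} (e : J -> V).

(** Ricci involves first derivatives of the Christoffel symbols. Convergence together with first
    derivatives is stable under the operations that build those symbols, and so yields convergence
    of Ricci. *)
Definition c1_cvg (f : nat -> V -> R) (f0 : V -> R) :=
  [/\ \forall i \near \oo, diff_on D (f i), diff_on D f0,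
      forall x, D x -> f i x @[i --> \oo] --> f0 x
    & forall j x, D x ->
        deriv_within D (e j) (f i) x @[i --> \oo] --> deriv_within D (e j) f0 x].

Lemma eq_c1_cvg f g f0 g0 : (\forall i \near \oo, forall x, D x -> f i x = g i x) ->
  (forall x, D x -> f0 x = g0 x) -> c1_cvg f f0 -> c1_cvg g g0.
Proof.
move=> fg fg0 [df df0 cf cdf]; split.
- by apply: filterS (filterI fg df) => i [h]; exact: eq_diff_on.
- exact: eq_diff_on df0.
- move=> x Dx; rewrite -fg0 //; apply: cvg_near_eq (cf x Dx).
  by apply: filterS fg => i h; rewrite h.
- move=> j x Dx; rewrite -(eq_deriv_within (e j) fg0 Dx); apply: cvg_near_eq (cdf j x Dx).
  by apply: filterS fg => i h; rewrite (eq_deriv_within (e j) h Dx).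
Qed.

Lemma c1_cvg_cst c : c1_cvg (fun _ _ => c) (fun=> c).
Proof.
split.
- by apply: nearW => i; exact: (@diff_on_cst _ _ B D c).
- exact: (@diff_on_cst _ _ B D c).
- by move=> x _; exact: cvg_cst.
- by move=> j x Dx; rewrite (deriv_within_cst tD) //; exact: cvg_cst.
Qed.

Lemma c1_cvgD f g f0 g0 : c1_cvg f f0 -> c1_cvg g g0 ->
  c1_cvg (fun i x => f i x + g i x) (fun x => f0 x + g0 x).
Proof.
move=> [df df0 cf cdf] [dg dg0 cg cdg]; split.
- by apply: filterS (filterI df dg) => i []; exact: (@diff_onD _ _ B D).
- exact: (@diff_onD _ _ B D).
- by move=> x Dx; apply: cvgD; [exact: cf|exact: cg].
- move=> j x Dx; rewrite (deriv_withinD tD) //.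
  apply: cvg_near_eq (cvgD (cdf j x Dx) (cdg j x Dx)).
  by apply: filterS (filterI df dg) => i [? ?]; rewrite (deriv_withinD tD).
Qed.

Lemma c1_cvgM f g f0 g0 : c1_cvg f f0 -> c1_cvg g g0 ->
  c1_cvg (fun i x => f i x * g i x) (fun x => f0 x * g0 x).
Proof.
move=> [df df0 cf cdf] [dg dg0 cg cdg]; split.
- by apply: filterS (filterI df dg) => i []; exact: (@diff_onM _ _ B D).
- exact: (@diff_onM _ _ B D).
- by move=> x Dx; apply: cvgM; [exact: cf|exact: cg].
- move=> j x Dx; rewrite (deriv_withinM tD) //.
  apply: cvg_near_eq (cvgD (cvgM (cdf j x Dx) (cg x Dx)) (cvgM (cf x Dx) (cdg j x Dx))).
  by apply: filterS (filterI df dg) => i [? ?]; rewrite (deriv_withinM tD).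
Qed.

Lemma c1_cvgB f g f0 g0 : c1_cvg f f0 -> c1_cvg g g0 ->
  c1_cvg (fun i x => f i x - g i x) (fun x => f0 x - g0 x).
Proof.
move=> cf cg; have := c1_cvgD cf (c1_cvgM (c1_cvg_cst (-1)) cg).
by apply: eq_c1_cvg => [|x _]; [apply: nearW => i x _|]; rewrite mulN1r.
Qed.

Lemma c1_cvg_sum (I : Type) (r : seq I) (f : I -> nat -> V -> R) f0 :
  (forall k, c1_cvg (f k) (f0 k)) ->
  c1_cvg (fun i x => \sum_(k <- r) f k i x) (fun x => \sum_(k <- r) f0 k x).
Proof.
move=> cf; elim: r => [|k r IH].
  by apply: eq_c1_cvg (c1_cvg_cst 0) => [|x _]; [apply: nearW => i x _|]; rewrite big_nil.
apply: eq_c1_cvg (c1_cvgD (cf k) IH) => [|x _]; last by rewrite big_cons.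
by apply: nearW => i x _; rewrite big_cons.
Qed.

Lemma c1_cvg_prod (I : Type) (r : seq I) (f : I -> nat -> V -> R) f0 :
  (forall k, c1_cvg (f k) (f0 k)) ->
  c1_cvg (fun i x => \prod_(k <- r) f k i x) (fun x => \prod_(k <- r) f0 k x).
Proof.
move=> cf; elim: r => [|k r IH].
  by apply: eq_c1_cvg (c1_cvg_cst 1) => [|x _]; [apply: nearW => i x _|]; rewrite big_nil.
apply: eq_c1_cvg (c1_cvgM (cf k) IH) => [|x _]; last by rewrite big_cons.
by apply: nearW => i x _; rewrite big_cons.
Qed.

Lemma c1_cvgV f f0 : (\forall i \near \oo, forall x, D x -> f i x != 0) ->
  (forall x, D x -> f0 x != 0) -> c1_cvg f f0 ->
  c1_cvg (fun i x => (f i x)^-1) (fun x => (f0 x)^-1).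
Proof.
move=> nf nf0 [df df0 cf cdf].
have cv x : D x -> (f i x)^-1 @[i --> \oo] --> (f0 x)^-1.
  by move=> Dx; apply: cvgV; [exact: nf0|exact: cf].
split=> //.
- by apply: filterS (filterI df nf) => i []; exact: (@diff_onV _ _ B D).
- exact: (@diff_onV _ _ B D).
- move=> j x Dx; rewrite (deriv_withinV tD _ df0 (nf0 x Dx) Dx).
  apply: cvg_near_eq (cvgN (cvgM (cdf j x Dx) (cvgM (cv x Dx) (cv x Dx)))).
  by apply: filterS (filterI df nf) => i [d0 n0]; rewrite (deriv_withinV tD _ d0 (n0 x Dx) Dx).
Qed.

Lemma c1_cvg_det n (M : nat -> V -> 'M[R]_n) (M0 : V -> 'M[R]_n) :
  (forall k l, c1_cvg (fun i x => M i x k l) (fun x => M0 x k l)) ->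
  c1_cvg (fun i x => \det (M i x)) (fun x => \det (M0 x)).
Proof.
move=> cM; rewrite /determinant; apply: c1_cvg_sum => s; apply: c1_cvgM.
  exact: c1_cvg_cst.
by apply: c1_cvg_prod => i.
Qed.

Lemma c1_cvg_invmx n (M : nat -> V -> 'M[R]_n) (M0 : V -> 'M[R]_n) :
  (\forall i \near \oo, forall x, D x -> M i x \in unitmx) ->
  (forall x, D x -> M0 x \in unitmx) ->
  (forall k l, c1_cvg (fun i x => M i x k l) (fun x => M0 x k l)) ->
  forall k l, c1_cvg (fun i x => invmx (M i x) k l) (fun x => invmx (M0 x) k l).
Proof.
move=> uM uM0 cM k l.
apply: (@eq_c1_cvg (fun i q => (\det (M i q))^-1 * ((-1) ^+ (l + k) *
    \det (row' l (col' k (M i q))))) _ (fun q => (\det (M0 q))^-1 * ((-1) ^+ (l + k) *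
    \det (row' l (col' k (M0 q)))))).
- by apply: filterS uM => i u q Dq; rewrite /invmx u // !mxE.
- by move=> q Dq; rewrite /invmx uM0 // !mxE.
apply: c1_cvgM.
  apply: c1_cvgV; last exact: c1_cvg_det.
    by apply: filterS uM => i u q /u; rewrite unitmxE unitfE.
  by move=> q /uM0; rewrite unitmxE unitfE.
apply: c1_cvgM; first exact: c1_cvg_cst.
apply: c1_cvg_det => a b.
have -> : (fun i x => row' l (col' k (M i x)) a b) = (fun i x => M i x (lift l a) (lift k b)).
  by apply/funext => i; apply/funext => x; rewrite !mxE.
have -> : (fun x => row' l (col' k (M0 x)) a b) = (fun x => M0 x (lift l a) (lift k b)).
  by apply/funext => x; rewrite !mxE.
exact: cM.
Qed.

End C1Convergence.

Section RicciLimit.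
Context {R : realType} {V : normedModType R} {N : nat} (B : coords V) (D : set V).
Hypothesis tD : thick B D.
Variables (e : 'I_N -> V) (H : nat -> V -> 'M[R]_N) (H0 : V -> 'M[R]_N).
Hypotheses (sH : \forall i \near \oo, smoothmx D (H i)) (sH0 : smoothmx D H0).
Hypothesis uH : \forall i \near \oo, forall x, D x -> H i x \in unitmx.
Hypothesis uH0 : forall x, D x -> H0 x \in unitmx.
Hypothesis cH : forall s k l x, D x ->
  derivs_within D [seq e j | j <- s] (fun y => H i y k l) x @[i --> \oo] -->
  derivs_within D [seq e j | j <- s] (fun y => H0 y k l) x.

Lemma c1_cvg_derivs s k l :
  c1_cvg D e (fun i => derivs_within D [seq e j | j <- s] (fun y => H i y k l))
             (derivs_within D [seq e j | j <- s] (fun y => H0 y k l)).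
Proof.
split.
- by apply: filterS sH => i h; apply: smooth_diff; apply: smooth_derivs; exact: h.
- by apply: smooth_diff; apply: smooth_derivs.
- exact: cH.
- by move=> j x Dx; have := @cH (j :: s) k l x Dx.
Qed.

Lemma gchr_c1_cvg k i j : c1_cvg D e (fun a => gchr D e (H a) k i j) (gchr D e H0 k i j).
Proof.
apply: (c1_cvgM tD); first exact: (c1_cvg_cst tD).
apply: (c1_cvg_sum tD) => l; apply: (c1_cvgM tD).
  by apply: (c1_cvg_invmx tD) => // a b; exact: (c1_cvg_derivs [::]).
apply: (c1_cvgB tD); first apply: (c1_cvgD tD).
- exact: (c1_cvg_derivs [:: i]).
- exact: (c1_cvg_derivs [:: j]).
- exact: (c1_cvg_derivs [:: l]).
Qed.

Lemma gricci_cvg j k x : D x ->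
  gricci D e (H i) j k x @[i --> \oo] --> gricci D e H0 j k x.
Proof.
move=> Dx; apply: cvg_rsum => i; rewrite /griem.
have c0 a b d := let: And4 _ _ h _ := gchr_c1_cvg a b d in h x Dx.
have c1 a b d m := let: And4 _ _ _ h := gchr_c1_cvg a b d in h m x Dx.
apply: cvgD; first by apply: cvgB; exact: c1.
by apply: cvg_rsum => m; apply: cvgB; apply: cvgM.
Qed.

End RicciLimit.

Lemma countable_extraction (R : realType) (T : countType) (u : T -> nat -> R) :
  (forall a, exists C : R, \forall i \near \oo, `|u a i| <= C) ->
  exists2 s : nat -> nat, {homo s : i j / (i < j)%N} &
    forall a, cvgn (fun i => u a (s i)).
Proof.
move=> ub; pose v l i := if unpickle l is Some a then u a i else 0.
have [|s ms cs] := @diagonal_extraction R v.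
  move=> l; rewrite /v; case: (unpickle l) => [a|]; first exact: ub.
  by exists 0; apply: nearW => i; rewrite normr0.
by exists s => // a; have := cs (pickle a); rewrite /v pickleK.
Qed.

(** One point is picked in each nonempty member of a countable base. [None] stands at the codes of
    no such member, so the empty space is covered too. *)
Lemma dense_sequence (T : topologicalType) : @second_countable T ->
  exists y : nat -> option T, forall (p : T) (A : set T), nbhs p A ->
    exists k x, y k = Some x /\ A x.
Proof.
move=> [B /countable_injP[f fB] [_ bB]].
have /choice[y Hy] : forall k, exists o : option T,
    (exists U x, [/\ B U, f U = k & U x]) ->
    exists U x, [/\ B U, f U = k, U x & o = Some x].
  move=> k; have [[U [x [BU fU Ux]]]|h] := pselect (exists U x, [/\ B U, f U = k & U x]).
    by exists (Some x) => _; exists U, x.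
  by exists None.
exists y => p A /(bB p)[U [BU Up] UA]; exists (f U).
have [|V [x [BV fV Vx yx]]] := Hy (f U); first by exists U, p.
exists x; split=> //; apply: UA; suff <- : V = U by [].
by apply: fB; rewrite ?inE.
Qed.

Lemma cvgn_approx (R : realType) (u : nat -> R) :
  (forall e, 0 < e -> exists2 v : nat -> R, cvgn v & \forall i \near \oo, `|u i - v i| <= e) ->
  cvgn u.
Proof.
move=> h; apply: cauchy_cvg; apply: cauchy_exP => e e0.
have e2 : 0 < e / 4 by rewrite divr_gt0.
have [v cv uv] := h _ e2; exists (limn v).
have /cvgrPdist_lt /(_ _ e2) vl := cv.
apply: filterS (filterI uv vl) => i [h1 h2]; rewrite /ball /=.
rewrite (_ : _ - u i = (limn v - v i) - (u i - v i)); last by ring.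
by apply: le_lt_trans (ler_normB _ _) _; move: h1 h2; lra.
Qed.

Lemma homo_cvg_oo (s : nat -> nat) : {homo s : i j / (i < j)%N} -> s i @[i --> \oo] --> \oo.
Proof.
move=> ms A [N _ NA]; exists N => // i /= Ni; apply: NA => /=; apply: leq_trans Ni _.
by elim: i => // i IH; apply: leq_ltn_trans IH (ms _ _ (ltnSn i)).
Qed.

Lemma increasing_choice (P : nat -> nat -> Prop) : (forall i, \forall m \near \oo, P i m) ->
  exists2 s : nat -> nat, {homo s : i j / (i < j)%N} & forall i, P i (s i).
Proof.
move=> hP; have /choice[f Hf] : forall ik : nat * nat, exists m, (ik.2 < m)%N /\ P ik.1 m.
  move=> [i k]; have [N _ HN] := hP i; exists (maxn N k.+1); split; first exact: leq_maxr.
  by apply: HN => /=; exact: leq_maxl.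
pose s := fix s i := if i is j.+1 then f (i, s j) else f (0, 0).
exists s; last by case=> [|i]; [case: (Hf (0, 0))|case: (Hf (i.+1, s i))].
by apply: homo_ltn => [|i]; [exact: ltn_trans|case: (Hf (i.+1, s i))].
Qed.

(** * Blow-downs and estimates on an annulus *)

Section Blowdown.
Context {R : realType} {n : nat} {X Y : topologicalType}.
Variables (AX : atlas R n.+1 X) (AY : atlas R n Y).
Variables (gX : R -> metric AX) (gY : metric AY) (x0 : X) (eps : R).
Local Notation CA := (cone_atlas AY).
Hypotheses (gdX : forall j : idx AX, good_chart j)
  (trX : smooth_map AX AX setT id) (cvX : forall x : X, exists j : idx AX, cdom j x).
Hypotheses (gdY : forall i : idx AY, good_chart i)
  (trY : smooth_map AY AY setT id) (cvY : forall y : Y, exists i : idx AY, cdom i y).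
Hypothesis (mY : riemannian_metric gY).
Hypothesis flow : ricci_flow [set p : X * R | 0 <= p.2] gX.
Hypothesis eps0 : 0 < eps.
Variables (F : R -> option (R * Y) -> X).
Hypothesis SM : forall R1 R2 : R, 0 < R1 -> R1 < R2 ->
  smooth_annulus_cvg (gX 0) x0 gY F R1 R2.
Variables (rd : R) (C : nat -> R).
Hypothesis decay : forall (k : nat) (x : X) (t : R),
  rd <= dist (gX 0) x x0 -> 0 <= t <= eps * dist (gX 0) x x0 ^+ 2 ->
  nablaRm_le (gX t) k x (C k * dist (gX 0) x x0 ^- (2 + k)).

Let gdC : forall c : idx CA, good_chart c := cone_good gdY.

Definition phi (l : R) (p : R * Y) : X := F l (Some p).

(* With lam slightly larger than rr, the decay hypothesis holds on the whole
   closed parabolic region, including its boundary t = eps * r^2. *)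
Definition good_seq (rr lam : nat -> R) :=
  [/\ forall i, 0 < rr i, rr i @[i --> \oo] --> +oo, lam i @[i --> \oo] --> +oo,
      lam i / rr i @[i --> \oo] --> (1 : R)
    & forall R1 R2, 0 < R1 -> R1 < R2 -> \forall i \near \oo,
        forall p, closed_annulus R1 R2 p ->
          rr i * p.1 <= dist (gX 0) (phi (lam i) p) x0].

Definition S0 : set (R * Y) := [set p | 0 < p.1].

(** The pullback is taken over all of [S0], so that one family serves every annulus, although the
    map is known to be an embedding only on a given annulus and for large scales. *)
Definition hh (r l : R) (c : idx CA) (x : 'rV[R]_n.+1 * R) : 'M[R]_n.+1 :=
  pflow gX S0 (phi l) c r^-1 x.

Definition btop (q : 'rV[R]_n.+1) : R := eps * (crad (q : 'rV[R]_(1 + n))) ^+ 2.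

Lemma open_annulus_open (R1 R2 : R) : open (open_annulus R1 R2 : set (R * Y)).
Proof.
rewrite (_ : open_annulus R1 R2 = (fst : R * Y -> R) @^-1` `]R1, R2[%classic).
  by apply: open_comp => [p _|]; [exact: cvg_fst|exact: interval_open].
by apply/seteqP; split=> p /=; rewrite /open_annulus /= in_itv.
Qed.

Section Annulus.
Variables (c : idx CA) (R1 R2 : R).
Hypotheses (R10 : 0 < R1) (R12 : R1 < R2).
Let S : set (R * Y) := open_annulus R1 R2.
Definition annU : set 'rV[R]_n.+1 := cmap c @` (S `&` cdom c).
Definition annD : set ('rV[R]_n.+1 * R) := under_graph annU btop.

Lemma annU_open : open annU.
Proof. by apply: (chart_image_open (gdC c)); exact: open_annulus_open. Qed.

Lemma annU_sub q : annU q -> [/\ cimg c q, S (cinv c q) & R1 < crad (q : 'rV[R]_(1 + n)) < R2].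
Proof.
move=> [p [Sp cp] <-]; split; first by exists p.
  by rewrite (cdomK (gdC c)).
by rewrite rad_cmap.
Qed.

Lemma annUP q : cimg c q -> R1 < crad (q : 'rV[R]_(1 + n)) < R2 -> annU q.
Proof.
move=> cq rq; exists (cinv c q); last exact: (cimgK (gdC c)).
split; last exact: (cimg_dom (gdC c)).
by rewrite /S /open_annulus cone_cinvE.
Qed.

Lemma annU_rad q : annU q -> 0 < crad (q : 'rV[R]_(1 + n)).
Proof. by move=> /annU_sub[_ _ /andP[h _]]; exact: lt_trans h. Qed.

Lemma annD_upper : upper_st annD.
Proof.
apply: under_graph_upper; first exact: annU_open.
  by move=> q /annU_rad q0; rewrite mulr_gt0 // exprn_gt0.
move=> q q' /annU_rad q0 /annU_rad q0' qq'; rewrite ler_wpM2l ?(ltW eps0) //.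
by rewrite ler_pXn2r ?nnegrE ?(ltW q0) ?(ltW q0') //; exact: qq'.
Qed.

Lemma annD_sub x : annD x -> [/\ cimg c x.1, S (cinv c x.1) & 0 <= x.2].
Proof. by move=> [/annU_sub[? ? _] /andP[? _]]. Qed.

Lemma S_sub : S `<=` S0.
Proof. by move=> p /andP[h _]; exact: lt_trans h. Qed.

Lemma hhE r l x : annD x -> hh r l c x = pflow gX S (phi l) c r^-1 x.
Proof.
move=> /annD_sub[cx Sx _]; rewrite /hh /pflow.
by rewrite -(pullback_sub gdC _ _ (@open_annulus_open R1 R2) S_sub cx Sx).
Qed.

Lemma hh0E r l q : annU q -> hh r l c (q, 0) = r ^- 2 *:
  pullback (closed_annulus R1 R2) (phi l) (gX 0) c q.
Proof.
move=> /annU_sub[cx Sx _]; rewrite /hh /pflow /= mulr0 exprVn.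
rewrite -(pullback_sub gdC _ _ (@open_annulus_open R1 R2) S_sub cx Sx).
rewrite (pullback_sub gdC (S' := closed_annulus R1 R2) _ _ (@open_annulus_open R1 R2) _ cx Sx) //.
by move=> p /andP[? ?]; apply/andP; split; exact: ltW.
Qed.

Section Sequence.
Variables (rr lam : nat -> R).
Hypothesis good : good_seq rr lam.

Lemma near_embedding : \forall i \near \oo,
  smooth_embedding CA AX S (phi (lam i)).
Proof.
have [_ _ lamoo _ _] := good; have [emb _ _] := SM R10 R12.
have h : \forall i \near \oo, smooth_embedding CA AX (closed_annulus R1 R2) (phi (lam i)).
  exact: (lamoo _ emb).
apply: filterS h => i.
apply: (embedding_sub gdC) => //; first exact: open_annulus_open.
by move=> p /andP[? ?]; apply/andP; split; exact: ltW.
Qed.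

Lemma near_hh : \forall i \near \oo,
  [/\ smoothmx annD (hh (rr i) (lam i) c), forall x, annD x -> spd (hh (rr i) (lam i) c x)
    & forall x k l, annD x -> deriv_within annD (0, 1) (fun y => hh (rr i) (lam i) c y k l) x =
       - 2 * gricci annD est (hh (rr i) (lam i) c) k l x].
Proof.
apply: filterS near_embedding => i emb; have [rr0 _ _ _ _] := good.
have sg0 : 0 < (rr i)^-1 by rewrite invr_gt0.
have oS := @open_annulus_open R1 R2 : open S.
split.
- move=> k l; apply: eq_smooth (pflow_smooth gdC gdX trX cvX flow oS emb annD_upper sg0 annD_sub k l).
  by move=> x Dx; rewrite hhE.
- move=> x Dx; rewrite hhE //.
  exact: (pflow_spd gdC gdX trX cvX flow oS emb sg0 annD_sub Dx).
move=> x k l Dx.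
pose pf := pflow gX S (phi (lam i)) c (rr i)^-1.
have hE : forall y, annD y -> hh (rr i) (lam i) c y = pf y by move=> y; exact: hhE.
rewrite (gricci_local est openT (fun y _ => iff_refl (annD y)) (fun y _ => hE y)) //.
rewrite -(pflow_flow gdC gdX trX cvX flow oS emb annD_upper sg0 annD_sub k l Dx).
exact: (@eq_deriv_within _ _ annD (fun y => hh (rr i) (lam i) c y k l) (fun y => pf y k l)
  _ _ (fun y Dy => congr1 (fun M : 'M[R]_n.+1 => M k l) (hE y Dy)) Dx).
Qed.

(** At a point of radius [p] the distance [d] to [x0] is at least [rr i * p], and [p > R1]; after
    rescaling the decay bound [C k * d^-(2 + k)] becomes at most [C k * R1^-(2 + k)] in absolute
    value. *)
Lemma near_curv k : exists K : R, \forall i \near \oo, forall x, annD x ->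
  exists2 P : 'M[R]_n.+1, invmx (hh (rr i) (lam i) c x) = P *m P^T &
   forall L, size L = (4 + k)%N ->
   `|pull P^T L ((iter k (gnabla annD est (hh (rr i) (lam i) c))
                  (gRm annD est (hh (rr i) (lam i) c)))^~ x)| <= K.
Proof.
exists (`|C k| * R1 ^- (2 + k)).
have [rr0 rroo _ _ dis] := good.
have big : \forall i \near \oo, rd <= rr i * R1.
  have : \forall i \near \oo, rd / R1 <= rr i by exact: (rroo _ (nbhs_pinfty_ge (num_real _))).
  by apply: filterS => i; rewrite ler_pdivrMr.
move: near_embedding big (dis R1 R2 R10 R12); apply: filter_app3.
near=> i => emb big {}dis x Dx; have [cx Sx x20] := annD_sub Dx.
have oS := @open_annulus_open R1 R2 : open S.
have sg0 : 0 < (rr i)^-1 by rewrite invr_gt0.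
have [/annU_sub[_ _ /andP[r1 r2]] /andP[_ tb]] := Dx.
pose p := cinv c x.1; pose d := dist (gX 0) (phi (lam i) p) x0.
have pE : p.1 = crad (x.1 : 'rV[R]_(1 + n)) by rewrite /p cone_cinvE.
have rp0 : 0 < p.1 by rewrite pE (lt_trans R10).
have pd : rr i * p.1 <= d.
  apply: dis; apply/andP; rewrite pE (ltW r1) (ltW r2); split => //.
have R1d : rr i * R1 <= d by apply: le_trans pd; rewrite ler_pM2l // pE ltW.
have rR0 : 0 < rr i * R1 by rewrite mulr_gt0.
have d0 : 0 < d by exact: lt_le_trans R1d.
have nle := decay k (le_trans big R1d : rd <= d) (t := (rr i)^-1 ^- 2 * x.2).
(* From [d >= rr i * p] the time [rr i ^ 2 * t], with [t <= eps * p^2], is within the range of the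
   decay hypothesis, the boundary case included. *)
have tt : 0 <= (rr i)^-1 ^- 2 * x.2 <= eps * d ^+ 2.
  rewrite exprVn invrK mulr_ge0 //=; last by rewrite exprn_ge0 // ltW.
  apply: le_trans (ler_wpM2l (exprn_ge0 2 (ltW (rr0 i))) tb) _.
  rewrite /btop mulrCA ler_wpM2l ?(ltW eps0) // -exprMn -pE.
  by rewrite ler_pXn2r ?nnegrE // ltW // mulr_gt0.
have [P HP Pb] := pflow_frames gdC gdX trX cvX flow oS emb annD_upper sg0 annD_sub Dx (nle tt).
exists P; first by rewrite hhE.
move=> L sL.
have -> : pull P^T L ((iter k (gnabla annD est (hh (rr i) (lam i) c))
                  (gRm annD est (hh (rr i) (lam i) c)))^~ x) =
   pull P^T L ((iter k (gnabla annD est (pflow gX S (phi (lam i)) c (rr i)^-1))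
                  (gRm annD est (pflow gX S (phi (lam i)) c (rr i)^-1)))^~ x).
  apply: eq_pull => I _.
  by apply: (nablaRm_local est openT (fun y _ => iff_refl (annD y)) (fun y _ => @hhE _ _ y)).
apply: le_trans (Pb L sL) _; rewrite -/p -/d exprVn invrK mulrCA.
apply: (@le_trans _ _ (`|C k| * (rr i ^+ (2 + k) * d ^- (2 + k)))).
  rewrite ler_wpM2r ?ler_norm //.
  by apply: mulr_ge0; rewrite ?invr_ge0; apply: exprn_ge0; rewrite ltW // rr0.
rewrite ler_wpM2l // -exprVn -exprMn -exprVn.
have rd0 : 0 <= rr i / d by rewrite divr_ge0 // ltW // rr0.
rewrite ler_pXn2r ?nnegrE // ?invr_ge0 ?(ltW R10) //.
by rewrite ler_pdivrMr // mulrC ler_pdivlMr.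
Unshelve. all: by end_near. Qed.

Let tU : thick (coords_rV n.+1) annU := upper_rV_thick (open_upper_rV annU_open).

Lemma cone_smoothU : smoothmx annU (cone_metric gY c).
Proof.
have [_ oc _ _ _] := gdC c.
move=> k l; apply: (smooth_restrict (upper_rV_thick (open_upper_rV oc)) tU).
  by move=> q /annU_sub[].
exact: cone_metric_smooth.
Qed.

Lemma slice0 : [set q | annD (q, 0)] = annU.
Proof.
apply/seteqP; split=> [q []//|q Uq]; split=> //=.
by rewrite lexx mulr_ge0 ?(ltW eps0) // sqr_ge0.
Qed.

Lemma hh_init (K : set 'rV[R]_n.+1) s j k e : compact K -> K `<=` annU -> 0 < e ->
  \forall i \near \oo, forall q, K q ->
   `|derivs_within annU s (fun q => hh (rr i) (lam i) c (q, 0) j k) q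
     - derivs_within annU s (fun q => cone_metric gY c q j k) q| < e.
Proof.
move=> cK KU e0; have [rr0 _ lamoo lrr _] := good; have [_ _ cvg] := SM R10 R12.
have [M M0 HM] := compact_smooth_bound annU_open
  (smooth_diff (smooth_derivs s (@cone_smoothU j k))) cK KU.
pose kap i := (lam i / rr i) ^+ 2.
have kap1 : kap i @[i --> \oo] --> (1 : R).
  by rewrite -[X in _ --> X](expr1n _ 2); exact: (cvg_comp _ _ lrr (@exprn_continuous _ 2 1)).
have /cvgrPdist_lt kapd := kap1.
pose CL := cmap c @` ((closed_annulus R1 R2 : set (R * Y)) `&` cdom c).
have UCL : annU `<=` CL.
  move=> q [p [/andP[p1 p2] cp] <-]; exists p => //; split=> //.
  by apply/andP; split; exact: ltW.
have UC q : annU q -> annU q <-> CL q by move=> Uq; split=> // _; exact: UCL.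
have hcl : \forall i \near \oo, forall q, K q ->
   `|derivs_within CL s (fun q => (lam i ^+ 2)^-1 * pullback (closed_annulus R1 R2) (phi (lam i)) (gX 0) c q j k) q
     - derivs_within CL s (fun q => cone_metric gY c q j k) q| < e / 4.
  apply: (lamoo _ (cvg c j k K s (e / 4) cK _ _)); last by rewrite divr_gt0.
  by move=> q /KU /UCL.
have lam0 : \forall i \near \oo, 0 < lam i by exact: (lamoo _ (nbhs_pinfty_gt (num_real _))).
have k1 : \forall i \near \oo, `|1 - kap i| < 1 by exact: (kapd _ ltr01).
have k2 : \forall i \near \oo, `|1 - kap i| < e / (2 * (M + 1)).
  by apply: kapd; rewrite divr_gt0 // mulr_gt0 // ltr_wpDl.
apply: filterS (filterI near_hh (filterI k2 (filterI k1 (filterI lam0 hcl)))).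
move=> i [[smh _ _]] [k2i] [k1i] [l0 {}hcl] q Kq; have Uq := KU _ Kq.
have smh0 : smooth_on annU (fun q => hh (rr i) (lam i) c (q, 0) j k).
  by have := @smooth_slice _ _ annD 0 annD_upper _ (smh j k); rewrite slice0.
have lr0 : lam i / rr i != 0 by rewrite mulf_neq0 ?invr_eq0 ?gt_eqF.
have kap0 : kap i != 0 by rewrite expf_neq0.
have E : derivs_within CL s (fun q => (lam i ^+ 2)^-1 * pullback (closed_annulus R1 R2) (phi (lam i)) (gX 0) c q j k) q
  = (kap i)^-1 * derivs_within annU s (fun q => hh (rr i) (lam i) c (q, 0) j k) q.
  rewrite -(derivs_withinZ tU) //; apply/esym.
  apply: (@derivs_within_congr _ _ annU CL _ _ s annU annU_open UC _ _ Uq Uq) => y Uy _.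
  rewrite hh0E // mxE mulrA; congr (_ * _); rewrite /kap exprMn exprVn invfM invrK -mulrA.
  by rewrite divff ?mulr1 // expf_neq0 // gt_eqF.
have E2 : derivs_within CL s (fun q => cone_metric gY c q j k) q = derivs_within annU s (fun q => cone_metric gY c q j k) q.
  by apply/esym; apply: (@derivs_within_congr _ _ annU CL _ _ s annU annU_open UC _ _ Uq Uq).
have := hcl _ Kq.
have Mq := HM _ Kq; rewrite E E2 {E E2}.
set w := derivs_within annU s _ q; set a := derivs_within annU s _ q => wa.
have {}k2i : `|1 - kap i| * (M + 1) < e / 2.
  by move: k2i; rewrite invfM mulrA ltr_pdivlMr // ltr_wpDl.
have -> : w - a = kap i * ((kap i)^-1 * w - a) - (1 - kap i) * a by field.
apply: le_lt_trans (ler_normB _ _) _; rewrite [`|kap i * _|]normrM [`|(1 - _) * a|]normrM.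
have kb : `|kap i| <= 2.
  have -> : kap i = 1 - (1 - kap i) by ring.
  by apply: le_trans (ler_normB _ _) _; rewrite normr1; move: k1i; lra.
have h1 : `|kap i| * `|(kap i)^-1 * w - a| <= 2 * (e / 4).
  by apply: ler_pM => //; exact: ltW.
have h2 : `|1 - kap i| * `|a| <= `|1 - kap i| * (M + 1).
  by rewrite ler_wpM2l // (le_trans Mq) // lerDl.
by move: h1 h2 k2i; lra.
Qed.

Lemma hh_init_bound (K : set 'rV[R]_n.+1) (s : seq 'I_n.+1) : compact K -> K `<=` annU ->
  exists M : R, \forall i \near \oo, forall q k l, K q ->
   `|derivs_within annD [seq est j | j <- s] (fun y => hh (rr i) (lam i) c y k l) (q, 0)| <= M.
Proof.
move=> cK KU; pose ds := [seq (delta_mx 0 j : 'rV[R]_n.+1) | j <- s].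
have /choice[M HM] : forall kl : 'I_n.+1 * 'I_n.+1, exists M : R, forall q, K q ->
    `|derivs_within annU ds (fun q => cone_metric gY c q kl.1 kl.2) q| <= M.
  move=> [k l]; have [M _ HM] := compact_smooth_bound annU_open
    (smooth_diff (smooth_derivs ds (@cone_smoothU k l))) cK KU.
  by exists M.
exists (1 + \sum_kl `|M kl|).
have close : \forall i \near \oo, forall kl : 'I_n.+1 * 'I_n.+1, forall q, K q ->
   `|derivs_within annU ds (fun q => hh (rr i) (lam i) c (q, 0) kl.1 kl.2) q
     - derivs_within annU ds (fun q => cone_metric gY c q kl.1 kl.2) q| < 1.
  by apply: filter_forall => kl; exact: hh_init.
apply: filterS (filterI near_hh close) => i [[smh _ _] {}close] q k l Kq.
have Dq : annD (q, 0) by rewrite -[annD _]/([set q | annD (q, 0)] q) slice0; exact: KU.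
rewrite (derivs_within_slice _ annD_upper (smh k l) Dq) slice0.
have /= h1 := close (k, l) _ Kq; have /= h2 := HM (k, l) _ Kq.
have h3 : M (k, l) <= \sum_kl `|M kl|.
  by rewrite (bigD1 (k, l)) //= ler_wpDr ?ler_norm // sumr_ge0.
rewrite -[X in `|X|](subrK (derivs_within annU ds (fun q => cone_metric gY c q k l) q)).
by apply: le_trans (ler_normD _ _) _; apply: lerD (ltW h1) (le_trans h2 h3).
Qed.

(** The cone metric has bounded inverse on the compact [K], and the initial metrics are eventually
    as close to it as [tr_inv_close] demands. *)
Lemma hh_init_tr (K : set 'rV[R]_n.+1) : compact K -> K `<=` annU ->
  exists M : R, \forall i \near \oo, forall q, K q ->
    \tr (invmx (hh (rr i) (lam i) c (q, 0))) <= M.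
Proof.
move=> cK KU.
have cU q : annU q -> spd (cone_metric gY c q).
  by move=> /annU_sub[cq _ _]; exact: cone_metric_spd.
have sI := smooth_invmx tU cone_smoothU (fun q Uq => spd_unit (cU q Uq)).
have sT : smooth_on annU (fun q => \tr (invmx (cone_metric gY c q))).
  by apply: (smooth_sum tU) => k; exact: sI.
have [M M0 HM] := compact_smooth_bound annU_open (smooth_diff sT) cK KU.
pose M1 := n.+1%:R ^+ 3 * M + 1; have M10 : 0 < M1 by rewrite ltr_wpDl // mulr_ge0 // exprn_ge0.
exists (n.+1%:R * (2 * M1)).
have e0 : 0 < (2 * M1 * (n.+1%:R ^+ 2 + 1))^-1.
  by rewrite invr_gt0 !mulr_gt0 // ltr_wpDl // exprn_ge0.
have close : \forall i \near \oo, forall kl : 'I_n.+1 * 'I_n.+1, forall q, K q ->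
   `|hh (rr i) (lam i) c (q, 0) kl.1 kl.2 - cone_metric gY c q kl.1 kl.2| < (2 * M1 * (n.+1%:R ^+ 2 + 1))^-1.
  by apply: filter_forall => kl; exact: (hh_init [::]).
apply: filterS (filterI near_hh close) => i [[_ sp _] {}close] q Kq.
have Dq : annD (q, 0) by rewrite -[annD _]/([set q | annD (q, 0)] q) slice0; exact: KU.
apply: (tr_inv_close M10 (cU _ (KU _ Kq)) (sp _ Dq)) => [|k l].
  have := HM _ Kq; rewrite /M1 => h; apply: (@le_trans _ _ (n.+1%:R ^+ 3 * M)).
    by rewrite ler_wpM2l ?exprn_ge0 // (le_trans _ h) // ler_norm.
  by rewrite lerDl.
by apply/ltW; exact: (close (k, l)).
Qed.

Lemma annU_ball q : annU q -> exists2 d : R, 0 < d & forall q', `|q' - q| <= d -> annU q'.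
Proof.
move=> Uq; have /nbhs_normP[d /= d0 h] := open_nbhs_nbhs (conj annU_open Uq).
exists (d / 2); first by rewrite divr_gt0.
move=> q' dq; apply: h; rewrite /= distrC (le_lt_trans dq) // ltr_pdivrMr //.
by rewrite ltr_pMr // ltr1n.
Qed.

(** Along a segment the radius stays between its end values, and [btop] increases with the
    radius. *)
Lemma btop_box q0 d : (forall q, `|q - q0| <= d -> annU q) -> quasiconvex (box q0 d btop).
Proof.
move=> bU; apply: box_quasiconvex => q q' y /bU /annU_rad r0 /bU /annU_rad r0' /andP[y0 y1].
have -> : btop (q + y *: (q' - q)) =
    eps * (crad (q : 'rV[R]_(1 + n)) + y * (crad (q' : 'rV[R]_(1 + n)) - crad (q : 'rV[R]_(1 + n)))) ^+ 2.
  by rewrite /btop /crad !mxE.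
rewrite /btop; move: r0 r0'; set a := crad _; set b := crad _ => a0 b0.
have [ab|ba] := leP a b.
  apply: (@le_trans _ _ (eps * a ^+ 2)); first by rewrite ge_min lexx.
  have h : 0 <= y * (b - a) by rewrite mulr_ge0 // subr_ge0.
  rewrite ler_wpM2l ?(ltW eps0) // ler_pXn2r ?nnegrE ?(ltW a0) //; first by rewrite lerDl.
  by rewrite addr_ge0 // ltW.
apply: (@le_trans _ _ (eps * b ^+ 2)); first by rewrite ge_min lexx orbT.
have h : b <= a + y * (b - a).
  have -> : a + y * (b - a) = b + (1 - y) * (a - b) by ring.
  by rewrite lerDl mulr_ge0 // subr_ge0 // ltW.
rewrite ler_wpM2l ?(ltW eps0) // ler_pXn2r ?nnegrE ?(ltW b0) //.
by apply: le_trans h; exact: ltW.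
Qed.

Lemma hh_box_bounds q0 d : 0 <= d -> (forall q, `|q - q0| <= d -> annU q) ->
  [/\ box q0 d btop `<=` annD,
     forall s k l, bd (box q0 d btop)
       (fun i => derivs_within annD [seq ce j | j : cI (coords_st n.+1) <- s] (hf (fun i => hh (rr i) (lam i) c) k l i))
   & exists M : R, \forall i \near \oo, forall x, box q0 d btop x ->
       \tr (invmx (hh (rr i) (lam i) c x)) <= M].
Proof.
(* Radii in the box stay below [R2], which gives a common bound on the times. *)
move=> d0 bU; set E := box q0 d btop; pose T0 := eps * R2 ^+ 2.
have ED : E `<=` annD by move=> x [/bU Ux tx].
have Etime q t : E (q, t) -> 0 <= t <= T0 /\ (forall t', 0 <= t' <= t -> E (q, t')).
  move=> [/= qd /andP[t0 tb]]; split; last first.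
    by move=> t' /andP[t'0 t't]; split=> //=; rewrite t'0 (le_trans t't).
  rewrite t0 (le_trans tb) // /btop ler_wpM2l ?(ltW eps0) //.
  have /annU_sub[_ _ /andP[r1 r2]] := bU _ qd.
  have r0 := lt_trans R10 r1.
  by rewrite ler_pXn2r ?nnegrE ?(ltW r2) ?(ltW r0) // (ltW (lt_trans R10 R12)).
have cK := @cball_compact R n.+1 q0 d d0.
have E0 q : E (q, 0) -> [set q | `|q - q0| <= d] q by move=> [].
have s1 : \forall i \near \oo, smoothmx annD (hh (rr i) (lam i) c) by apply: filterS near_hh => i [].
have s2 : \forall i \near \oo, forall x, annD x -> spd (hh (rr i) (lam i) c x) by apply: filterS near_hh => i [].
have s3 : \forall i \near \oo, forall x k l, annD x -> deriv_within annD (0, 1) (fun y => hh (rr i) (lam i) c y k l) x =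
       - 2 * gricci annD est (hh (rr i) (lam i) c) k l x by apply: filterS near_hh => i [].
have s4 k : exists K : R, \forall i \near \oo, forall x, E x ->
  exists2 P : 'M[R]_n.+1, invmx (hh (rr i) (lam i) c x) = P *m P^T &
   forall L, size L = (4 + k)%N ->
   `|pull P^T L ((iter k (gnabla annD est (hh (rr i) (lam i) c))
                  (gRm annD est (hh (rr i) (lam i) c)))^~ x)| <= K.
  have [K HK] := near_curv k; exists K; apply: filterS HK => i h x Ex; exact: h (ED _ Ex).
have s5 (s : seq 'I_n.+1) : exists M : R, \forall i \near \oo, forall q k l, E (q, 0) ->
   `|derivs_within annD [seq est j | j <- s] (fun y => hh (rr i) (lam i) c y k l) (q, 0)| <= M.
  have [M HM] := hh_init_bound s cK bU; exists M; apply: filterS HM => i h q k l Eq.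
  exact: h (E0 _ Eq).
have s6 : exists M : R, \forall i \near \oo, forall q, E (q, 0) ->
    \tr (invmx (hh (rr i) (lam i) c (q, 0))) <= M.
  have [M HM] := hh_init_tr cK bU; exists M; apply: filterS HM => i h q Eq.
  exact: h (E0 _ Eq).
split=> //.
  exact: (flow_derivs_bd annD_upper ED Etime s1 s2 s3 s4 s5 s6).
exact: (tr_A_le annD_upper ED Etime s1 s2 s3 s4 s6).
Qed.

Lemma hh_locally_bounded k l :
  locally_bounded_derivs (coords_st n.+1) annD (fun i x => hh (rr i) (lam i) c x k l).
Proof.
move=> [q t] [/= Uq tq]; have [d d0 bU] := annU_ball Uq.
have [ED bds _] := hh_box_bounds (ltW d0) bU.
exists (box q d btop); split=> //.
- by split=> //=; rewrite subrr normr0 ltW.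
- exact: btop_box.
- apply/nbhs_normP; exists d => // y yq [Uy ty]; split=> //.
  by rewrite distrC; apply: le_trans (ltW yq); rewrite prod_normE /= le_max lexx.
- by move=> s; exact: bds.
Qed.

End Sequence.
End Annulus.

Lemma good_seq_sub rr lam (s : nat -> nat) : {homo s : i j / (i < j)%N} ->
  good_seq rr lam -> good_seq (rr \o s) (lam \o s).
Proof.
move=> ms [rr0 rroo lamoo lr dis]; have so := homo_cvg_oo ms; split.
- by move=> i; exact: rr0.
- exact: cvg_comp so rroo.
- exact: cvg_comp so lamoo.
- exact: (cvg_comp _ _ so lr).
- by move=> R1 R2 R10 R12; exact: (so _ (dis R1 R2 R10 R12)).
Qed.

Lemma hh_trans r l c c' R1 R2 x : 0 < R1 -> 0 < r ->
  smooth_embedding CA AX (open_annulus R1 R2) (phi l) ->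
  annD c R1 R2 x -> cdom c' (cinv c x.1) ->
  let J := jac (A := CA) (B := CA) setT id c c' x.1 in
  hh r l c x = J *m hh r l c' (cmap c' (cinv c x.1), x.2) *m J^T.
Proof.
move=> R10 r0 [sm _ _ _] Dx cx' J; have [cx Sx x20] := annD_sub Dx.
have oS := @open_annulus_open R1 R2.
have Dx' : annD c' R1 R2 (cmap c' (cinv c x.1), x.2).
  split; first by exists (cinv c x.1).
  have bE : btop (cmap c' (cinv c x.1)) = btop x.1.
    by rewrite /btop [crad _](rad_cmap c') cone_cinvE.
  by case: Dx => _; rewrite -bE.
have [fm _ _] := flow.
have ma : metric_at (gX (r^-1 ^- 2 * x.2)) (phi l (cinv c x.1)).
  by apply: fm => /=; rewrite mulr_ge0 // invr_ge0 exprn_ge0 // invr_ge0 ltW.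
rewrite (hhE R10 r l Dx) (hhE R10 r l Dx') /pflow /=.
rewrite (pullback_source gdC gdX oS sm (cone_trans gdY trY) trX cvX cx Sx ma cx') -/J.
by rewrite -scalemxAr -scalemxAl.
Qed.

Definition stdom (c : idx CA) : set ('rV[R]_n.+1 * R) := under_graph (cimg c) btop.

Lemma stdom_ann c x : stdom c x ->
  exists R1 R2, [/\ 0 < R1, R1 < R2 & annD c R1 R2 x].
Proof.
move=> [cx tx]; have := cx; rewrite cone_cimgE => -[r0 _].
set r := crad _ in r0; exists (r / 2), (r * 2); split; [by rewrite divr_gt0| |].
  by rewrite ltr_pdivrMr // -mulrA ltr_pMr // -natrM ltr1n.
split=> //; apply: annUP => //; rewrite -/r ltr_pdivrMr // andbb.
by rewrite ltr_pMr // ltr1n.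
Qed.

Lemma annD_stdom c R1 R2 : annD c R1 R2 `<=` stdom c.
Proof. by move=> x [/annU_sub[cx _ _] tx]. Qed.

(** The extraction looks at each dense point in one chosen chart only; the fixed Jacobian of the
    change of charts carries convergence to every other chart. *)
Lemma hh_trans_cvg rr lam (good : good_seq rr lam) c c' x : stdom c x ->
  cdom c' (cinv c x.1) ->
  (forall k l, cvgn (fun i => hh (rr i) (lam i) c' (cmap c' (cinv c x.1), x.2) k l)) ->
  forall k l, cvgn (fun i => hh (rr i) (lam i) c x k l).
Proof.
move=> /stdom_ann[R1 [R2 [R10 R12 Dx]]] cx' cv k l.
pose J := jac (A := CA) (B := CA) setT id c c' x.1.
pose H i := hh (rr i) (lam i) c' (cmap c' (cinv c x.1), x.2).
have cv' : cvgn (fun i => (J *m H i *m J^T) k l).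
  have -> : (fun i => (J *m H i *m J^T) k l) =
      (fun i => \sum_a \sum_b (J k b * J^T a l) * H i b a).
    apply/funext => i; rewrite mxE; apply: eq_bigr => a _; rewrite mxE mulr_suml.
    by apply: eq_bigr => b _; rewrite mulrAC.
  apply/cvg_ex; exists (\sum_a \sum_b (J k b * J^T a l) * limn (fun i => H i b a)).
  apply: cvg_rsum => a; apply: cvg_rsum => b.
  by apply: cvgM (cv b a); exact: cvg_cst.
apply/cvg_ex; exists (limn (fun i => (J *m H i *m J^T) k l)).
apply: cvg_trans cv'; apply: near_eq_cvg.
apply: filterS (near_embedding R10 R12 good) => i emb.
by rewrite (hh_trans R10 _ emb Dx cx') //; have [] := good.
Qed.

(** On a box around the given point the metrics have a common Lipschitz constant, so their values
    there are approximated, uniformly in the index, by values at a point with rational radius,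
    rational time and link coordinate in the dense sequence. *)
Lemma hh_dense_cvg rr lam (good : good_seq rr lam) (y : nat -> option Y)
  (dy : forall (p : Y) (A : set Y), nbhs p A -> exists k x, y k = Some x /\ A x)
  (cv : forall m z (a b : rat), y m = Some z -> 0 < (ratr a : R) ->
     0 <= (ratr b : R) <= eps * ratr a ^+ 2 ->
     exists2 c : idx CA, cdom c (ratr a, z) &
      forall k l, cvgn (fun i => hh (rr i) (lam i) c (cmap c (ratr a, z), ratr b) k l)) :
  forall c x k l, stdom c x -> cvgn (fun i => hh (rr i) (lam i) c x k l).
Proof.
move=> c [q t] k l stx; have [R1 [R2 [R10 R12 Dx]]] := stdom_ann stx.
have [/= Uq /andP[t0 tb]] := Dx; have [d d0 bU] := annU_ball Uq.
have [ED bds _] := hh_box_bounds R10 R12 good (ltW d0) bU.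
have /choice[M HM] : forall j : cI (coords_st n.+1), exists M : R, \forall i \near \oo,
   forall x, box q d btop x -> `|deriv_within (annD c R1 R2) (ce j) (fun y => hh (rr i) (lam i) c y k l) x| <= M.
  by move=> j; exact: (bds [:: j] k l).
pose M0 := \sum_j `|M j|; have M00 : 0 <= M0 by apply: sumr_ge0.
pose L := path_cst (coords_st n.+1) * M0.
have tD := upper_st_thick (@annD_upper c R1 R2 R10).
apply: cvgn_approx => e e0.
pose de := Num.min d (e / (`|L| + 1)).
have de0 : 0 < de by rewrite lt_min d0 divr_gt0 // ltr_wpDl.
have cq : cimg c q by case: stx.
have rq := annU_rad R10 Uq; set ra := crad (q : 'rV[R]_(1 + n)) in rq.
(* A radius strictly larger than [ra] raises the top of the time interval above [t], even when
   [t = eps * ra^2], and so leaves room for a rational time. *)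
have [a /andP[ra1 ra2]] : exists a : rat, ra < ratr a < ra + de.
  by have [a] := @rat_in_itvoo R ra (ra + de) (ltr_pwDr de0 (lexx _)); rewrite in_itv; exists a.
have ara : eps * ra ^+ 2 < eps * ratr a ^+ 2.
  by rewrite ltr_pM2l // ltr_pXn2r // ?nnegrE ltW // (lt_trans rq).
have [b /andP[tb1 tb2]] : exists b : rat, t < ratr b < Num.min (t + de) (eps * ratr a ^+ 2).
  have h : t < Num.min (t + de) (eps * ratr a ^+ 2).
    by rewrite lt_min ltrDl de0 (le_lt_trans tb).
  by have [b] := @rat_in_itvoo R _ _ h; rewrite in_itv; exists b.
move: tb2; rewrite lt_min => /andP[tb2 tb3].
pose z0 := (cinv c q).2.
have cz0 : cdom (c : idx AY) z0 by have := cimg_dom (gdC c) cq; case.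
have [m [z [ym [cz zde]]]] := dy _ _ (cmap_near (gdY c) cz0 de0).
have a0 : 0 < (ratr a : R) := lt_trans rq ra1.
have b0 : 0 <= (ratr b : R) <= eps * ratr a ^+ 2 by rewrite !ltW // (le_lt_trans t0).
have [c' cc' cv'] := cv m z a b ym a0 b0.
pose q' := cmap c (ratr a : R, z).
have ccz : cdom (c : idx CA) (ratr a, z) by split.
have q'K : cinv c q' = (ratr a, z) by rewrite (cdomK (gdC c)).
have bq' : btop q' = eps * ratr a ^+ 2 by rewrite /btop [crad _](rad_cmap c).
have qq' : `|q' - q| <= de.
  have qE : q = row_mx (ra%:M : 'rV[R]_1) (cmap (c : idx AY) z0).
    by rewrite -[LHS](row_rad (q : 'rV[R]_(1 + n))) -/ra -(rsub_cmap c (cinv c q)) (cimgK (gdC c)).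
  apply: row_norm_le; first exact: ltW.
  move=> j; have -> : (q' - q) 0 j = row_mx ((ratr a)%:M : 'rV[R]_1) (cmap (c : idx AY) z) 0 (j : 'I_(1 + n))
      - row_mx (ra%:M : 'rV[R]_1) (cmap (c : idx AY) z0) 0 (j : 'I_(1 + n)).
    by rewrite mxE [X in _ + X]mxE qE.
  case: (split_ordP (j : 'I_(1 + n))) => j' ->.
    rewrite !row_mxEl !mxE ord1 eqxx !mulr1n ger0_norm; first by move: ra1 ra2; lra.
    by rewrite subr_ge0 ltW.
  rewrite !row_mxEr; apply: le_trans (ltW zde).
  by have := row_entry_le (cmap (c : idx AY) z - cmap (c : idx AY) z0) j'; rewrite !mxE.
have Ez : box q d btop (q', ratr b).
  split; first by apply: le_trans qq' _; rewrite ge_min lexx.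
  by rewrite -[(q', ratr b).1]/q' bq'.
have Ex : box q d btop (q, t).
  by split; [rewrite subrr normr0 ltW|rewrite t0].
have stz : stdom c (q', ratr b).
  by split; [exists (ratr a, z)|rewrite -[(q', ratr b).1]/q' bq'].
exists (fun i => hh (rr i) (lam i) c (q', ratr b) k l).
  apply: (hh_trans_cvg good stz (c' := c')); rewrite -[(q', ratr b).1]/q' q'K //.
have HMa : \forall i \near \oo, forall j x, box q d btop x ->
   `|deriv_within (annD c R1 R2) (ce (c := coords_st n.+1) j) (fun y => hh (rr i) (lam i) c y k l) x| <= M j.
  exact: filter_forall.
apply: filterS (filterI HMa (near_hh c R10 R12 good)) => i [bi [smi _ _]].
rewrite distrC.
have zx : `|(q', ratr b : R) - (q, t)| <= de.
  rewrite prod_normE /= ge_max qq' ger0_norm; first by move: tb1 tb2; lra.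
  by rewrite subr_ge0 ltW.
have := path_lip tD ED (btop_box R10 bU) (smooth_diff (smi k l)) M00 Ex Ez.
move=> /(_ _) h; apply: le_trans (h _) _.
  move=> j x' Ex' _; apply: le_trans (bi j x' Ex') _.
  by rewrite /M0 (bigD1 j) //= ler_wpDr ?ler_norm // sumr_ge0.
rewrite -/L; apply: (@le_trans _ _ (`|L| * de)).
  by apply: le_trans (ler_wpM2r _ (ler_norm L)) _ => //; exact: ler_wpM2l.
apply: (@le_trans _ _ ((`|L| + 1) * (e / (`|L| + 1)))).
  by apply: ler_pM; rewrite ?(ltW de0) ?lerDl // ge_min lexx orbT.
by rewrite mulrC divfK // gt_eqF // ltr_wpDl.
Qed.

Lemma hh_extraction rr lam (good : good_seq rr lam) : @second_countable Y ->
  exists2 s : nat -> nat, {homo s : i j / (i < j)%N} &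
   forall c x k l, stdom c x -> cvgn (fun i => hh (rr (s i)) (lam (s i)) c x k l).
Proof.
move=> /dense_sequence[y dy]; have /choice[ch Hch] := cvY.
pose T : countType := (nat * rat * rat * 'I_n.+1 * 'I_n.+1)%type.
(* Codes that name no point of the space-time domain get the zero sequence, which is bounded. *)
pose u (a : T) i := let: (m, a, b, k, l) := a in
  if y m is Some z then
    if (0 < (ratr a : R)) && (0 <= (ratr b : R) <= eps * ratr a ^+ 2) then
      hh (rr i) (lam i) (ch z : idx CA) (cmap (ch z : idx CA) (ratr a : R, z), ratr b) k l else 0 else 0.
have st m z (a b : rat) : y m = Some z -> 0 < (ratr a : R) ->
     0 <= (ratr b : R) <= eps * ratr a ^+ 2 -> stdom (ch z) (cmap (ch z : idx CA) (ratr a : R, z), ratr b).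
  move=> ym a0 b0; split; first by exists (ratr a, z) => //; split.
  have bE : btop (cmap (ch z : idx CA) (ratr a : R, z)) = eps * ratr a ^+ 2.
    by rewrite /btop [crad _](rad_cmap (ch z)).
  suff : 0 <= (ratr b : R) <= btop (cmap (ch z : idx CA) (ratr a : R, z)) by [].
  by rewrite bE.
have [|s ms cs] := @countable_extraction R T u.
  move=> [[[[m a] b] k] l]; rewrite /u; case ym: (y m) => [z|]; last first.
    by exists 0; apply: nearW => i; rewrite normr0.
  case: (boolP ((0 < (ratr a : R)) && (0 <= (ratr b : R) <= eps * ratr a ^+ 2))) => [/andP[a0 b0]|_]; last first.
    by exists 0; apply: nearW => i; rewrite normr0.
  have [R1 [R2 [R10 R12 Dx]]] := stdom_ann (st m z a b ym a0 b0).
  have [E [_ Ex _ _ /(_ [::])[M HM]]] := hh_locally_bounded R10 R12 good k l Dx.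
  by exists M; apply: filterS HM => i; exact.
exists s => //; apply: (hh_dense_cvg (good_seq_sub ms good) dy) => m z a b ym a0 b0.
exists (ch z); first by split.
by move=> k l; have := cs (m, a, b, k, l); rewrite /u ym a0 b0.
Qed.

(** * The limit flow *)

Section Limit.
Variables (rr lam : nat -> R).
Hypothesis good : good_seq rr lam.
Hypothesis cv : forall c x k l, stdom c x -> cvgn (fun i => hh (rr i) (lam i) c x k l).

Definition glim (t : R) (c : idx CA) (q : 'rV[R]_n.+1) : 'M[R]_n.+1 :=
  \matrix_(k, l) limn (fun i => hh (rr i) (lam i) c (q, t) k l).

Let glx c (x : 'rV[R]_n.+1 * R) : 'M[R]_n.+1 := glim x.2 c x.1.

Lemma glim_cvg c x k l : stdom c x ->
  hh (rr i) (lam i) c x k l @[i --> \oo] --> glim x.2 c x.1 k l.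
Proof. by rewrite mxE -surjective_pairing; exact: cv. Qed.

Lemma glim_limit c R1 R2 k l : 0 < R1 -> R1 < R2 ->
  [/\ smooth_on (annD c R1 R2) (fun x => glx c x k l),
      forall (s : seq (cI (coords_st n.+1))) x, annD c R1 R2 x ->
        derivs_within (annD c R1 R2) [seq ce j | j <- s] (fun y => hh (rr i) (lam i) c y k l) x
          @[i --> \oo] -->
        derivs_within (annD c R1 R2) [seq ce j | j <- s] (fun y => glx c y k l) x
    & smooth_cvg_on \oo (annD c R1 R2) (fun i x => hh (rr i) (lam i) c x k l)
        (fun x => glx c x k l)].
Proof.
move=> R10 R12.
have sm : \forall i \near \oo, smooth_on (annD c R1 R2) (fun x => hh (rr i) (lam i) c x k l).
  by apply: filterS (near_hh c R10 R12 good) => i [+ _ _]; exact.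
have pc p : annD c R1 R2 p -> cvgn (fun i => hh (rr i) (lam i) c p k l).
  by move=> /annD_stdom; exact: cv.
have := smooth_limit (upper_st_corner (@annD_upper c R1 R2 R10)) sm (hh_locally_bounded R10 R12 good k l) pc.
have -> : limder (B := coords_st n.+1) (annD c R1 R2) (fun i x => hh (rr i) (lam i) c x k l) [::] =
    (fun x => glx c x k l).
  by apply/funext => x; rewrite /glx /glim mxE -surjective_pairing.
by [].
Qed.

(** A limit of positive definite matrices might degenerate; the uniform bound on the trace of the
    inverse gives [|v|^2 <= K * (v h v^T)] with one constant [K], and this survives in the limit. *)
Lemma glim_spd c x : stdom c x -> spd (glx c x).
Proof.
move=> stx; have [R1 [R2 [R10 R12 Dx]]] := stdom_ann stx.
have gc k l := @glim_cvg c x k l stx.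
have nh := near_hh c R10 R12 good; split.
  apply/matrixP => k l; rewrite mxE; apply: (cvgn_unique (gc l k)).
  apply: cvg_near_eq (gc k l); apply: filterS nh => i [_ /(_ x Dx)[sy _] _].
  by have := congr1 (fun A : 'M[R]_n.+1 => A k l) sy; rewrite mxE.
move=> v v0; have [/= Uq tq] := Dx; have [d d0 bU] := annU_ball Uq.
have [_ _ [M HM]] := hh_box_bounds R10 R12 good (ltW d0) bU.
have Ex : box x.1 d btop x by split=> //; rewrite subrr normr0 ltW.
pose K := n.+1%:R ^+ 3 * `|M|.
have qcv : (v *m hh (rr i) (lam i) c x *m v^T) 0 0 @[i --> \oo] --> (v *m glx c x *m v^T) 0 0.
  have E (A : 'M[R]_n.+1) : (v *m A *m v^T) 0 0 = \sum_a \sum_b (v 0 b * v 0 a) * A b a.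
    rewrite mxE; apply: eq_bigr => a _; rewrite !mxE mulr_suml.
    by apply: eq_bigr => b _; rewrite mulrAC.
  rewrite E (_ : (fun i => _) = (fun i => \sum_a \sum_b (v 0 b * v 0 a) * hh (rr i) (lam i) c x b a)).
    by apply: cvg_rsum => a; apply: cvg_rsum => b; apply: cvgM (gc b a); exact: cvg_cst.
  by apply/funext => i; rewrite E.
have low : (v *m v^T) 0 0 <= K * (v *m glx c x *m v^T) 0 0.
  have kc : K * (v *m hh (rr i) (lam i) c x *m v^T) 0 0 @[i --> \oo] --> K * (v *m glx c x *m v^T) 0 0.
    by apply: cvgM qcv; exact: cvg_cst.
  apply: (@cvgr_to_ge _ _ _ _ _ _ _ kc); apply: filterS (filterI HM nh) => i [hM [_ sp _]].
  have spx := sp x Dx; apply: le_trans (spd_lower v spx) _.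
  rewrite ler_wpM2r //; first by have [_ /(_ v v0) /ltW] := spx.
  by rewrite ler_wpM2l ?exprn_ge0 // (le_trans (hM x Ex)) // ler_norm.
have K0 : 0 <= K by rewrite mulr_ge0 // exprn_ge0.
move: (lt_le_trans (row_sqr_gt0 v0) low); case: (ltgtP K 0) K0 => // [K0 _|-> _].
  by rewrite pmulr_rgt0.
by rewrite mul0r ltxx.
Qed.

(** Both sides of the flow equation of [hh] converge: the time derivative by [glim_limit], the Ricci
    tensor by [gricci_cvg]. *)
Lemma glim_flow c R1 R2 x k l : 0 < R1 -> R1 < R2 -> annD c R1 R2 x ->
  deriv_within (annD c R1 R2) (0, 1) (fun y => glx c y k l) x
  = - 2 * gricci (annD c R1 R2) est (glx c) k l x.
Proof.
move=> R10 R12 Dx; have nh := near_hh c R10 R12 good.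
have tD := upper_st_thick (@annD_upper c R1 R2 R10).
have [_ /(_ [:: None] x Dx) h1 _] := @glim_limit c R1 R2 k l R10 R12.
have h2 : gricci (annD c R1 R2) est (hh (rr i) (lam i) c) k l x @[i --> \oo] -->
    gricci (annD c R1 R2) est (glx c) k l x.
  apply: (gricci_cvg tD) => //.
  - by apply: filterS nh => i [].
  - by move=> a b; have [] := @glim_limit c R1 R2 a b R10 R12.
  - by apply: filterS nh => i [_ sp _] y Dy; exact: spd_unit (sp y Dy).
  - by move=> y Dy; apply: spd_unit; apply: glim_spd; exact: annD_stdom Dy.
  - move=> s a b y Dy; have [_ /(_ (map Some s) y Dy) + _] := @glim_limit c R1 R2 a b R10 R12.
    by rewrite -map_comp.
have h3 : -2 * gricci (annD c R1 R2) est (hh (rr i) (lam i) c) k l x @[i --> \oo] -->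
    -2 * gricci (annD c R1 R2) est (glx c) k l x.
  by apply: cvgM h2; exact: cvg_cst.
apply: (cvgn_unique h1); apply: cvg_near_eq h3.
by apply: filterS nh => i [_ _ fl]; exact: fl.
Qed.

Lemma glim_trans c c' x : stdom c x -> cdom c' (cinv c x.1) ->
  let J := jac (A := CA) (B := CA) setT id c c' x.1 in
  glim x.2 c x.1 = J *m glim x.2 c' (cmap c' (cinv c x.1)) *m J^T.
Proof.
move=> stx cx' J; have [R1 [R2 [R10 R12 Dx]]] := stdom_ann stx.
pose q' := cmap c' (cinv c x.1).
have stx' : stdom c' (q', x.2).
  split; first by exists (cinv c x.1).
  have bE : btop q' = btop x.1 by rewrite /btop [crad _](rad_cmap c') cone_cinvE.
  by case: stx => _; rewrite -bE.
apply/matrixP => k l; apply: (cvgn_unique (@glim_cvg c x k l stx)).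
have E (A : 'M[R]_n.+1) : (J *m A *m J^T) k l = \sum_a \sum_b (J k b * J^T a l) * A b a.
  rewrite mxE; apply: eq_bigr => a _; rewrite mxE mulr_suml.
  by apply: eq_bigr => b _; rewrite mulrAC.
rewrite E; apply: (@cvg_near_eq _ _ (fun i => \sum_a \sum_b (J k b * J^T a l) * hh (rr i) (lam i) c' (q', x.2) b a)).
  apply: filterS (near_embedding R10 R12 good) => i emb.
  by rewrite -E (hh_trans R10 _ emb Dx cx') //; have [] := good.
apply: cvg_rsum => a; apply: cvg_rsum => b; apply: cvgM (@glim_cvg c' (q', x.2) b a stx').
exact: cvg_cst.
Qed.

Lemma glim0 c q : cimg c q -> glim 0 c q = cone_metric gY c q.
Proof.
move=> cq; have st0 : stdom c (q, 0).
  by split=> //=; rewrite lexx mulr_ge0 ?(ltW eps0) // sqr_ge0.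
have [R1 [R2 [R10 R12 [Uq _]]]] := stdom_ann st0.
apply/matrixP => k l; apply: (cvgn_unique (@glim_cvg c (q, 0) k l st0)).
apply/cvgrPdist_lt => e e0.
have qU : [set q] `<=` annU c R1 R2 by move=> q' ->.
have := hh_init R10 R12 good [::] k l (@compact_set1 _ q) qU e0.
by apply: filterS => i /(_ q erefl); rewrite distrC.
Qed.

Lemma stdom_upper c : upper_st (stdom c).
Proof.
have [_ oc _ _ _] := gdC c; have cr q : cimg c q -> 0 < crad (q : 'rV[R]_(1 + n)).
  by rewrite cone_cimgE => -[].
apply: under_graph_upper oc _ _ => [q /cr q0|q q' /cr q0 /cr q0' qq'].
  by rewrite mulr_gt0 // exprn_gt0.
rewrite ler_wpM2l ?(ltW eps0) //.
by rewrite ler_pXn2r ?nnegrE ?(ltW q0) ?(ltW q0') //; exact: qq'.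
Qed.

Let W : set ((R * Y) * R) := [set p | 0 < p.1.1 /\ 0 <= p.2 <= eps * cone_dist gY (Some p.1) None ^+ 2].

Lemma stdomE c : spacetime_chart (A := CA) W c = stdom c.
Proof.
apply/seteqP; split=> [_ [[p t] [[p0 tp] cp] <-]|[q t] [cq tq]].
  split; first by exists p.
  by rewrite /btop [crad _](rad_cmap c).
exists (cinv c q, t); last by congr (_, _); exact: (cimgK (gdC c) cq).
have cd := cimg_dom (gdC c) cq; split=> //; split; first by case: cd.
have rE : (cinv c q).1 = crad (q : 'rV[R]_(1 + n)) by rewrite cone_cinvE.
suff : 0 <= t <= eps * (cinv c q).1 ^+ 2 by [].
by rewrite rE; exact: tq.
Qed.

(** An open set in space-time over which the domain of the annulus and that of the whole cone
    coincide, so that derivatives and curvature relative to the two agree there. *)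
Let annO c R1 R2 : set ('rV[R]_n.+1 * R) := [set x | annU c R1 R2 x.1].

Lemma annO_open c R1 R2 : open (annO c R1 R2).
Proof. by apply: open_comp (@annU_open c R1 R2) => x _; exact: cvg_fst. Qed.

Lemma annO_stdom c R1 R2 x : annO c R1 R2 x -> annD c R1 R2 x <-> stdom c x.
Proof. by move=> Ox; split=> [/annD_stdom//|[_ tx]]. Qed.

Lemma glim_smooth c : smoothmx (stdom c) (glx c).
Proof.
move=> k l; apply: smooth_local => x stx; have [R1 [R2 [R10 R12 Dx]]] := stdom_ann stx.
exists (annO c R1 R2); split; [exact: annO_open|by case: Dx|].
have -> : stdom c `&` annO c R1 R2 = annD c R1 R2.
  apply/seteqP; split=> [y [sy Oy]|y Dy]; first by apply/annO_stdom.
  by split; [exact: annD_stdom Dy|case: Dy].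
by have [] := @glim_limit c R1 R2 k l R10 R12.
Qed.

Lemma glim_ricci_flow : ricci_flow W glim.
Proof.
split.
- move=> p t [/= p0 tp] c cp; have stx : stdom c (cmap c p, t).
    by rewrite -stdomE; exists (p, t).
  have [sy po] := glim_spd stx; split=> // c' cp' J.
  have := @glim_trans c c' _ stx; rewrite [(_, t).1]/= [(_, t).2]/= (cdomK (gdC c)) //; exact.
- by move=> c k l; rewrite stdomE; exact: glim_smooth.
move=> c q t k l; rewrite stdomE => stx.
have [R1 [R2 [R10 R12 Dx]]] := stdom_ann stx.
have Ox : annO c R1 R2 (q, t) by case: Dx.
have oO := @annO_open c R1 R2.
have := @glim_flow c R1 R2 (q, t) k l R10 R12 Dx.
have -> : deriv_within (annD c R1 R2) (0, 1) (fun y => glx c y k l) (q, t)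
   = deriv_within (stdom c) (0, 1) (fun y => glx c y k l) (q, t).
  pose f (y : 'rV[R]_n.+1 * R) := glx c y k l.
  exact: (@derivs_within_congr _ _ (annD c R1 R2) (stdom c) f f [:: (0, 1)] _ oO
    (@annO_stdom c R1 R2) (fun _ _ _ => erefl) _ Ox Dx).
have -> : gricci (annD c R1 R2) est (glx c) k l (q, t) = gricci (stdom c) est (glx c) k l (q, t).
  exact: (gricci_local est oO (@annO_stdom c R1 R2) (fun _ _ _ => erefl)).
move=> ->; congr (_ * _); apply/esym.
apply: (@ricci_slice _ _ (stdom c) (glx c) t (@stdom_upper c) (@glim_smooth c)) => //.
by move=> x sx; apply: spd_unit; exact: glim_spd.
Qed.

(** The domain with flat top [eps * R1^2] is contained in the one with top [eps * r^2], since
    [r > R1] on the annulus; derivatives relative to the two agree by thickness. *)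
Lemma glim_annulus_cvg c R1 R2 j k : 0 < R1 -> R1 < R2 ->
  smooth_cvg_on \oo
    (spacetime_chart (A := CA) [set p : (R * Y) * R | open_annulus R1 R2 p.1 /\
                  0 <= p.2 <= eps * R1 ^+ 2] c)
    (fun (i : nat) p => (rr i ^+ 2)^-1 *
        pullback (open_annulus R1 R2) (phi (lam i)) (gX (rr i ^+ 2 * p.2)) c p.1 j k)
    (fun p => glim p.2 c p.1 j k).
Proof.
move=> R10 R12.
have -> : spacetime_chart (A := CA) [set p : (R * Y) * R | open_annulus R1 R2 p.1 /\
    0 <= p.2 <= eps * R1 ^+ 2] c = under_graph (annU c R1 R2) (fun=> eps * R1 ^+ 2).
  apply/seteqP; split=> [_ [[p t] [[p0 tp] cp] <-]|[q t] [[p [Sp cp] pq] tq]].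
    by split=> //; exists p.
  by exists (p, t) => //; congr (_, _).
set D := under_graph _ _.
have DA : D `<=` annD c R1 R2.
  move=> x [Ux /andP[t0 tb]]; split=> //; rewrite t0 (le_trans tb) // ler_wpM2l ?(ltW eps0) //.
  have [_ _ /andP[/ltW r1 _]] := annU_sub Ux.
  by rewrite ler_pXn2r ?nnegrE ?(ltW R10) // (le_trans (ltW R10)).
have uD : upper_st D.
  apply: under_graph_upper (@annU_open c R1 R2) _ _ => // q _.
  by rewrite mulr_gt0 // exprn_gt0.
have tD := upper_st_thick uD; have tA := upper_st_thick (@annD_upper c R1 R2 R10).
have [sg _ cvA] := @glim_limit c R1 R2 j k R10 R12.
move=> K s e cK KD e0.
have KA : K `<=` annD c R1 R2 by move=> x /KD /DA.
apply: filterS (filterI (near_hh c R10 R12 good) (cvA K s e cK KA e0)) => i [[sm _ _] h] x Kx.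
have := h x Kx; rewrite -(derivs_restrict tA tD DA s (sm j k) (KD x Kx)).
rewrite -(derivs_restrict tA tD DA s sg (KD x Kx)); congr (`|_ - _| < e).
apply: eq_derivs_within (KD x Kx) => y /DA Dy.
by rewrite (hhE R10 _ _ Dy) /pflow mxE exprVn invrK.
Qed.

End Limit.

(** With [h = 1 / (i + 1)] the enlargement [1 + h] of the scale has an effect of order [h], which
    beats a scaled distance error of order [h^2], while [lam / r = 1 + h] still tends to 1. *)
Lemma good_subsequence (r : nat -> R) : pointed_GH_cvg (gX 0) x0 gY F ->
  r i @[i --> \oo] --> +oo ->
  exists2 s : nat -> nat, {homo s : i j / (i < j)%N} & exists lam, good_seq (r \o s) lam.
Proof.
move=> [F0 gh] roo; pose h (i : nat) : R := i.+1%:R^-1.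
have h0 i : 0 < h i by rewrite invr_gt0.
have h1 i : h i <= 1 by rewrite invf_le1 // ler1n.
(* [L i] is a scale beyond which the Gromov-Hausdorff error on the ball of radius [i + 1] is below
   [h i ^ 2]. *)
have /choice[L HL] : forall i : nat, exists L : R, forall l, L < l ->
    forall p : R * Y, 0 < p.1 -> p.1 < i.+1%:R ->
    `|dist (gX 0) (phi l p) x0 / l - p.1| < h i ^+ 2.
  move=> i; have [|L [_ HL]] := gh i.+1%:R (h i ^+ 2) _ (exprn_gt0 2 (h0 i)); first by [].
  exists L => l Ll p p0 pm; have [H _] := HL l Ll.
  by have := H (Some p) None; rewrite F0; apply=> //; case: {pm} p p0.
have [s ms Ps] : exists2 s : nat -> nat, {homo s : i j / (i < j)%N} &
    forall i, 0 < r (s i) /\ L i < r (s i).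
  apply: (@increasing_choice (fun i m => 0 < r m /\ L i < r m)) => i.
  apply: filterI; first exact: (roo _ (nbhs_pinfty_gt (num_real _))).
  exact: (roo _ (nbhs_pinfty_gt (num_real _))).
have hc : h i @[i --> \oo] --> (0 : R) by exact: cvg_harmonic.
have rsoo : r (s i) @[i --> \oo] --> +oo := cvg_comp _ _ (homo_cvg_oo ms) roo.
exists s => //; exists (fun i => (1 + h i) * r (s i)).
have rs0 i : 0 < r (s i) by case: (Ps i).
have lr i : r (s i) <= (1 + h i) * r (s i) by rewrite ler_peMl ?(ltW (rs0 i)) // lerDl ltW.
split=> //.
- apply/cvgryPge => A; move/cvgryPge: rsoo => /(_ A); apply: filterS => i Ai.
  exact: le_trans Ai (lr i).
- rewrite (_ : (fun i => _) = (fun i => 1 + h i)); last first.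
    by apply/funext => i; rewrite /= mulfK // gt_eqF.
  by rewrite -[X in _ --> X]addr0; apply: cvgD hc; exact: cvg_cst.
move=> R1 R2 R10 R12; have R20 := lt_trans R10 R12.
(* [h < R1 / 2] makes [p - h - h^2] nonnegative on the annulus; [h < 1 / R2] puts the annulus inside
   the ball of radius [i + 1]. *)
have e0 : 0 < Num.min (R1 / 2) R2^-1 by rewrite lt_min divr_gt0 //= invr_gt0.
move/cvgrPdist_lt: hc => /(_ _ e0); apply: filterS => i.
rewrite sub0r normrN (gtr0_norm (h0 i)) lt_min => /andP[hR1 hR2] p /andP[p1 p2].
have p0 : 0 < p.1 := lt_le_trans R10 p1.
have pm : p.1 < i.+1%:R.
  by apply: le_lt_trans p2 _; rewrite -ltf_pV2 ?posrE // ltr0Sn.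
have l0 : 0 < (1 + h i) * r (s i) by exact: lt_le_trans (lr i).
have := HL i _ (lt_le_trans (Ps i).2 (lr i)) p p0 pm.
rewrite ltr_norml => /andP[+ _]; rewrite ltrBrDl ltr_pdivlMr //= => /ltW; apply: le_trans.
rewrite mulrA -subr_ge0.
have -> : (p.1 + - h i ^+ 2) * (1 + h i) * r (s i) - r (s i) * p.1 =
   r (s i) * h i * (p.1 - h i - h i * h i) by ring.
rewrite mulr_ge0 ?mulr_ge0 ?(ltW (h0 i)) ?(ltW (rs0 i)) //.
have hh1 : h i * h i <= h i by rewrite ler_piMr // ltW.
by move: hh1 hR1 p1; lra.
Qed.

End Blowdown.

Theorem proposition5p6 (R : realType) (n : nat) (X Y : topologicalType)
    (AX : atlas R n.+1 X) (AY : atlas R n Y)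
    (gX : R -> metric AX) (gY : metric AY) (x0 : X) (eps : R)
    (X_manifold : smooth_manifold AX)
    (X_connected : connected [set: X])
    (Y_manifold : smooth_manifold AY)
    (Y_compact : compact [set: Y])
    (gY_metric : riemannian_metric gY)
    (gX_flow : ricci_flow [set p : X * R | 0 <= p.2] gX)
    (gX_complete : forall t : R, 0 <= t -> complete_metric (gX t))
    (gX_bounded : forall T : R, exists K : R, forall (x : X) (t : R),
       0 <= t <= T -> nablaRm_le (gX t) 0 x K)
    (gX_conical : asymptotically_conical (gX 0) x0 gY)
    (eps_gt0 : 0 < eps)
    (eps_decay : exists (rad : R) (C : nat -> R), 0 < rad /\
       forall (k : nat) (x : X) (t : R),
         rad <= dist (gX 0) x x0 ->
         0 <= t <= eps * dist (gX 0) x x0 ^+ 2 ->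
         nablaRm_le (gX t) k x (C k * dist (gX 0) x x0 ^- (2 + k))) :
  forall r : nat -> R, r i @[i --> \oo] --> +oo ->
  exists s : nat -> nat, {homo s : i j / (i < j)%N} /\
  exists ginf : R -> metric (cone_atlas AY),
  [/\ ricci_flow
        [set p : (R * Y) * R | 0 < p.1.1 /\
           0 <= p.2 <= eps * cone_dist gY (Some p.1) None ^+ 2] ginf,
      forall (c : idx (cone_atlas AY)) (q : 'rV[R]_(n.+1)),
        (cmap c @` cdom c) q -> ginf 0 c q = cone_metric gY c q
    & forall R1 R2 : R, 0 < R1 -> R1 < R2 ->
      exists phi : nat -> R * Y -> X,
        (\forall i \near \oo,
           smooth_embedding (cone_atlas AY) AX (open_annulus R1 R2) (phi i)) /\
        forall (c : idx (cone_atlas AY)) (j k : 'I_(n.+1)),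
          smooth_cvg_on \oo
            (spacetime_chart
               [set p : (R * Y) * R | open_annulus R1 R2 p.1 /\
                  0 <= p.2 <= eps * R1 ^+ 2] c)
            (fun (i : nat) p => (r (s i) ^+ 2)^-1 *
               pullback (open_annulus R1 R2) (phi i)
                 (gX (r (s i) ^+ 2 * p.2)) c p.1 j k)
            (fun p => ginf p.2 c p.1 j k)].
Proof.
move=> r roo.
have [_ _ cvX gdX trX] := X_manifold; have [_ scY cvY gdY trY] := Y_manifold.
have [F [gh SM]] := gX_conical; have [rd [C [_ decay]]] := eps_decay.
(* Two extractions are composed: [s1] produces admissible scales, [s2] makes the pulled back metrics
   converge. *)
have [s1 ms1 [lam good]] := good_subsequence gh roo.
have [s2 ms2 cv] := hh_extraction gdX trX cvX gdY trY cvY gY_metric gX_flow eps_gt0 SM decay good scY.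
have good2 := good_seq_sub ms2 good.
exists (s1 \o s2); split; first by move=> i j ij; apply: ms1; exact: ms2.
exists (glim gX F (r \o s1 \o s2) (lam \o s2)); split.
- exact: (glim_ricci_flow gdX trX cvX gdY trY gY_metric gX_flow eps_gt0 SM decay good2 cv).
- move=> c q cq.
  exact: (glim0 gdX trX cvX gdY gY_metric gX_flow eps_gt0 SM good2 cv cq).
move=> R1 R2 R10 R12; exists (fun i => phi F (lam (s2 i))); split.
  exact: (near_embedding gdY SM R10 R12 good2).
move=> c j k.
exact: (glim_annulus_cvg gdX trX cvX gdY gY_metric gX_flow eps_gt0 SM decay good2 cv j k R10 R12).
Qed.
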